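(* Let $M$ be the 5-manifold with coordinates $(x,y,z,p,r)$ carrying the para-CR structure of a completely integrable PDE system $z_y=F(x,y,z,z_x)$, $z_{xxx}=H(x,y,z,z_x,z_{xx})$ with $F_{pp}\neq 0$ and $D^3F=\Delta H$. On the 9-dimensional bundle $\mathcal G^9=M\times G^4$, with fibre coordinates $(\rho,\phi,f^2,\bar f{}^2)$, let $\theta^1,\dots,\theta^5$ be the lifted 1-forms $$\begin{pmatrix}\theta^1\\\theta^2\\\theta^3\\\theta^4\\\theta^5\end{pmatrix}=\begin{pmatrix}\rho^2&0&0&0&0\\ f^2&\rho e^\phi&0&0&0\\ \frac{(f^2)^2}{2\rho^2}&\frac{f^2e^\phi}{\rho}&e^{2\phi}&0&0\\ \bar f{}^2&0&0&\rho e^{-\phi}&0\\ -\frac{(\bar f{}^2)^2}{2\rho^2}&0&0&-\frac{\bar f{}^2e^{-\phi}}{\rho}&e^{-2\phi}\end{pmatrix}\begin{pmatrix}\hat\omega^1\\\hat\omega^2\\\hat\omega^3\\\hat\omega^4\\\hat\omega^5\end{pmatrix},$$ where $(\hat\omega^\mu)$ is the adapted coframe on $M$ defined in the context. Then there exist four 1-forms $\Omega_1,\Omega_2,\Omega_3,\Omega_4$ on $\mathcal G^9$, with $\theta^1,\dots,\theta^5,\Omega_1,\dots,\Omega_4$ linearly independent at every point, which satisfy the following para-CR invariant exterior differential system: $$\begin{aligned} d\theta^1=&-\theta^1\wedge\Omega_1+\theta^2\wedge\theta^4,\\ d\theta^2=&\;\theta^2\wedge(\Omega_2-\tfrac12\Omega_1)-\theta^1\wedge\Omega_3+\theta^3\wedge\theta^4,\\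 d\theta^3=&\;2\theta^3\wedge\Omega_2-\theta^2\wedge\Omega_3+\tfrac{e^{3\phi}}{\rho^3}I^1\,\theta^1\wedge\theta^4+\tfrac{e^{-\phi}}{\rho}I^3\,\theta^2\wedge\theta^3\\ &+\tfrac1{8\rho^3}\big(2e^\phi\bar f{}^2I^3{}_{|5}+\rho(I^3{}_{|52}+2I^3{}_{|4})-4e^{-\phi}f^2I^3\big)\,\theta^1\wedge\theta^3,\\ d\theta^4=&-\theta^2\wedge\theta^5-\theta^4\wedge(\tfrac12\Omega_1+\Omega_2)-\theta^1\wedge\Omega_4,\\ d\theta^5=&-2\theta^5\wedge\Omega_2+\theta^4\wedge\Omega_4+\tfrac{e^{-3\phi}}{\rho^3}I^2\,\theta^1\wedge\theta^2-\tfrac{e^\phi}{2\rho}I^3{}_{|5}\,\theta^4\wedge\theta^5\\ &+\tfrac1{8\rho^3}\big(2e^\phi\bar f{}^2I^3{}_{|5}+\rho(I^3{}_{|52}+2I^3{}_{|4})-4e^{-\phi}f^2I^3\big)\,\theta^1\wedge\theta^5, \end{aligned}$$ where $I^1,I^2,I^3$ are the following explicit relative differential invariants on the base $M$: $$\begin{aligned}I^1&=-\tfrac1{54}\big(9D^2H_r-27DH_p-18H_r\,DH_r+18H_pH_r+4H_r^3+54H_z\big),\\ I^2&=\frac{40F_{ppp}^3-45F_{pp}F_{ppp}F_{pppp}+9F_{pp}^2F_{ppppp}}{54F_{pp}^3},\\ I^3&=\frac{2F_{ppp}+F_{pp}H_{rr}}{3F_{pp}}.\end{aligned}$$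
   Context: Functions are smooth; $p=z_x$, $r=z_{xx}$; $F=F(x,y,z,p)$ (so $F_r=0$), $H=H(x,y,z,p,r)$; subscripts on $F,H$ are partial derivatives. $D=\partial_x+p\partial_z+r\partial_p+H\partial_r$ and $\Delta=\partial_y+F\partial_z+DF\,\partial_p+D^2F\,\partial_r$; expressions such as $DH_r$, $D^2H_r$ mean $D(\partial_rH)$, $D(D(\partial_rH))$. Fibre coordinates: $\rho>0$, $\phi,f^2,\bar f{}^2\in\mathbb R$ (upper $2$ in $f^2,\bar f{}^2$ is an index; the bar is only notation). Initial coframe: $\omega^1=dz-p\,dx-F\,dy$, $\omega^2=dp-r\,dx-DF\,dy$, $\omega^3=dr-H\,dx-D^2F\,dy$, $\omega^4=dx$, $\omega^5=dy$. The associated para-CR structure is the class of all coframes obtained from $(\omega^\mu)$ by $\tilde\omega^1=f\omega^1$, $\tilde\omega^i=f^i\omega^1+f^i{}_2\omega^2+f^i{}_3\omega^3$ ($i=2,3$), $\tilde\omega^i=f^i\omega^1+f^i{}_4\omega^4+f^i{}_5\omega^5$ ($i=4,5$), invertible with function coefficients. A relative differential invariant is a function built from $F,H$ and their derivatives whose vanishing or not is invariant under local para-CR equivalence (local diffeomorphisms mapping one class of coframes to the other). Adapted coframe: $\hat\omega^1=-\omega^1$, $\hat\omega^2=\omega^2$, $\hat\omega^3=\frac{2H_r^2+9H_p-3DH_r}{18}\omega^1+\frac{H_r}3\omega^2-\omega^3$, $\hat\omega^4=\omega^4+F_p\omega^5$, $\hat\omega^5=\frac{3F_{pp}F_{pppp}-5F_{ppp}^2}{18F_{pp}^2}\omega^1+\frac{F_{ppp}}{3F_{pp}}\omega^4+\frac{F_{ppp}F_p-3F_{pp}^2}{3F_{pp}}\omega^5$.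 Meaning of the derivatives $I^3{}_{|4},I^3{}_{|5},I^3{}_{|52}$ (functions on $M$): let $\varpi_1,\varpi_2$ be the 1-forms on $M$, unique modulo $\hat\omega^1$, such that $d\hat\omega^1=-\hat\omega^1\wedge\varpi_1+\hat\omega^2\wedge\hat\omega^4$, $d\hat\omega^2\equiv\hat\omega^2\wedge(\varpi_2-\frac12\varpi_1)+\hat\omega^3\wedge\hat\omega^4$ and $d\hat\omega^4\equiv-\hat\omega^2\wedge\hat\omega^5-\hat\omega^4\wedge(\frac12\varpi_1+\varpi_2)$ modulo $\hat\omega^1$. Then, modulo $\hat\omega^1$, $dI^3\equiv I^3{}_{|2}\hat\omega^2+I^3{}_{|3}\hat\omega^3+I^3{}_{|4}\hat\omega^4+I^3{}_{|5}\hat\omega^5-\frac12I^3\varpi_1+I^3\varpi_2$, and $dI^3{}_{|5}\equiv I^3{}_{|52}\hat\omega^2+I^3{}_{|53}\hat\omega^3+I^3{}_{|54}\hat\omega^4+I^3{}_{|55}\hat\omega^5-\frac12I^3{}_{|5}\varpi_1-I^3{}_{|5}\varpi_2$. *)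

(* Defs.v *)
From HB Require Import structures.
From mathcomp Require Import all_boot all_order all_algebra.
From mathcomp Require Import all_classical all_reals all_analysis.
Set Implicit Arguments.
Unset Strict Implicit.
Unset Printing Implicit Defensive.
Import Order.TTheory GRing.Theory Num.Theory.
Import numFieldNormedType.Exports.
Local Open Scope classical_set_scope.
Local Open Scope ring_scope.

Definition partial {R : realType} {n : nat} {V : normedModType R} (i : 'I_n.+1)
    (f : 'rV[R]_n.+1 -> V) : 'rV[R]_n.+1 -> V :=
  'D_(delta_mx 0 i) f.

(* All iterated partial derivatives are Frechet differentiable, hence
   continuous, on U; for open U this is C^oo. *)
Definition smooth {R : realType} {n : nat} {V : normedModType R}
    (U : set 'rV[R]_n.+1) (f : 'rV[R]_n.+1 -> V) : Prop :=
  forall (s : seq 'I_n.+1) (q : 'rV[R]_n.+1), U q ->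
    differentiable (foldr partial f s) q.

(* A covector is the row of its components in the basis dq_0, .., dq_n, and a
   2-covector w is the antisymmetric matrix of its values w(d/dq_i, d/dq_j). *)
Definition dcoord {R : realType} {n : nat} (i : 'I_n) : 'rV[R]_n := delta_mx 0 i.

Definition wedge {R : realType} {n : nat} (a b : 'rV[R]_n) : 'M[R]_n :=
  a^T *m b - b^T *m a.

Notation "a \wedge b" := (wedge a b) (at level 40, left associativity).

Definition dfun {R : realType} {n : nat} (f : 'rV[R]_n.+1 -> R)
    (q : 'rV[R]_n.+1) : 'rV[R]_n.+1 :=
  \row_i partial i f q.

Definition dform {R : realType} {n : nat} (a : 'rV[R]_n.+1 -> 'rV[R]_n.+1)
    (q : 'rV[R]_n.+1) : 'M[R]_n.+1 :=
  \matrix_(i, j) (partial i (fun q' => a q' 0 j) q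
                  - partial j (fun q' => a q' 0 i) q).

Definition eqmod1 {R : realType} {n : nat} (w a b : 'rV[R]_n) : Prop :=
  exists c : R, a - b = c *: w.

Definition eqmod2 {R : realType} {n : nat} (w : 'rV[R]_n) (a b : 'M[R]_n) : Prop :=
  exists c : 'rV[R]_n, a - b = w \wedge c.

(* A field of m one-forms is a matrix-valued map whose rows are the forms;
   MathComp's Jacobian 'J acts on the right of row vectors. *)
Definition pullback {R : realType} {m n : nat}
    (Phi : 'rV[R]_n.+1 -> 'rV[R]_n.+1) (W : 'rV[R]_n.+1 -> 'M[R]_(m, n.+1))
    (q : 'rV[R]_n.+1) : 'M[R]_(m, n.+1) :=
  W (Phi q) *m ('J Phi q)^T.

Definition mx_of_rows {R : realType} (m n : nat) (s : seq 'rV[R]_n) : 'M[R]_(m, n) :=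
  \matrix_(i < m) s`_i.

Definition mx_of_seqs {R : realType} (m n : nat) (s : seq (seq R)) : 'M[R]_(m, n) :=
  \matrix_(i < m, j < n) (nth [::] s i)`_j.

(* Coordinates (x, y, z, p, r) on R^5. *)
Definition ix : 'I_5 := 0.
Definition iy : 'I_5 := 1.
Definition iz : 'I_5 := 2.
Definition ip : 'I_5 := 3.
Definition ir : 'I_5 := 4.

Definition pullr {R : realType} (F : 'rV[R]_4 -> R) (q : 'rV[R]_5) : R :=
  F (lsubmx (q : 'rV[R]_(4 + 1))).

Definition D {R : realType} (H f : 'rV[R]_5 -> R) (q : 'rV[R]_5) : R :=
  partial ix f q + q 0 ip * partial iz f q + q 0 ir * partial ip f q
  + H q * partial ir f q.

Definition Delta {R : realType} (F : 'rV[R]_4 -> R) (H f : 'rV[R]_5 -> R)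
    (q : 'rV[R]_5) : R :=
  partial iy f q + pullr F q * partial iz f q
  + D H (pullr F) q * partial ip f q
  + D H (D H (pullr F)) q * partial ir f q.

Definition Fp {R : realType} (F : 'rV[R]_4 -> R) : 'rV[R]_5 -> R :=
  partial ip (pullr F).
Definition Fpp {R : realType} (F : 'rV[R]_4 -> R) := partial ip (Fp F).
Definition Fppp {R : realType} (F : 'rV[R]_4 -> R) := partial ip (Fpp F).
Definition Fpppp {R : realType} (F : 'rV[R]_4 -> R) := partial ip (Fppp F).
Definition Fppppp {R : realType} (F : 'rV[R]_4 -> R) := partial ip (Fpppp F).
Definition Hz {R : realType} (H : 'rV[R]_5 -> R) := partial iz H.
Definition Hp {R : realType} (H : 'rV[R]_5 -> R) := partial ip H.
Definition Hr {R : realType} (H : 'rV[R]_5 -> R) := partial ir H.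
Definition Hrr {R : realType} (H : 'rV[R]_5 -> R) := partial ir (Hr H).

Definition integrable_system {R : realType} (M : set 'rV[R]_5)
    (F : 'rV[R]_4 -> R) (H : 'rV[R]_5 -> R) : Prop :=
  [/\ open M, smooth M (pullr F), smooth M H,
      forall q, M q -> Fpp F q != 0
    & forall q, M q -> D H (D H (D H (pullr F))) q = Delta F H H q].

Definition omega {R : realType} (F : 'rV[R]_4 -> R) (H : 'rV[R]_5 -> R)
    (q : 'rV[R]_5) : 'M[R]_5 :=
  let p := q 0 ip in let r := q 0 ir in
  let dx := dcoord ix in let dy := dcoord iy in let dz := dcoord iz in
  let dp := dcoord ip in let dr := dcoord ir in
  mx_of_rows 5
    [:: dz - p *: dx - pullr F q *: dy;
        dp - r *: dx - D H (pullr F) q *: dy;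
        dr - H q *: dx - D H (D H (pullr F)) q *: dy;
        dx;
        dy].

Definition paraCR_entry (i j : nat) : bool :=
  [|| j == 0%N, (1 <= i <= 2)%N && (1 <= j <= 2)%N
    | (3 <= i <= 4)%N && (3 <= j <= 4)%N].

Definition paraCR_matrix {R : realType} (A : 'M[R]_5) : Prop :=
  A \in unitmx /\ forall i j : 'I_5, ~~ paraCR_entry i j -> A i j = 0.

Definition paraCR_class {R : realType} (F : 'rV[R]_4 -> R) (H : 'rV[R]_5 -> R)
    (U : set 'rV[R]_5) (W : 'rV[R]_5 -> 'M[R]_5) : Prop :=
  exists A : 'rV[R]_5 -> 'M[R]_5, smooth U A /\
    forall q, U q -> paraCR_matrix (A q) /\ W q = A q *m omega F H q.

Definition diffeo {R : realType} {n : nat} (U V : set 'rV[R]_n.+1)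
    (Phi : 'rV[R]_n.+1 -> 'rV[R]_n.+1) : Prop :=
  [/\ open U, open V, smooth U Phi, set_bij U V Phi
    & exists Psi : 'rV[R]_n.+1 -> 'rV[R]_n.+1,
        smooth V Psi /\ forall q, U q -> Psi (Phi q) = q].

Definition paraCR_equivalence {R : realType}
    (F F' : 'rV[R]_4 -> R) (H H' : 'rV[R]_5 -> R) (U U' : set 'rV[R]_5)
    (Phi : 'rV[R]_5 -> 'rV[R]_5) : Prop :=
  diffeo U U' Phi /\
  forall W' : 'rV[R]_5 -> 'M[R]_5,
    paraCR_class F' H' U' W' <-> paraCR_class F H U (pullback Phi W').

(* Invariance only; that the functions it is applied to are built from F, H
   and their derivatives is apparent from their formulas. *)
Definition relative_invariant {R : realType}
    (I : ('rV[R]_4 -> R) -> ('rV[R]_5 -> R) -> 'rV[R]_5 -> R) : Prop :=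
  forall (M M' : set 'rV[R]_5) (F F' : 'rV[R]_4 -> R) (H H' : 'rV[R]_5 -> R)
         (U U' : set 'rV[R]_5) (Phi : 'rV[R]_5 -> 'rV[R]_5),
    integrable_system M F H -> integrable_system M' F' H' ->
    U `<=` M -> U' `<=` M' -> paraCR_equivalence F F' H H' U U' Phi ->
    forall q, U q -> (I F H q = 0 <-> I F' H' (Phi q) = 0).

Definition I1 {R : realType} (F : 'rV[R]_4 -> R) (H : 'rV[R]_5 -> R)
    (q : 'rV[R]_5) : R :=
  - 54^-1 * (9 * D H (D H (Hr H)) q - 27 * D H (Hp H) q
             - 18 * Hr H q * D H (Hr H) q + 18 * Hp H q * Hr H q
             + 4 * Hr H q ^+ 3 + 54 * Hz H q).

Definition I2 {R : realType} (F : 'rV[R]_4 -> R) (H : 'rV[R]_5 -> R)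
    (q : 'rV[R]_5) : R :=
  (40 * Fppp F q ^+ 3 - 45 * Fpp F q * Fppp F q * Fpppp F q
   + 9 * Fpp F q ^+ 2 * Fppppp F q) / (54 * Fpp F q ^+ 3).

Definition I3 {R : realType} (F : 'rV[R]_4 -> R) (H : 'rV[R]_5 -> R)
    (q : 'rV[R]_5) : R :=
  (2 * Fppp F q + Fpp F q * Hrr H q) / (3 * Fpp F q).

Definition omega_hat {R : realType} (F : 'rV[R]_4 -> R) (H : 'rV[R]_5 -> R)
    (q : 'rV[R]_5) : 'M[R]_5 :=
  let w1 := row 0 (omega F H q) in let w2 := row 1 (omega F H q) in
  let w3 := row 2 (omega F H q) in let w4 := row 3 (omega F H q) in
  let w5 := row 4 (omega F H q) in
  mx_of_rows 5
    [:: - w1;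
        w2;
        ((2 * Hr H q ^+ 2 + 9 * Hp H q - 3 * D H (Hr H) q) / 18) *: w1
          + (Hr H q / 3) *: w2 - w3;
        w4 + Fp F q *: w5;
        ((3 * Fpp F q * Fpppp F q - 5 * Fppp F q ^+ 2) / (18 * Fpp F q ^+ 2)) *: w1
          + (Fppp F q / (3 * Fpp F q)) *: w4
          + ((Fppp F q * Fp F q - 3 * Fpp F q ^+ 2) / (3 * Fpp F q)) *: w5].

Definition varpi_spec {R : realType} (M : set 'rV[R]_5) (F : 'rV[R]_4 -> R)
    (H : 'rV[R]_5 -> R) (varpi1 varpi2 : 'rV[R]_5 -> 'rV[R]_5) : Prop :=
  [/\ smooth M varpi1, smooth M varpi2
    & forall q, M q ->
      let w i := row i (omega_hat F H q) in
      let dw i := dform (fun q' => row i (omega_hat F H q')) q in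
      let v1 := varpi1 q in let v2 := varpi2 q in
      [/\ dw 0 = - (w 0 \wedge v1) + w 1 \wedge w 3,
          eqmod2 (w 0) (dw 1)
            (w 1 \wedge (v2 - 2^-1 *: v1) + w 2 \wedge w 3)
        & eqmod2 (w 0) (dw 3)
            (- (w 1 \wedge w 4) - w 3 \wedge (2^-1 *: v1 + v2))]].

(* I3_4, I3_5, I3_52 are the derivatives I^3_{|4}, I^3_{|5}, I^3_{|52}. *)
Definition I3_derivatives {R : realType} (M : set 'rV[R]_5) (F : 'rV[R]_4 -> R)
    (H : 'rV[R]_5 -> R) (I3_4 I3_5 I3_52 : 'rV[R]_5 -> R) : Prop :=
  exists varpi1 varpi2 : 'rV[R]_5 -> 'rV[R]_5,
  exists I3_2 I3_3 I3_53 I3_54 I3_55 : 'rV[R]_5 -> R,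
  [/\ varpi_spec M F H varpi1 varpi2,
      [/\ smooth M I3_2, smooth M I3_3, smooth M I3_4 & smooth M I3_5],
      [/\ smooth M I3_52, smooth M I3_53, smooth M I3_54 & smooth M I3_55]
    & forall q, M q ->
      let w i := row i (omega_hat F H q) in
      let v1 := varpi1 q in let v2 := varpi2 q in
      eqmod1 (w 0) (dfun (I3 F H) q)
        (I3_2 q *: w 1 + I3_3 q *: w 2 + I3_4 q *: w 3 + I3_5 q *: w 4
         - (2^-1 * I3 F H q) *: v1 + I3 F H q *: v2) /\
      eqmod1 (w 0) (dfun I3_5 q)
        (I3_52 q *: w 1 + I3_53 q *: w 2 + I3_54 q *: w 3 + I3_55 q *: w 4
         - (2^-1 * I3_5 q) *: v1 - I3_5 q *: v2)].

(* Coordinates (x, y, z, p, r, rho, phi, f2, fbar2) on R^9. *)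
Definition base {R : realType} (u : 'rV[R]_9) : 'rV[R]_5 :=
  lsubmx (u : 'rV[R]_(5 + 4)).
Definition rho {R : realType} (u : 'rV[R]_9) : R := u 0 5.
Definition phi {R : realType} (u : 'rV[R]_9) : R := u 0 6.
Definition f2 {R : realType} (u : 'rV[R]_9) : R := u 0 7.
Definition fbar2 {R : realType} (u : 'rV[R]_9) : R := u 0 8.

Definition G9 {R : realType} (M : set 'rV[R]_5) : set 'rV[R]_9 :=
  [set u | M (base u) /\ 0 < rho u].

Definition G4_matrix {R : realType} (u : 'rV[R]_9) : 'M[R]_5 :=
  let rh := rho u in let e := expR (phi u) in let e' := expR (- phi u) in
  let f := f2 u in let fb := fbar2 u in
  mx_of_seqs 5 5
    [:: [:: rh ^+ 2; 0; 0; 0; 0];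
        [:: f; rh * e; 0; 0; 0];
        [:: f ^+ 2 / (2 * rh ^+ 2); f * e / rh; expR (2 * phi u); 0; 0];
        [:: fb; 0; 0; rh * e'; 0];
        [:: - (fb ^+ 2 / (2 * rh ^+ 2)); 0; 0; - (fb * e' / rh);
            expR (- 2 * phi u)]].

(* The zero block makes the forms of M forms on G^9. *)
Definition theta {R : realType} (F : 'rV[R]_4 -> R) (H : 'rV[R]_5 -> R)
    (u : 'rV[R]_9) : 'M[R]_(5, 9) :=
  G4_matrix u *m (row_mx (omega_hat F H (base u)) 0 : 'M[R]_(5, 5 + 4)).

(* th 0, .., th 4 are theta^1, .., theta^5 and Om 0, .., Om 3 are
   Omega_1, .., Omega_4. *)
Definition paraCR_EDS {R : realType} (F : 'rV[R]_4 -> R) (H : 'rV[R]_5 -> R)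
    (I3_4 I3_5 I3_52 : 'rV[R]_5 -> R) (Omega : 'rV[R]_9 -> 'M[R]_(4, 9))
    (u : 'rV[R]_9) : Prop :=
  let q := base u in
  let rh := rho u in let ph := phi u in let f := f2 u in let fb := fbar2 u in
  let th i := row i (theta F H u) in
  let dth i := dform (fun u' => row i (theta F H u')) u in
  let Om i := row i (Omega u) in
  let T := (8 * rh ^+ 3)^-1 *
    (2 * expR ph * fb * I3_5 q + rh * (I3_52 q + 2 * I3_4 q)
     - 4 * expR (- ph) * f * I3 F H q) in
  [/\ dth 0 = - (th 0 \wedge Om 0) + th 1 \wedge th 3,
      dth 1 = th 1 \wedge (Om 1 - 2^-1 *: Om 0) - th 0 \wedge Om 2
              + th 2 \wedge th 3,
      dth 2 = 2 *: (th 2 \wedge Om 1) - th 1 \wedge Om 2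
              + (expR (3 * ph) / rh ^+ 3 * I1 F H q) *: (th 0 \wedge th 3)
              + (expR (- ph) / rh * I3 F H q) *: (th 1 \wedge th 2)
              + T *: (th 0 \wedge th 2),
      dth 3 = - (th 1 \wedge th 4) - th 3 \wedge (2^-1 *: Om 0 + Om 1)
              - th 0 \wedge Om 3
    & dth 4 = - (2 *: (th 4 \wedge Om 1)) + th 3 \wedge Om 3
              + (expR (- 3 * ph) / rh ^+ 3 * I2 F H q) *: (th 0 \wedge th 1)
              - (expR ph / (2 * rh) * I3_5 q) *: (th 3 \wedge th 4)
              + T *: (th 0 \wedge th 4)].

(* Main.v *)
Require Import Defs.
From HB Require Import structures.
From mathcomp Require Import all_boot all_order all_algebra.
From mathcomp Require Import ring lra.
From mathcomp Require Import all_classical all_reals all_analysis.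
Set Implicit Arguments.
Unset Strict Implicit.
Unset Printing Implicit Defensive.
Import Order.TTheory GRing.Theory Num.Theory.
Import numFieldNormedType.Exports.
Local Open Scope classical_set_scope.
Local Open Scope ring_scope.

(** The theorem asserts three things: the covariant derivatives of [I3] exist, the
    lifted coframe satisfies the exterior differential system for some connection
    forms, and [I1], [I2], [I3] are relative invariants.

    The structure equations on [M].  The vector fields d/dz, d/dp, d/dr, [D] and
    [L = Delta - F_p D] frame [M], and [D^3 F = Delta H] says that [D] and [Delta]
    commute.  So the brackets of this frame are polynomial in the jets of [F] and
    [H], and Cartan's formula expresses the exterior derivative of every form with
    such coefficients.  Moreover [D^3 F = Delta H] can be solved for [H_y]; once
    the y-derivatives of [H] are eliminated, the other jets can be treated as
    independent variables.  Each structure equation for the adapted coframe, with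
    guessed connection forms, thus becomes a rational identity in finitely many jets
    with powers of [F_pp] as denominators, which field arithmetic decides.  For
    this the jets are represented by symbolic expressions ([dexp]), differentiated
    symbolically ([dd_correct]) and evaluated ([ev]); the outcome is
    [omega_hat_structure].  Modulo the first form, the first two connection forms
    are unique ([varpi_unique]), hence so are the derivatives of [I3]
    ([I3_derivatives_unique]).

    The lift.  The lifted coframe is [lift_mx b c s u *m omega_hat] with
    [b = rho e^phi], [c = rho e^-phi], [s = f^2] and [u] the other fibre
    coordinate.  For arbitrary functions b, c, s, u, such a change of coframe
    preserves the shape of the structure equations: the connection forms change by
    an explicit formula, and the torsion [I1], [I2], [I3] is divided by [c^3],
    [b^3], [b] ([structure_lift], [structure_lift_mx]).  Applied on the bundle this
    is the exterior differential system ([bundle_EDS]).  Along the fibres the four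
    connection forms restrict to independent invariant forms of the group, while
    the lifted forms vanish there; this gives independence ([row_free_bundle]).

    Relative invariance.  An equivalence pulls the adapted coframe of the second
    system back to [A *m omega_hat], [A] a field of para-CR matrices, and the
    pulled-back coframe satisfies structure equations because [d] commutes with
    pull-backs ([dform_pullback]).  Comparing them with those of [omega_hat]
    forces [A] to be some [lift_mx b c s u]: the first, second and fourth equations
    give the diagonal of [A], and what remains is unipotent and dies degree by
    degree.  Then the torsion coefficients, being determined by the coframe,
    transform by the nonzero factors above ([adapted_change]). *)

(** * Calculus of smooth functions *)

(** Smoothness on an open set only constrains a function there, so each rule has to
    be insensitive to a change of the function elsewhere. *)
Section Locality.
Context {R : realType} {n : nat} {V : normedModType R}.
Implicit Types (U : set 'rV[R]_n.+1) (f g : 'rV[R]_n.+1 -> V).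

Lemma eq_on_near U f g q : open U -> U q -> (forall x, U x -> f x = g x) ->
  \near q, f q = g q.
Proof.
move=> oU Uq fg; have := open_nbhs_nbhs (conj oU Uq).
by apply: filterS => x /fg.
Qed.

Lemma eq_on_partial U f g i q : open U -> U q -> (forall x, U x -> f x = g x) ->
  partial i f q = partial i g q.
Proof. by move=> oU Uq fg; apply: near_eq_derive; apply: eq_on_near oU Uq fg. Qed.

Lemma eq_on_differentiable U f g q : open U -> U q ->
  (forall x, U x -> f x = g x) -> differentiable f q -> differentiable g q.
Proof.
move=> oU Uq fg /diff_locallyP[cdf Ef].
have Eg : g \o shift q = cst (g q) + 'd f q +o_ (nbhs (0 : 'rV[R]_n.+1)) id.
  apply/eqaddoP => _/posnumP[e].
  have /eqaddoP/(_ _ [gt0 of e%:num]) := Ef.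
  have : nbhs (0 : 'rV[R]_n.+1) (fun x => U (x + q)).
    have : nbhs q U by exact: (open_nbhs_nbhs (conj oU Uq)).
    move=> qU; have : \near q, U q by exact: qU.
    by rewrite (near_shift 0 q); apply: filterS => x /=; rewrite subr0.
  apply: filterS2 => x /fg Ux; rewrite -(fg _ Uq).
  by rewrite -![(_ + _ : _ -> _) _]/(_ + _) -![(- _ : _ -> _) _]/(- _) /= Ux.
have dE := diff_unique cdf Eg.
by apply/diff_locallyP; rewrite dE.
Qed.

End Locality.

Section PartialCalculus.
Context {R : realType} {n : nat}.
Implicit Types (U : set 'rV[R]_n.+1) (f g : 'rV[R]_n.+1 -> R) (q : 'rV[R]_n.+1).

Lemma derive_partial f q v : differentiable f q ->
  'D_v f q = \sum_i v 0 i * partial i f q.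
Proof.
move=> df; rewrite deriveE //.
rewrite {1}(row_sum_delta v) linear_sum; apply: eq_bigr => i _.
by rewrite linearZ /partial deriveE.
Qed.

Lemma partialD f g i q : differentiable f q -> differentiable g q ->
  partial i (fun x => f x + g x) q = partial i f q + partial i g q.
Proof. by move=> df dg; rewrite /partial deriveD //; exact: diff_derivable. Qed.

Lemma partialM f g i q : differentiable f q -> differentiable g q ->
  partial i (fun x => f x * g x) q = partial i f q * g q + f q * partial i g q.
Proof.
move=> df dg; rewrite /partial deriveM //; try exact: diff_derivable.
by rewrite addrC /GRing.scale /= [X in X + _]mulrC.
Qed.

Lemma partialN f i q : differentiable f q ->
  partial i (fun x => - f x) q = - partial i f q.
Proof. by move=> df; rewrite /partial deriveN //; exact: diff_derivable. Qed.

Lemma partial_cst (c : R) i q : partial i (fun=> c) q = 0.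
Proof. by rewrite /partial derive_cst. Qed.

Lemma partial_coord j i q : partial i (fun x : 'rV[R]_n.+1 => x 0 j) q = (i == j)%:R.
Proof.
rewrite /partial; transitivity ('D_(delta_mx 0 i) (@id 'rV[R]_n.+1) q 0 j).
  by rewrite derive_mx ?mxE //; exact: derivable_id.
by rewrite derive_id mxE eqxx /= eq_sym.
Qed.

Lemma partial_sum m (F : 'I_m -> 'rV[R]_n.+1 -> R) i q :
  (forall k, differentiable (F k) q) ->
  partial i (fun x => \sum_k F k x) q = \sum_k partial i (F k) q.
Proof.
move=> dF; rewrite /partial.
rewrite (_ : (fun x => _) = \sum_(k < m) F k); last by apply/funext => x; rewrite fct_sumE.
by rewrite derive_sum // => k; exact: diff_derivable.
Qed.

Lemma partialV f i q : f q != 0 -> differentiable f q ->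
  partial i (fun x => (f x)^-1) q = - (partial i f q * ((f q)^-1 * (f q)^-1)).
Proof.
move=> fq df; rewrite /partial.
rewrite deriveV //; last exact: diff_derivable.
by rewrite /GRing.scale /= -exprVn expr2 mulNr mulrC.
Qed.

Lemma differentiable_expR_comp f q : differentiable f q ->
  differentiable (fun x => expR (f x)) q.
Proof.
move=> df; apply: (@differentiable_comp _ _ _ _ f (@expR R)) => //.
exact/derivable1_diffP/derivable_expR.
Qed.

Lemma partial_expR f i q : differentiable f q ->
  partial i (fun x => expR (f x)) q = expR (f q) * partial i f q.
Proof.
move=> df; rewrite /partial deriveE; last exact: differentiable_expR_comp.
have de : differentiable (@expR R) (f q).
  exact/derivable1_diffP/derivable_expR.
rewrite (_ : (fun x => _) = expR \o f) // diff_comp //= deriveE //.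
rewrite deriv1E; last exact: derivable_expR.
by rewrite derive1E derive_val /GRing.scale /= mulrC.
Qed.

End PartialCalculus.

Section FiniteOrder.
Context {R : realType} {n : nat}.
Implicit Types (U : set 'rV[R]_n.+1) (k : nat).

(** Smoothness is cut into finite orders because the partial derivatives of a
    product, an inverse or an exponential involve that same operation: only the
    order of differentiability decreases. *)
Fixpoint Ck {V : normedModType R} U k (f : 'rV[R]_n.+1 -> V) : Prop :=
  (forall q, U q -> differentiable f q) /\
  (if k is k'.+1 then forall i, Ck U k' (partial i f) else True).

Lemma Ck_differentiable {V : normedModType R} U k (f : 'rV[R]_n.+1 -> V) q :
  Ck U k f -> U q -> differentiable f q.
Proof. by case: k => [|k] [df _] /df. Qed.

Lemma smooth_partial {V : normedModType R} U (f : 'rV[R]_n.+1 -> V) i :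
  smooth U f -> smooth U (partial i f).
Proof. by move=> sf s q Uq; rewrite -foldr_rcons; apply: sf. Qed.

Lemma smoothP {V : normedModType R} U (f : 'rV[R]_n.+1 -> V) :
  smooth U f <-> forall k, Ck U k f.
Proof.
split=> [sf k|Cf s].
  elim: k f sf => [|k IH] f sf; first by split=> // q; apply: (sf [::]).
  by split=> [q|i]; [apply: (sf [::])|apply/IH/smooth_partial].
elim/last_ind: s f Cf => [|s i IH] f Cf q Uq.
  exact: Ck_differentiable (Cf 0) Uq.
by rewrite foldr_rcons; apply: IH => // k; have [_ pf] := Cf k.+1; apply: pf.
Qed.

Lemma smooth_differentiable {V : normedModType R} U (f : 'rV[R]_n.+1 -> V) q :
  smooth U f -> U q -> differentiable f q.
Proof. by move=> sf; apply: (sf [::]). Qed.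

Lemma CkW {V : normedModType R} U k (f : 'rV[R]_n.+1 -> V) : Ck U k.+1 f -> Ck U k f.
Proof.
elim: k f => [|k IH] f [df pf]; first by split.
by split=> // i; apply/IH/pf.
Qed.

Lemma eq_on_Ck {V : normedModType R} U k (f g : 'rV[R]_n.+1 -> V) :
  open U -> (forall x, U x -> f x = g x) -> Ck U k f -> Ck U k g.
Proof.
move=> oU; elim: k f g => [|k IH] f g fg [df pf]; split => //.
- by move=> q Uq; apply: eq_on_differentiable fg (df q Uq).
- by move=> q Uq; apply: eq_on_differentiable fg (df q Uq).
by move=> i; apply: IH (pf i) => x Ux; apply: eq_on_partial fg.
Qed.

Lemma Ck_cst {V : normedModType R} U k (c : V) : Ck U k (fun=> c).
Proof.
elim: k c => [|k IH] c; split=> // i.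
have -> : partial i (fun=> c : V) = fun=> 0 :> V.
  by apply/funext => x; rewrite /partial derive_cst.
exact: IH.
Qed.

Section Algebra.
Variables (U : set 'rV[R]_n.+1) (oU : open U).
Implicit Types f g : 'rV[R]_n.+1 -> R.

Lemma CkD k f g : Ck U k f -> Ck U k g -> Ck U k (fun x => f x + g x).
Proof.
elim: k f g => [|k IH] f g Cf Cg.
  split=> // q Uq.
  by apply: differentiableD; [exact: Ck_differentiable Cf Uq|exact: Ck_differentiable Cg Uq].
split=> [q Uq|i].
  by apply: differentiableD; [exact: Ck_differentiable Cf Uq|exact: Ck_differentiable Cg Uq].
apply: (eq_on_Ck (f := fun x => partial i f x + partial i g x)) => //.
  by move=> x Ux; rewrite partialD //;
    [exact: Ck_differentiable Cf Ux|exact: Ck_differentiable Cg Ux].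
by apply: IH; [exact: Cf.2|exact: Cg.2].
Qed.

Lemma CkM k f g : Ck U k f -> Ck U k g -> Ck U k (fun x => f x * g x).
Proof.
elim: k f g => [|k IH] f g Cf Cg.
  split=> // q Uq.
  by apply: differentiableM; [exact: Ck_differentiable Cf Uq|exact: Ck_differentiable Cg Uq].
split=> [q Uq|i].
  by apply: differentiableM; [exact: Ck_differentiable Cf Uq|exact: Ck_differentiable Cg Uq].
apply: (eq_on_Ck (f := fun x => partial i f x * g x + f x * partial i g x)) => //.
  by move=> x Ux; rewrite partialM //;
    [exact: Ck_differentiable Cf Ux|exact: Ck_differentiable Cg Ux].
by apply: CkD; apply: IH; [exact: Cf.2|exact: CkW|exact: CkW|exact: Cg.2].
Qed.

Lemma CkN k f : Ck U k f -> Ck U k (fun x => - f x).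
Proof.
move=> Cf; have := CkM (Ck_cst U k (-1 : R)) Cf.
by apply: eq_on_Ck => // x _; rewrite mulN1r.
Qed.

Lemma Ck_coord k j : Ck U k (fun x : 'rV[R]_n.+1 => x 0 j).
Proof.
case: k => [|k]; split=> //; try by move=> q _; exact: differentiable_coord.
move=> i; have := Ck_cst U k ((i == j)%:R : R).
by apply: eq_on_Ck => // x _; rewrite partial_coord.
Qed.

Lemma CkV k f : (forall q, U q -> f q != 0) -> Ck U k f ->
  Ck U k (fun x => (f x)^-1).
Proof.
move=> f0; elim: k => [|k IH] Cf.
  split=> // q Uq; apply: differentiableV; [|exact: f0].
  exact: Ck_differentiable Cf Uq.
split=> [q Uq|i].
  by apply: differentiableV; [exact: Ck_differentiable Cf Uq|exact: f0].
have IHf := IH (CkW Cf).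
apply: (eq_on_Ck (f := fun x => - (partial i f x * ((f x)^-1 * (f x)^-1)))) => //.
  by move=> x Ux; rewrite partialV ?f0 //; exact: Ck_differentiable Cf Ux.
by apply: CkN; apply: CkM; [exact: Cf.2|exact: CkM].
Qed.

Lemma Ck_expR k f : Ck U k f -> Ck U k (fun x => expR (f x)).
Proof.
elim: k => [|k IH] Cf.
  split=> // q Uq; apply: differentiable_expR_comp; exact: Ck_differentiable Cf Uq.
split=> [q Uq|i].
  by apply: differentiable_expR_comp; exact: Ck_differentiable Cf Uq.
apply: (eq_on_Ck (f := fun x => expR (f x) * partial i f x)) => //.
  by move=> x Ux; rewrite partial_expR //; exact: Ck_differentiable Cf Ux.
by apply: CkM; [exact/IH/CkW|exact: Cf.2].
Qed.

End Algebra.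

Lemma differentiable_mx m p U (f : 'rV[R]_n.+1 -> 'M[R]_(m, p)) q :
  (forall i j, differentiable (fun x => f x i j) q) -> differentiable f q.
Proof.
move=> df.
rewrite (_ : f = \sum_i \sum_j (fun x => f x i j *: delta_mx i j)); last first.
  apply/funext => x; rewrite fct_sumE {1}(matrix_sum_delta (f x)).
  by apply: eq_bigr => i _; rewrite fct_sumE.
apply: differentiable_sum => i; apply: differentiable_sum => j.
exact: differentiableZl.
Qed.

Lemma Ck_mx m p U k (f : 'rV[R]_n.+1 -> 'M[R]_(m, p)) : open U ->
  Ck U k f <-> forall i j, Ck U k (fun x => f x i j).
Proof.
move=> oU; elim: k f => [|k IH] f; split.
- move=> [df _] i j; split=> // q /df dfq.
  exact: (differentiable_comp dfq (differentiable_coord _ i j)).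
- move=> Cf; split=> // q Uq.
  by apply: differentiable_mx => // i j; exact: Ck_differentiable (Cf i j) Uq.
- move=> [df pf] i j; split.
    move=> q /df dfq; exact: (differentiable_comp dfq (differentiable_coord _ i j)).
  move=> l; have /IH/(_ i j) := pf l; apply: eq_on_Ck => // x Ux.
  by rewrite /partial derive_mx ?mxE //; exact/diff_derivable/df.
- move=> Cf; have df q : U q -> differentiable f q.
    by move=> Uq; apply: differentiable_mx => // i j; exact: Ck_differentiable (Cf i j) Uq.
  split=> // l; apply/IH => i j; have [_ /(_ l)] := Cf i j.
  apply: eq_on_Ck => // x Ux.
  by rewrite /partial derive_mx ?mxE //; exact/diff_derivable/df.
Qed.

End FiniteOrder.

Section SmoothAlgebra.
Context {R : realType} {n : nat} {U : set 'rV[R]_n.+1} (oU : open U).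
Implicit Types f g : 'rV[R]_n.+1 -> R.

Lemma eq_on_smooth {V : normedModType R} (f g : 'rV[R]_n.+1 -> V) :
  (forall x, U x -> f x = g x) -> smooth U f -> smooth U g.
Proof. by move=> fg /smoothP sf; apply/smoothP => k; apply: eq_on_Ck fg _. Qed.

Lemma smooth_cst {V : normedModType R} (c : V) : smooth U (fun=> c).
Proof. by apply/smoothP => k; exact: Ck_cst. Qed.

Lemma smooth_coord j : smooth U (fun x : 'rV[R]_n.+1 => x 0 j).
Proof. by apply/smoothP => k; exact: Ck_coord. Qed.

Lemma smoothD f g : smooth U f -> smooth U g -> smooth U (fun x => f x + g x).
Proof. by move=> /smoothP sf /smoothP sg; apply/smoothP => k; exact: CkD. Qed.

Lemma smoothM f g : smooth U f -> smooth U g -> smooth U (fun x => f x * g x).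
Proof. by move=> /smoothP sf /smoothP sg; apply/smoothP => k; exact: CkM. Qed.

Lemma smoothN f : smooth U f -> smooth U (fun x => - f x).
Proof. by move=> /smoothP sf; apply/smoothP => k; exact: CkN. Qed.

Lemma smoothB f g : smooth U f -> smooth U g -> smooth U (fun x => f x - g x).
Proof. by move=> sf sg; apply/smoothD/smoothN. Qed.

Lemma smoothX f m : smooth U f -> smooth U (fun x => f x ^+ m).
Proof.
move=> sf; elim: m => [|m IH]; first exact: (smooth_cst (1 : R)).
by apply: eq_on_smooth (smoothM sf IH) => x _; rewrite exprS.
Qed.

Lemma smoothV f : (forall q, U q -> f q != 0) -> smooth U f ->
  smooth U (fun x => (f x)^-1).
Proof. by move=> f0 /smoothP sf; apply/smoothP => k; exact: CkV. Qed.

Lemma smooth_expR f : smooth U f -> smooth U (fun x => expR (f x)).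
Proof. by move=> /smoothP sf; apply/smoothP => k; exact: Ck_expR. Qed.

Lemma smooth_sum m (f : 'I_m -> 'rV[R]_n.+1 -> R) :
  (forall i, smooth U (f i)) -> smooth U (fun x => \sum_i f i x).
Proof.
elim: m f => [|m IH] f sf.
  by apply: eq_on_smooth (smooth_cst (0 : R)) => x _; rewrite big_ord0.
apply: eq_on_smooth (smoothD (sf ord0) (IH (fun i => f (lift ord0 i)) _)) => // x _.
by rewrite big_ord_recl.
Qed.

Lemma smooth_mx m p (f : 'rV[R]_n.+1 -> 'M[R]_(m, p)) :
  smooth U f <-> forall i j, smooth U (fun x => f x i j).
Proof.
split=> [/smoothP sf i j|sf]; apply/smoothP => k.
  by have /Ck_mx := sf k; exact.
by apply/Ck_mx => // i j; have /smoothP := sf i j; exact.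
Qed.

Lemma smooth_mulmx m p l (f : 'rV[R]_n.+1 -> 'M[R]_(m, p))
    (g : 'rV[R]_n.+1 -> 'M[R]_(p, l)) :
  smooth U f -> smooth U g -> smooth U (fun x => f x *m g x).
Proof.
move=> /smooth_mx sf /smooth_mx sg; apply/smooth_mx => i j.
apply: (eq_on_smooth (f := fun x => \sum_k f x i k * g x k j)).
  by move=> x _; rewrite mxE.
by apply: smooth_sum => k; apply: smoothM.
Qed.

End SmoothAlgebra.

Section Schwarz.
Context {R : realType} {n : nat}.
Implicit Types (U : set 'rV[R]_n.+1) (f g : 'rV[R]_n.+1 -> R) (q : 'rV[R]_n.+1).

Lemma is_derive_line f q v t : differentiable f (q + t *: v) ->
  is_derive t 1 (fun s : R => f (q + s *: v)) ('D_v f (q + t *: v)).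
Proof.
move=> df.
have dl : is_diff t (fun s : R => q + s *: v) (fun s : R => s *: v).
  have := is_diffD (is_diff_cst q t) (is_diff_scalel t v).
  by rewrite add0r.
have /= := is_diff_comp dl (differentiableP df) => dc.
split; first by apply: diff_derivable; case: dc.
by rewrite deriveE ?diff_val /= ?scale1r ?deriveE //; case: dc.
Qed.

Lemma mean_value_line f q v h : 0 < h ->
  (forall t, 0 <= t <= h -> differentiable f (q + t *: v)) ->
  exists2 t, 0 < t < h & f (q + h *: v) - f q = h * 'D_v f (q + t *: v).
Proof.
move=> h0 df.
have [] := @MVT R (fun s => f (q + s *: v)) (fun t => 'D_v f (q + t *: v)) 0 h h0.
- by move=> t; rewrite in_itv /= => /andP[/ltW t0 /ltW th]; apply/is_derive_line/df/andP.
- apply: derivable_within_continuous => t; rewrite in_itv /= => th.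
  by case: (is_derive_line (df t th)).
- move=> t; rewrite in_itv /= => th; rewrite scale0r addr0 subr0 mulrC => E.
  by exists t.
Qed.

(** The mixed second difference of [f] over the parallelogram with sides
    [h v], [h w] is [h ^+ 2] times a mixed second derivative at some point of
    that parallelogram, and it is symmetric in [v] and [w]. *)
Lemma mixed_difference f q v w h : 0 < h ->
  (forall s t, 0 <= s <= h -> 0 <= t <= h ->
     differentiable f (q + s *: v + t *: w)) ->
  (forall s t, 0 <= s <= h -> 0 <= t <= h ->
     differentiable ('D_v f) (q + s *: v + t *: w)) ->
  exists s t, [/\ 0 < s < h, 0 < t < h &
    f (q + h *: v + h *: w) - f (q + h *: v) - (f (q + h *: w) - f q) =
    h * (h * 'D_w ('D_v f) (q + s *: v + t *: w))].
Proof.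
move=> h0 df ddf.
have hh : 0 <= h <= h by rewrite lexx ltW.
have h00 : 0 <= (0 : R) <= h by rewrite lexx ltW.
pose g x := f (x + h *: w) - f x.
have dg s : 0 <= s <= h -> differentiable g (q + s *: v) /\
    'D_v g (q + s *: v) = 'D_v f (q + s *: v + h *: w) - 'D_v f (q + s *: v).
  move=> sh; have d0 : differentiable f (q + s *: v).
    by have := df s 0 sh h00; rewrite scale0r addr0.
  have dT : is_diff (q + s *: v) (fun x => x + h *: w) id.
    have := is_diffD (is_diff_id (q + s *: v)) (is_diff_cst (h *: w) (q + s *: v)).
    by rewrite addr0.
  have /= dc := is_diff_comp dT (differentiableP (df s h sh hh)).
  have [d1 dE] := dc.
  split; first exact: differentiableB.
  rewrite /g deriveB; try exact: diff_derivable.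
  have df1 := df s h sh hh.
  have -> // : 'D_v (fun x => f (x + h *: w)) (q + s *: v) =
    'D_v f (q + s *: v + h *: w).
  by rewrite (deriveE _ d1) (deriveE _ df1); apply: (congr1 (@^~ v) dE).
have [|s sh Es] := @mean_value_line g q v h h0.
  by move=> t /dg[].
have sh' : 0 <= s <= h by case/andP: sh => /ltW -> /ltW ->.
have [|t th Et] := @mean_value_line ('D_v f) (q + s *: v) w h h0.
  by move=> t th; apply: ddf.
by exists s, t; split=> //; rewrite -Et -(dg s sh').2 -Es /g.
Qed.

(** Schwarz's theorem. By [mixed_difference] both mixed derivatives take a common
    value at points arbitrarily close to [q], where they are continuous. *)
Lemma partial_commute U f i j q : open U -> smooth U f -> U q ->
  partial i (partial j f) q = partial j (partial i f) q.
Proof.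
move=> oU sf Uq.
pose e k : 'rV[R]_n.+1 := delta_mx 0 k.
have [d /= d0 dU] : exists2 d : R, 0 < d & ball q d `<=` U.
  have /nbhs_ballP[d /= d0 dU] := open_nbhs_nbhs (conj oU Uq).
  by exists d.
have inb h s t k l : 0 < h -> 0 <= s <= h -> 0 <= t <= h ->
    forall r, 2 * h < r -> ball q r (q + s *: e k + t *: e l).
  move=> h0 /andP[s0 sh] /andP[t0 th] r hr; rewrite -ball_normE /ball_ /=.
  rewrite -addrA opprD addNKr normrN.
  have ne m : `|e m| <= 1.
    rewrite /e [leLHS]/Num.Def.normr /= mx_normrE.
    apply: bigmax_le => // -[a b] _; rewrite mxE.
    by case: (_ && _); rewrite ?normr1 ?normr0.
  apply: le_lt_trans (ler_normD _ _) _; rewrite !normrZ !ger0_norm //.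
  apply: le_lt_trans hr; rewrite mulr2n mulrDl mul1r.
  apply: lerD.
    by rewrite -[leRHS]mulr1; apply: ler_pM.
  by rewrite -[leRHS]mulr1; apply: ler_pM.
have third (a : R) : 0 < a -> 2 * (a / 3) < a by move=> a0; lra.
have close (a b c c' : R) : `|b - c'| < `|a - b| / 2 -> `|a - c| < `|a - b| / 2 ->
    c' = c -> False.
  move=> A1 A2 Ec; rewrite Ec distrC in A1.
  have := ler_normD (a - c) (c - b); rewrite subrKA.
  by move=> /le_lt_trans/(_ (ltrD A2 A1)); rewrite -splitr ltxx.
have cont k l : {for q, continuous (partial k (partial l f))}.
  apply/differentiable_continuous/smooth_differentiable/Uq.
  exact/smooth_partial/smooth_partial.
apply/eqP/negPn/negP => neq.
pose ep := `|partial i (partial j f) q - partial j (partial i f) q| / 2.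
have ep0 : 0 < ep by rewrite divr_gt0 // normr_gt0 subr_eq0.
have get_ball k l : exists2 r : R, 0 < r & forall x, ball q r x ->
    `|partial k (partial l f) q - partial k (partial l f) x| < ep.
  have /cvgrPdist_lt/(_ _ ep0) := cont k l.
  by case/nbhs_ballP => r /= r0 rE; exists r.
have [r1 r10 r1E] := get_ball i j; have [r2 r20 r2E] := get_ball j i.
pose r := Order.min d (Order.min r1 r2).
have r0 : 0 < r by rewrite !lt_min d0 r10 r20.
pose h := r / 3; have h0 : 0 < h by rewrite divr_gt0.
have hr : 2 * h < r by exact: third.
have [hd h1 h2] : [/\ 2 * h < d, 2 * h < r1 & 2 * h < r2].
  by move: hr; rewrite !lt_min => /and3P[].
have dUp k l s t : 0 <= s <= h -> 0 <= t <= h -> U (q + s *: e k + t *: e l).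
  by move=> sh th; apply/dU/(inb h).
have [s [t [sh th E1]]] := @mixed_difference f q (e i) (e j) h h0
  (fun s t sh th => smooth_differentiable sf (dUp i j s t sh th))
  (fun s t sh th => smooth_differentiable (smooth_partial i sf) (dUp i j s t sh th)).
have [s' [t' [sh' th' E2]]] := @mixed_difference f q (e j) (e i) h h0
  (fun s t sh th => smooth_differentiable sf (dUp j i s t sh th))
  (fun s t sh th => smooth_differentiable (smooth_partial j sf) (dUp j i s t sh th)).
have W a : 0 < a < h -> 0 <= a <= h by case/andP => /ltW -> /ltW ->.
have E : partial j (partial i f) (q + s *: e i + t *: e j) =
         partial i (partial j f) (q + s' *: e j + t' *: e i).
  have hN0 : h != 0 by rewrite gt_eqF.
  apply: (mulfI hN0); apply: (mulfI hN0).
  transitivity (f (q + h *: e i + h *: e j) - f (q + h *: e i) -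
    (f (q + h *: e j) - f q)); first exact/esym/E1.
  transitivity (f (q + h *: e j + h *: e i) - f (q + h *: e j) -
    (f (q + h *: e i) - f q)); last exact: E2.
  rewrite [q + h *: e i + h *: e j]addrAC !opprB addrACA [RHS]addrACA.
  by congr (_ + _); exact: addrC.
have [x [y [/r2E A1 /r1E A2 Exy]]] : exists x y, [/\ ball q r2 x, ball q r1 y
    & partial j (partial i f) x = partial i (partial j f) y].
  exists (q + s *: e i + t *: e j), (q + s' *: e j + t' *: e i).
  split; last exact: E.
    exact: (inb h s t i j h0 (W _ sh) (W _ th) _ h2).
  exact: (inb h s' t' j i h0 (W _ sh') (W _ th') _ h1).
exact: (close _ _ _ _ A1 A2 Exy).
Qed.

End Schwarz.

(** * Exterior calculus in coordinates *)

Section ChainRule.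
Context {R : realType} {m n : nat}.
Implicit Types (Phi : 'rV[R]_m.+1 -> 'rV[R]_n.+1) (q : 'rV[R]_m.+1).

Lemma jacobian_partial Phi q i k : differentiable Phi q ->
  ('J Phi q) i k = partial i (fun x => Phi x 0 k) q.
Proof.
move=> dPhi; have := deriveEjacobian (delta_mx 0 i) dPhi; rewrite -rowE => E.
have -> : ('J Phi q) i k = (row i ('J Phi q)) 0 k by rewrite [RHS]mxE.
by rewrite -E derive_mx ?mxE //; exact: diff_derivable.
Qed.

Lemma differentiable_comp_coord Phi (g : 'rV[R]_n.+1 -> R) q :
  differentiable Phi q -> differentiable g (Phi q) ->
  differentiable (fun x => g (Phi x)) q.
Proof. by move=> dPhi dg; exact: (differentiable_comp dPhi dg). Qed.

Lemma partial_comp Phi (g : 'rV[R]_n.+1 -> R) i q :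
  differentiable Phi q -> differentiable g (Phi q) ->
  partial i (fun x => g (Phi x)) q =
  \sum_k partial i (fun x => Phi x 0 k) q * partial k g (Phi q).
Proof.
move=> dPhi dg.
transitivity ('D_('D_(delta_mx 0 i) Phi q) g (Phi q)).
  rewrite /partial deriveE; last exact: differentiable_comp_coord.
  have [_ /(congr1 (@^~ (delta_mx 0 i))) /= ->] :=
    is_diff_comp (differentiableP dPhi) (differentiableP dg).
  by rewrite deriveE // deriveE.
rewrite derive_partial //; apply: eq_bigr => k _; congr (_ * _).
by rewrite derive_mx ?mxE //; exact: diff_derivable.
Qed.

End ChainRule.

Section Wedge.
Context {R : realType} {n : nat}.
Implicit Types a b c : 'rV[R]_n.

Lemma wedgeE a b i j : (a \wedge b) i j = a 0 i * b 0 j - b 0 i * a 0 j.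
Proof. by rewrite !mxE !big_ord1 !mxE. Qed.

Lemma wedgeDr a b c : a \wedge (b + c) = a \wedge b + a \wedge c.
Proof. by rewrite /wedge mulmxDr linearD mulmxDl opprD addrACA. Qed.

Lemma wedgeN a b : a \wedge (- b) = - (a \wedge b).
Proof. by rewrite /wedge mulmxN linearN mulNmx opprB opprK addrC. Qed.

(** Change of basis of a two-form, and also its pull-back when [P] is the transpose
    of a Jacobian matrix. *)
Lemma mulmx_wedge m (P : 'M[R]_(n, m)) a b :
  P^T *m (a \wedge b) *m P = (a *m P) \wedge (b *m P).
Proof. by rewrite /wedge mulmxBr mulmxBl !trmx_mul !mulmxA. Qed.

End Wedge.

Section ExteriorDerivative.
Context {R : realType} {n : nat}.
Implicit Types (f : 'rV[R]_n.+1 -> R) (a b : 'rV[R]_n.+1 -> 'rV[R]_n.+1).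

Lemma dformE a q i j : dform a q i j =
  partial i (fun x => a x 0 j) q - partial j (fun x => a x 0 i) q.
Proof. by rewrite mxE. Qed.

Lemma eq_on_dform U a b q : open U -> U q -> (forall x, U x -> a x = b x) ->
  dform a q = dform b q.
Proof.
move=> oU Uq ab; apply/matrixP => i j; rewrite !dformE.
by congr (_ - _); apply: (eq_on_partial _ oU) => // x /ab ->.
Qed.

Lemma eq_on_dfun U f g q : open U -> U q -> (forall x, U x -> f x = g x) ->
  dfun f q = dfun g q.
Proof.
by move=> oU Uq fg; apply/rowP => i; rewrite !mxE; apply: (eq_on_partial _ oU).
Qed.

Lemma differentiable_entry m p (W : 'rV[R]_n.+1 -> 'M[R]_(m, p)) q i j :
  differentiable W q -> differentiable (fun x => W x i j) q.
Proof. by move=> dW; exact: (differentiable_comp dW (differentiable_coord _ i j)). Qed.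

Lemma differentiable_scale p l f (g : 'rV[R]_n.+1 -> 'M[R]_(p, l)) q :
  differentiable f q -> differentiable g q -> differentiable (fun x => f x *: g x) q.
Proof.
move=> df dg; apply: (@differentiable_mx _ _ _ _ setT) => i j.
rewrite (_ : (fun x => _) = (fun x => f x * g x i j)); last first.
  by apply/funext => x; rewrite mxE.
by apply: differentiableM => //; exact: (@differentiable_entry _ _ g).
Qed.

Lemma dformD a b q : differentiable a q -> differentiable b q ->
  dform (fun x => a x + b x) q = dform a q + dform b q.
Proof.
move=> da db; apply/matrixP => i j; rewrite [RHS]mxE !dformE.
have dE k : partial k (fun x => (a x + b x) 0 j) q =
    partial k (fun x => a x 0 j) q + partial k (fun x => b x 0 j) q.
  rewrite -partialD; try exact: differentiable_entry.
  by congr (partial _ _ _); apply/funext => x; rewrite mxE.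
have dE' k : partial k (fun x => (a x + b x) 0 i) q =
    partial k (fun x => a x 0 i) q + partial k (fun x => b x 0 i) q.
  rewrite -partialD; try exact: differentiable_entry.
  by congr (partial _ _ _); apply/funext => x; rewrite mxE.
by rewrite dE dE' opprD addrACA.
Qed.

Lemma dformZ f a q : differentiable f q -> differentiable a q ->
  dform (fun x => f x *: a x) q = dfun f q \wedge a q + f q *: dform a q.
Proof.
move=> df da; apply/matrixP => i j.
have dE k l : partial k (fun x => (f x *: a x) 0 l) q =
    partial k f q * a q 0 l + f q * partial k (fun x => a x 0 l) q.
  rewrite -partialM //; try exact: differentiable_entry.
  by congr (partial _ _ _); apply/funext => x; rewrite mxE.
rewrite dformE !dE [RHS]mxE wedgeE !mxE mulrBr.
by rewrite opprD addrACA [_ * partial j f q]mulrC.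
Qed.

Lemma dform_sum m (a : 'I_m -> 'rV[R]_n.+1 -> 'rV[R]_n.+1) q :
  (forall k, differentiable (a k) q) ->
  dform (fun x => \sum_k a k x) q = \sum_k dform (a k) q.
Proof.
move=> da; apply/matrixP => i j; rewrite dformE summxE.
have dE k l : partial k (fun x => (\sum_h a h x) 0 l) q =
    \sum_h partial k (fun x => a h x 0 l) q.
  rewrite -partial_sum; last by move=> h; exact: differentiable_entry.
  by congr (partial _ _ _); apply/funext => x; rewrite summxE.
by rewrite !dE -sumrB; apply: eq_bigr => k _; rewrite dformE.
Qed.

(** The Leibniz rule for the rows of a product [A *m W]. *)
Lemma dform_mulmx m p (A : 'rV[R]_n.+1 -> 'M[R]_(m, p))
    (W : 'rV[R]_n.+1 -> 'M[R]_(p, n.+1)) q i :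
  differentiable A q -> differentiable W q ->
  dform (fun x => row i (A x *m W x)) q =
  \sum_k (dfun (fun x => A x i k) q \wedge row k (W q)
          + A q i k *: dform (fun x => row k (W x)) q).
Proof.
move=> dA dW.
have dr k : differentiable (fun x => row k (W x)) q.
  apply: (@differentiable_mx _ _ _ _ setT) => a b.
  rewrite (_ : (fun x => _) = (fun x => W x k b)); first exact: differentiable_entry.
  by apply/funext => x; rewrite mxE.
rewrite (_ : (fun x => _) = (fun x => \sum_k A x i k *: row k (W x))); last first.
  apply/funext => x; apply/rowP => j; rewrite !mxE summxE.
  by apply: eq_bigr => k _; rewrite !mxE.
rewrite dform_sum => [|k]; last first.
  by apply: differentiable_scale => //; exact: differentiable_entry.
by apply: eq_bigr => k _; rewrite dformZ //; exact: differentiable_entry.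
Qed.

End ExteriorDerivative.

Section Naturality.
Context {R : realType} {m n : nat}.

(** The exterior derivative commutes with pull-backs: the second derivatives of
    [Phi] cancel by symmetry. *)
Lemma dform_pullback (U : set 'rV[R]_m.+1) (Phi : 'rV[R]_m.+1 -> 'rV[R]_n.+1)
    (a : 'rV[R]_n.+1 -> 'rV[R]_n.+1) q :
  open U -> smooth U Phi -> U q -> differentiable a (Phi q) ->
  dform (fun x => a (Phi x) *m ('J Phi x)^T) q =
  'J Phi q *m dform a (Phi q) *m ('J Phi q)^T.
Proof.
move=> oU sPhi Uq da.
have dPhi x : U x -> differentiable Phi x by exact: smooth_differentiable.
have sc k : smooth U (fun x => Phi x 0 k) by have /(smooth_mx oU) := sPhi; exact.
have dE i j : partial i (fun x => (a (Phi x) *m ('J Phi x)^T) 0 j) q =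
    \sum_k ((\sum_l partial i (fun x => Phi x 0 l) q *
                    partial l (fun y => a y 0 k) (Phi q)) *
            partial j (fun x => Phi x 0 k) q +
            a (Phi q) 0 k * partial i (partial j (fun x => Phi x 0 k)) q).
  rewrite (eq_on_partial (g := fun x => \sum_k a (Phi x) 0 k *
     partial j (fun y => Phi y 0 k) x) _ oU) //; last first.
    move=> x Ux; rewrite mxE; apply: eq_bigr => k _.
    by rewrite mxE jacobian_partial //; exact: dPhi.
  have dak k : differentiable (fun x => a (Phi x) 0 k) q.
    apply: (@differentiable_comp_coord _ _ _ Phi (fun y => a y 0 k)); first exact: dPhi.
    exact: differentiable_entry.
  have dpk k : differentiable (partial j (fun y => Phi y 0 k)) q.
    exact/smooth_differentiable/Uq/smooth_partial.
  rewrite partial_sum => [|k]; last exact: differentiableM.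
  apply: eq_bigr => k _; rewrite partialM //; congr (_ * _ + _).
  rewrite (@partial_comp _ _ _ Phi (fun y => a y 0 k)) //; first exact: dPhi.
  exact: differentiable_entry.
apply/matrixP => i j; rewrite dformE !dE -sumrB.
have -> : ('J Phi q *m dform a (Phi q) *m ('J Phi q)^T) i j =
    \sum_l \sum_k partial i (fun x => Phi x 0 l) q *
      ((partial l (fun y => a y 0 k) (Phi q) - partial k (fun y => a y 0 l) (Phi q)) *
       partial j (fun x => Phi x 0 k) q).
  rewrite -mulmxA mxE; apply: eq_bigr => l _.
  rewrite [X in _ * X]mxE jacobian_partial ?mulr_sumr; last exact: dPhi.
  apply: eq_bigr => k _; rewrite [X in _ * (_ * X)]mxE jacobian_partial; last exact: dPhi.
  by rewrite dformE.
rewrite exchange_big /=.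
transitivity (\sum_k \sum_l partial i (fun x => Phi x 0 l) q *
    (partial l (fun x => a x 0 k) (Phi q) * partial j (fun x => Phi x 0 k) q) -
  \sum_k \sum_l partial i (fun x => Phi x 0 l) q *
    (partial k (fun x => a x 0 l) (Phi q) * partial j (fun x => Phi x 0 k) q)); last first.
  rewrite -sumrB; apply: eq_bigr => k _; rewrite -sumrB; apply: eq_bigr => l _.
  by rewrite mulrBl mulrBr.
rewrite [X in _ = _ - X]exchange_big /= -sumrB; apply: eq_bigr => k _.
rewrite (partial_commute _ _ oU (sc k) Uq) opprD addrACA subrr addr0.
congr (_ - _); rewrite mulr_suml; apply: eq_bigr => l _; first by rewrite mulrA.
by rewrite mulrC [X in _ * X]mulrC.
Qed.

End Naturality.

(** The common shape of the equations satisfied on [M] by the adapted coframe and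
    on the bundle by the lifted coframe. They are stated at one point, so that
    linear algebra applies: the [dw]s stand for the exterior derivatives and the
    [v]s for the connection forms. *)
Definition structure_eqs {R : realType} {n : nat} (w1 w2 w3 w4 w5 : 'rV[R]_n)
    (dw1 dw2 dw3 dw4 dw5 : 'M[R]_n) (v1 v2 v3 v4 : 'rV[R]_n)
    (i1 i2 i3 k t : R) : Prop :=
  [/\ dw1 = - (w1 \wedge v1) + w2 \wedge w4,
      dw2 = w2 \wedge (v2 - 2^-1 *: v1) - w1 \wedge v3 + w3 \wedge w4,
      dw3 = 2 *: (w3 \wedge v2) - w2 \wedge v3 + i1 *: (w1 \wedge w4)
            + i3 *: (w2 \wedge w3) + t *: (w1 \wedge w3),
      dw4 = - (w2 \wedge w5) - w4 \wedge (2^-1 *: v1 + v2) - w1 \wedge v4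
    & dw5 = - (2 *: (w5 \wedge v2)) + w4 \wedge v4 + i2 *: (w1 \wedge w2)
            - k *: (w4 \wedge w5) + t *: (w1 \wedge w5)].

(** * Symbolic jets *)

(** A symbolic differential polynomial in the jets of [F] and [H]: [FJ s] and
    [HJ s] are the iterated partial derivatives along the (sorted) list of
    coordinates [s], numbered as in (x, y, z, p, r), and [IP] is the inverse of
    [F_pp]. *)
Inductive dexp : Type :=
| Qc of nat & nat
| Xp | Xr
| FJ of seq nat | HJ of seq nat
| IP
| Ad of dexp & dexp | Ne of dexp | Mu of dexp & dexp.

(* The smart constructors only drop trivial terms, which keeps the computed
   derivatives small. *)
Definition zero := Qc 0 1.
Definition one := Qc 1 1.
Definition isz e := if e is Qc 0 _ then true else false.
Definition isone e := if e is Qc 1 1 then true else false.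
Definition ad e f := if isz e then f else if isz f then e else Ad e f.
Definition ne e := if isz e then zero else Ne e.
Definition mu e f :=
  if isz e || isz f then zero else
  if isone e then f else if isone f then e else Mu e f.
Definition sb e f := ad e (ne f).
Definition sumx (s : seq dexp) := foldr ad zero s.

Fixpoint ins (i : nat) (s : seq nat) : seq nat :=
  if s is j :: s' then if (i <= j)%N then i :: s else j :: ins i s' else [:: i].

(** The derivation along coordinate [i]; [dHy s] is the expression that stands
    for the y-derivative of the jet [HJ s]. *)
Fixpoint dx (dHy : seq nat -> dexp) (i : nat) (e : dexp) : dexp :=
  match e with
  | Qc _ _ => zero
  | Xp => if i == 3%N then one else zero
  | Xr => if i == 4%N then one else zero
  | FJ s => if i == 4%N then zero else FJ (ins i s)
  | HJ s => if i == 1%N then dHy s else HJ (ins i s)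
  | IP => if i == 4%N then zero else ne (mu (FJ (ins i [:: 3; 3])) (mu IP IP))
  | Ad e f => ad (dx dHy i e) (dx dHy i f)
  | Ne e => ne (dx dHy i e)
  | Mu e f => ad (mu (dx dHy i e) f) (mu e (dx dHy i f))
  end.

Definition Dwith (d : nat -> dexp -> dexp) e :=
  ad (d 0 e) (ad (mu Xp (d 2 e)) (ad (mu Xr (d 3 e)) (mu (HJ [::]) (d 4 e)))).

Definition d0 := dx (fun=> zero).
Definition xF := FJ [::].
Definition xDF := Eval vm_compute in Dwith d0 xF.
Definition xDDF := Eval vm_compute in Dwith d0 xDF.

(** [D^3 F = Delta H], solved for [H_y]: no other y-derivative occurs in it, so
    the y-derivatives of all jets of [H] can be eliminated, and the remaining
    jets are free. *)
Definition xHy := Eval vm_compute in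
  sb (Dwith d0 xDDF)
     (ad (mu xF (HJ [:: 2])) (ad (mu xDF (HJ [:: 3])) (mu xDDF (HJ [:: 4])))).

Definition dHy (s : seq nat) := foldr d0 xHy s.
Definition dd := dx dHy.
Definition xD := Dwith dd.

(** Expressions in which no jet of [H] involves y: on these the derivations [dd] are
    closed. *)
Fixpoint yfree (e : dexp) : bool :=
  match e with
  | HJ s => all (fun i => (i != 1%N) && (i < 5)%N) s
  | Ad e f | Mu e f => yfree e && yfree f
  | Ne e => yfree e
  | _ => true
  end.

Section Eval.
Context {R : fieldType}.
Variables (jF jH : seq nat -> R) (p r : R).

Fixpoint ev (e : dexp) : R :=
  match e with
  | Qc a b => a%:R / b%:R
  | Xp => p
  | Xr => r
  | FJ s => jF s
  | HJ s => jH s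
  | IP => (jF [:: 3; 3])^-1
  | Ad e f => ev e + ev f
  | Ne e => - ev e
  | Mu e f => ev e * ev f
  end.

Lemma ev_zero : ev zero = 0. Proof. by rewrite /= mul0r. Qed.
Lemma ev_one : ev one = 1. Proof. by rewrite /= divr1. Qed.

Lemma iszP e : isz e -> ev e = 0.
Proof. by case: e => //= -[|?] //= b _; rewrite mul0r. Qed.

Lemma isoneP e : isone e -> ev e = 1.
Proof. by case: e => //= -[|[|?]] // [|[|?]] //= _; rewrite divr1. Qed.

Lemma ev_ad e f : ev (ad e f) = ev e + ev f.
Proof.
rewrite /ad; case: ifP => [/iszP ->|_]; first by rewrite add0r.
by case: ifP => [/iszP ->|_] //; rewrite addr0.
Qed.

Lemma ev_ne e : ev (ne e) = - ev e.
Proof. by rewrite /ne; case: ifP => [/iszP ->|_] //; rewrite ev_zero oppr0. Qed.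

Lemma ev_mu e f : ev (mu e f) = ev e * ev f.
Proof.
rewrite /mu; case: ifP => [/orP[|] /iszP ->|_]; rewrite ?mulr0 ?mul0r ?ev_zero //.
case: ifP => [/isoneP ->|_]; first by rewrite mul1r.
by case: ifP => [/isoneP ->|_] //; rewrite mulr1.
Qed.

Lemma ev_sb e f : ev (sb e f) = ev e - ev f.
Proof. by rewrite ev_ad ev_ne. Qed.

Lemma ev_sumx s : ev (sumx s) = \sum_(e <- s) ev e.
Proof.
elim: s => [|e s IH]; first by rewrite big_nil ev_zero.
by rewrite big_cons /= ev_ad -/(sumx s) IH.
Qed.

End Eval.

Lemma yfree_ad e f : yfree e -> yfree f -> yfree (ad e f).
Proof. by rewrite /ad; case: ifP => // _; case: ifP => //= _ -> ->. Qed.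

Lemma yfree_ne e : yfree e -> yfree (ne e).
Proof. by rewrite /ne; case: ifP. Qed.

Lemma yfree_mu e f : yfree e -> yfree f -> yfree (mu e f).
Proof. by rewrite /mu; do 3![case: ifP => // _] => /= -> ->. Qed.

Lemma perm_ins i s : perm_eq (ins i s) (i :: s).
Proof.
elim: s => //= j s IH; case: ifP => // _.
apply: (perm_trans (y := j :: i :: s)); first by rewrite perm_cons.
exact: (permEl (perm_catCA [:: j] [:: i] s)).
Qed.

Lemma yfree_dx d i e : (i < 5)%N -> (i == 1%N -> forall s, yfree (HJ s) -> yfree (d s)) ->
  yfree e -> yfree (dx d i e).
Proof.
move=> i5 yd; elim: e => //=.
- by case: ifP.
- by case: ifP.
- by move=> s; case: ifP.
- move=> s ys; case: ifPn => [/yd|i1 /=]; first by apply.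
  by rewrite (perm_all _ (perm_ins i s)) /= i1 i5.
- case: ifP => // _ _; by rewrite !yfree_ne ?yfree_mu.
- by move=> e IHe f IHf /andP[/IHe ye /IHf yf]; apply: yfree_ad.
- by move=> e IHe /IHe; apply: yfree_ne.
- move=> e IHe f IHf /andP[ye yf].
  by apply: yfree_ad; apply: yfree_mu; rewrite ?IHe ?IHf.
Qed.

Lemma yfree_d0 i e : (i < 5)%N -> yfree e -> yfree (d0 i e).
Proof. by move=> i5; apply: yfree_dx. Qed.

Lemma yfree_dHy s : yfree (HJ s) -> yfree (dHy s).
Proof.
elim: s => [_|i s IH /= /andP[/andP[_ i5] /IH]]; first by vm_compute.
exact: yfree_d0.
Qed.

Lemma yfree_dd i e : (i < 5)%N -> yfree e -> yfree (dd i e).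
Proof. by move=> i5; apply: yfree_dx => // _ s; exact: yfree_dHy. Qed.

Definition crd (k : nat) : 'I_5 :=
  match k with 0 => ix | 1 => iy | 2 => iz | 3 => ip | _ => ir end.

Lemma crdE (i : 'I_5) : crd i = i.
Proof. by apply: val_inj; case: i => -[|[|[|[|[|]]]]]. Qed.

Definition jet {R : realType} (f : 'rV[R]_5 -> R) (s : seq nat) : 'rV[R]_5 -> R :=
  foldr partial f (map crd s).

Section Jets.
Context {R : realType} {M : set 'rV[R]_5}.
Hypothesis oM : open M.
Implicit Types (f : 'rV[R]_5 -> R).

Lemma smooth_jet f s : smooth M f -> smooth M (jet f s).
Proof. by move=> sf; elim: s => //= i s IH; apply: smooth_partial. Qed.

Lemma eq_on_jet f g s q : (forall x, M x -> f x = g x) -> M q -> jet f s q = jet g s q.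
Proof.
by move=> fg; elim: s q => [|i s IH] q Mq; [exact: fg|exact: (eq_on_partial _ oM)].
Qed.

Lemma jet_rcons f s i : jet f (rcons s i) = jet (partial (crd i) f) s.
Proof. by rewrite /jet map_rcons foldr_rcons. Qed.

(** Jets are indexed by sorted lists, so symbolic differentiation inserts an index
    where the analytic derivative prepends it. *)
Lemma jet_perm f s t q : smooth M f -> perm_eq s t -> M q -> jet f s q = jet f t q.
Proof.
move=> sf; elim: s t q => [|i s IH] t q st Mq.
  by move: st; rewrite perm_sym => /perm_nilP ->.
have it : i \in t by rewrite -(perm_mem st) mem_head.
have [t1 [t2 Et]] : exists t1 t2, t = t1 ++ i :: t2.
  exists (take (index i t) t), (drop (index i t).+1 t).
  by rewrite -{1}(cat_take_drop (index i t) t) (drop_nth i) ?index_mem // nth_index.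
have {}st : perm_eq s (t1 ++ t2).
  rewrite -(perm_cons i) (perm_trans st) // Et.
  exact: (permEl (perm_catCA t1 [:: i] t2)).
rewrite Et {t Et it}.
transitivity (jet f (i :: t1 ++ t2) q).
  by apply: (eq_on_partial _ oM) => // x Mx; exact: IH.
elim: t1 {IH st} q Mq => [|j t1 IH] q Mq //.
transitivity (partial (crd j) (jet f (i :: t1 ++ t2)) q).
  apply: (partial_commute _ _ oM) => //; exact: smooth_jet.
by apply: (eq_on_partial _ oM) => // x Mx; exact: IH.
Qed.

End Jets.

Section Semantics.
Context {R : realType} {M : set 'rV[R]_5} {F : 'rV[R]_4 -> R} {H : 'rV[R]_5 -> R}.

Definition evq (e : dexp) (q : 'rV[R]_5) : R :=
  ev (fun s => jet (pullr F) s q) (fun s => jet H s q) (q 0 ip) (q 0 ir) e.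

Arguments evq : simpl never.

Lemma evq_zero q : evq zero q = 0. Proof. exact: ev_zero. Qed.
Lemma evq_one q : evq one q = 1. Proof. exact: ev_one. Qed.
Lemma evq_ad e f q : evq (ad e f) q = evq e q + evq f q.
Proof. exact: ev_ad. Qed.
Lemma evq_ne e q : evq (ne e) q = - evq e q. Proof. exact: ev_ne. Qed.
Lemma evq_mu e f q : evq (mu e f) q = evq e q * evq f q.
Proof. exact: ev_mu. Qed.
Lemma evq_sb e f q : evq (sb e f) q = evq e q - evq f q.
Proof. exact: ev_sb. Qed.
Hypothesis hMFH : integrable_system M F H.
Let oM : open M. Proof. by case: hMFH. Qed.
Let sF : smooth M (pullr F). Proof. by case: hMFH. Qed.
Let sH : smooth M H. Proof. by case: hMFH. Qed.
Let Fpp0 q : M q -> jet (pullr F) [:: 3%N; 3%N] q != 0.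
Proof. by case: hMFH => _ _ _ h _ /h. Qed.

Lemma partial_r_pullr q : partial ir (pullr F) q = 0.
Proof.
rewrite /partial /derive.
rewrite (_ : (fun h => _) = fun=> 0) ?lim_cst //.
apply/funext => h; rewrite /pullr /=.
rewrite (_ : lsubmx _ = lsubmx (q : 'rV_(4 + 1))) ?subrr ?scaler0 //.
apply/rowP => j; rewrite !mxE eqxx /=.
rewrite (_ : _ == ir = false) ?mulr0 ?add0r //.
by apply/eqP => /(congr1 val) /= E; have := ltn_ord j; rewrite E.
Qed.

Lemma partial_r_jetF s q : M q -> partial ir (jet (pullr F) s) q = 0.
Proof.
move=> Mq; transitivity (jet (pullr F) (rcons s 4) q).
  by apply: (@jet_perm _ _ oM _ (4%N :: s)) => //; rewrite perm_sym perm_rcons.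
rewrite jet_rcons; transitivity (jet (fun=> 0 : R) s q).
  by apply: (eq_on_jet oM) => // x _; exact: partial_r_pullr.
elim: s q Mq => //= i s IH q Mq.
rewrite -[RHS](partial_cst 0 (crd i) q).
by apply: (eq_on_partial _ oM) => // x Mx; exact: IH.
Qed.

Lemma smooth_ev e : smooth M (evq e).
Proof.
elim: e => [a b|||s|s||e IHe f IHf|e IHe|e IHe f IHf].
- exact: smooth_cst.
- exact: smooth_coord.
- exact: smooth_coord.
- exact: (smooth_jet s sF).
- exact: (smooth_jet s sH).
- by apply: smoothV => //; exact: (smooth_jet [:: 3%N; 3%N] sF).
- exact: smoothD.
- exact: smoothN.
- exact: smoothM.
Qed.

Let dev_ e q : M q -> differentiable (evq e) q.
Proof. by move=> Mq; exact: smooth_differentiable (smooth_ev e) Mq. Qed.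

(** The hypothesis on [d] is vacuous for [i != 1]. This lets [xHy], which only
    differentiates along the other coordinates, be justified before [dHy]. *)
Lemma dx_correct d i e q : (i < 5)%N -> M q ->
  (i = 1%N -> forall s, yfree (HJ s) -> partial iy (jet H s) q = evq (d s) q) ->
  yfree e -> partial (crd i) (evq e) q = evq (dx d i e) q.
Proof.
move=> i5 Mq Hd; elim: e => [a b|||s|s||e IHe f IHf|e IHe|e IHe f IHf] /= ye.
- by rewrite evq_zero; exact: partial_cst.
- rewrite partial_coord; case: i i5 {Hd} => [|[|[|[|[|]]]]] //= _;
    by rewrite ?evq_zero ?evq_one.
- rewrite partial_coord; case: i i5 {Hd} => [|[|[|[|[|]]]]] //= _;
    by rewrite ?evq_zero ?evq_one.
- case: ifPn => [/eqP i4|i4].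
    by rewrite i4 evq_zero; exact: partial_r_jetF.
  by apply: (@jet_perm _ _ oM _ (i :: s)) => //; rewrite perm_sym perm_ins.
- case: ifPn => [/eqP i1|i1]; first by rewrite i1; exact: (Hd i1 s ye).
  by apply: (@jet_perm _ _ oM _ (i :: s)) => //; rewrite perm_sym perm_ins.
- have -> : partial (crd i) (evq IP) q =
      - (partial (crd i) (jet (pullr F) [:: 3%N; 3%N]) q *
         ((jet (pullr F) [:: 3%N; 3%N] q)^-1 * (jet (pullr F) [:: 3%N; 3%N] q)^-1)).
    apply: partialV; first exact: Fpp0.
    exact: (smooth_differentiable (smooth_jet [:: 3%N; 3%N] sF) Mq).
  case: ifPn => [/eqP i4|i4].
    by rewrite i4 evq_zero partial_r_jetF // mul0r oppr0.
  rewrite evq_ne !evq_mu; congr (- (_ * _)).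
  apply: (@jet_perm _ _ oM _ [:: i; 3%N; 3%N]) => //.
  by rewrite perm_sym -/(ins i [:: 3%N; 3%N]) perm_ins.
- case/andP: ye => ye yf; rewrite evq_ad -IHe // -IHf //.
  by apply: partialD; exact: dev_.
- by rewrite evq_ne -IHe //; apply: partialN; exact: dev_.
- case/andP: ye => ye yf.
  rewrite evq_ad !evq_mu -IHe // -IHf //.
  by apply: partialM; exact: dev_.
Qed.

(** Recording [yfree] together with the value allows a represented function to be
    differentiated further. *)
Definition rep (f : 'rV[R]_5 -> R) e := yfree e /\ forall q, M q -> f q = evq e q.

Lemma rep_Dwith d f e :
  (forall i g, (i < 5)%N -> i != 1%N -> yfree g -> yfree (d i g) /\
     forall q, M q -> partial (crd i) (evq g) q = evq (d i g) q) ->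
  rep f e -> rep (D H f) (Dwith d e).
Proof.
move=> dP [ye fe].
have [[y0 E0] [y2 E2]] := (dP 0%N e isT isT ye, dP 2%N e isT isT ye).
have [[y3 E3] [y4 E4]] := (dP 3%N e isT isT ye, dP 4%N e isT isT ye).
split; first by rewrite !(yfree_ad, yfree_mu).
move=> q Mq; rewrite /Dwith !evq_ad !evq_mu -E0 // -E2 // -E3 // -E4 // /D !addrA.
have eqp i : partial i f q = partial i (evq e) q.
  exact: (eq_on_partial _ oM Mq fe).
by rewrite !eqp.
Qed.

Lemma d0_correct i g : (i < 5)%N -> i != 1%N -> yfree g -> yfree (d0 i g) /\
  forall q, M q -> partial (crd i) (evq g) q = evq (d0 i g) q.
Proof.
move=> i5 i1 yg; split; first exact: yfree_d0.
by move=> q Mq; apply: dx_correct => // E; rewrite E in i1.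
Qed.

Lemma rep_pullr : rep (pullr F) xF. Proof. by split. Qed.

Lemma rep_DF : rep (D H (pullr F)) xDF.
Proof. exact: (rep_Dwith d0_correct rep_pullr). Qed.

Lemma rep_DDF : rep (D H (D H (pullr F))) xDDF.
Proof. exact: (rep_Dwith d0_correct rep_DF). Qed.

(** The only place where the integrability condition enters. *)
Lemma xHy_correct q : M q -> partial iy H q = evq xHy q.
Proof.
move=> Mq; have [_ E3] := rep_Dwith d0_correct rep_DDF.
have [_ _ _ _ /(_ q Mq)] := hMFH; rewrite E3 // /Delta.
rewrite (rep_DF.2 q Mq) (rep_DDF.2 q Mq) => E.
have -> : xHy = sb (Dwith d0 xDDF) (ad (mu xF (HJ [:: 2%N]))
    (ad (mu xDF (HJ [:: 3%N])) (mu xDDF (HJ [:: 4%N])))) by vm_compute.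
rewrite evq_sb E !evq_ad !evq_mu.
have cancel (h a b c : R) : h = h + a + b + c - (a + (b + c)) by ring.
exact: cancel.
Qed.

Lemma dHy_correct s q : yfree (HJ s) -> M q ->
  partial iy (jet H s) q = evq (dHy s) q.
Proof.
move=> ys Mq; transitivity (jet H (rcons s 1) q).
  by apply: (@jet_perm _ _ oM _ (1%N :: s)) => //; rewrite perm_sym perm_rcons.
rewrite jet_rcons; elim: s ys q Mq => [|i s IH].
  by move=> _ q; exact: xHy_correct.
move=> /= /andP[/andP[i1 i5] ys] q Mq.
rewrite -(proj2 (d0_correct i5 i1 (yfree_dHy ys))) //.
by apply: (eq_on_partial _ oM) => // x Mx; exact: IH.
Qed.

Lemma dd_correct i e q : (i < 5)%N -> M q -> yfree e ->
  partial (crd i) (evq e) q = evq (dd i e) q.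
Proof. by move=> i5 Mq ye; apply: dx_correct => // _ s ys; exact: dHy_correct. Qed.

Lemma rep_D f e : rep f e -> rep (D H f) (xD e).
Proof.
apply: rep_Dwith => i g i5 _ yg; split; first exact: yfree_dd.
by move=> q Mq; exact: dd_correct.
Qed.

End Semantics.

(** * The structure equations on the base *)

Definition nthx (c : seq dexp) (k : nat) := nth zero c k.
Definition xFp := FJ [:: 3%N].
Definition xFz := FJ [:: 2%N].
Definition xP := FJ [:: 3%N; 3%N].

Definition xL e :=
  ad (dd 1 e) (ad (mu xF (dd 2 e)) (ad (mu xDF (dd 3 e))
    (sb (mu xDDF (dd 4 e)) (mu xFp (xD e))))).

(** The frame [d/dz, d/dp, d/dr, D, L], [L = Delta - F_p D]: it is dual to the
    initial coframe with [omega^4] replaced by [omega^4 + F_p omega^5]. *)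
Definition xX (k : nat) : dexp -> dexp :=
  match k with 0 => dd 2 | 1 => dd 3 | 2 => dd 4 | 3 => xD | _ => xL end.

(** The coframe dual to [xX], in the coordinate basis. *)
Definition xS : seq (seq dexp) :=
  [:: [:: ne Xp; ne xF; one; zero; zero];
      [:: ne Xr; ne xDF; zero; one; zero];
      [:: ne (HJ [::]); ne xDDF; zero; zero; one];
      [:: one; xFp; zero; zero; zero];
      [:: zero; one; zero; zero; zero]].

(** Components of the bracket of the vector fields [k < l] of the frame; the
    missing cases are the commuting pairs. That [D] and [Delta] commute makes
    [[D, L] = - (D F_p) D]. *)
Definition xbr (k l : nat) : seq dexp :=
  let tw e i := sb (dd i xDDF) (mu (HJ [:: i]) xFp) in
  match k, l with
  | 0, 3 => [:: zero; zero; HJ [:: 2%N]; zero; zero]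
  | 1, 3 => [:: one; zero; HJ [:: 3%N]; zero; zero]
  | 2, 3 => [:: zero; one; HJ [:: 4%N]; zero; zero]
  | 0, 4 => [:: xFz; xD xFz; tw xDDF 2%N; ne (dd 2 xFp); zero]
  | 1, 4 => [:: zero; ad (xD xFp) xFz; tw xDDF 3%N; ne xP; zero]
  | 2, 4 => [:: zero; zero; tw xDDF 4%N; zero; zero]
  | 3, 4 => [:: zero; zero; zero; ne (xD xFp); zero]
  | _, _ => [::]
  end.

Definition xBr (k l m : nat) :=
  if (k < l)%N then nthx (xbr k l) m else ne (nthx (xbr l k) m).

Definition sum5 (f : nat -> dexp) := sumx [seq f i | i <- [:: 0%N; 1%N; 2%N; 3%N; 4%N]].

(** Values on the frame of the exterior derivative of a one-form [c]. *)
Definition xdc (c : seq dexp) (k l : nat) :=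
  sb (sb (xX k (nthx c l)) (xX l (nthx c k))) (sum5 (fun m => mu (nthx c m) (xBr k l m))).

Definition xwedge (a b : seq dexp) (i j : nat) :=
  sb (mu (nthx a i) (nthx b j)) (mu (nthx b i) (nthx a j)).

(* [xg], [xh], [xa], [xb] are the coefficients of the adapted coframe [xw], written
   like all forms below by components on the coframe [xS]. *)
Definition xg := Eval vm_compute in mu (Qc 1 3) (mu (FJ [:: 3;3;3]%N) IP).
Definition xh := Eval vm_compute in mu (Qc 1 3) (HJ [:: 4%N]).
Definition xa := Eval vm_compute in
  let hr := HJ [:: 4%N] in
  mu (Qc 1 18) (sb (ad (mu (Qc 2 1) (mu hr hr)) (mu (Qc 9 1) (HJ [:: 3%N])))
     (mu (Qc 3 1) (xD hr))).
Definition xb := Eval vm_compute in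
  mu (Qc 1 18) (mu (sb (mu (Qc 3 1) (mu xP (FJ [:: 3;3;3;3]%N)))
     (mu (Qc 5 1) (mu (FJ [:: 3;3;3]%N) (FJ [:: 3;3;3]%N)))) (mu IP IP)).

Definition xw : seq (seq dexp) :=
  [:: [:: ne one; zero; zero; zero; zero];
      [:: zero; one; zero; zero; zero];
      [:: xa; xh; ne one; zero; zero];
      [:: zero; zero; zero; one; zero];
      [:: xb; zero; zero; xg; ne xP]].

Definition xI1 := Eval vm_compute in
  let hr := HJ [:: 4%N] in let hp := HJ [:: 3%N] in
  mu (ne (Qc 1 54)) (sumx [:: mu (Qc 9 1) (xD (xD hr)); ne (mu (Qc 27 1) (xD hp));
   ne (mu (Qc 18 1) (mu hr (xD hr))); mu (Qc 18 1) (mu hp hr);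
   mu (Qc 4 1) (mu hr (mu hr hr)); mu (Qc 54 1) (HJ [:: 2%N])]).
Definition xI2 := Eval vm_compute in
  let f3 := FJ [:: 3;3;3]%N in let f4 := FJ [:: 3;3;3;3]%N in
  let f5 := FJ [:: 3;3;3;3;3]%N in
  mu (Qc 1 54) (mu (sumx [:: mu (Qc 40 1) (mu f3 (mu f3 f3));
     ne (mu (Qc 45 1) (mu xP (mu f3 f4))); mu (Qc 9 1) (mu xP (mu xP f5))])
     (mu IP (mu IP IP))).
Definition xI3 := Eval vm_compute in
  mu (Qc 1 3) (mu (ad (mu (Qc 2 1) (FJ [:: 3;3;3]%N)) (mu xP (HJ [:: 4;4]%N))) IP).

Definition xLg := Eval vm_compute in xL xg.
(** [xJ5], [xJ4], [xJ52] stand for the derivatives of [I3] that occur in the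
    structure equations; of the expressions for the first, the one with the fewest
    derivatives makes the later identities smaller. *)
Definition xJ5 := Eval vm_compute in
  ne (mu (Qc 2 1) (mu IP (sumx [:: xD xP; xLg; mu xg (ad (xD xFp) xFz); dd 2 xFp;
     mu (Qc 2 3) (mu xP (HJ [:: 4%N]))]))).
Definition xJ4 := Eval vm_compute in sb (ad (xD xI3) (mu xI3 xh)) (mu xg xJ5).
Definition xJ52 := Eval vm_compute in
  ad (ad (dd 3 xJ5) (mu xh (dd 4 xJ5))) (mu xg xJ5).
(** The torsion coefficients of [w1 \wedge w3] and [w1 \wedge w5]. *)
Definition xT := Eval vm_compute in mu (Qc 1 8) (ad xJ52 (mu (Qc 2 1) xJ4)).

Definition xmu := Eval vm_compute in mu (ne (Qc 1 2)) (ad xT (dd 4 xa)).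
Definition xnu := Eval vm_compute in
  sumx [:: dd 2 xh; ne (dd 3 xa); ne (mu (Qc 2 1) (sb (mu xa xg) (mu xh xmu)));
     mu xI3 xa; mu xT xh].
Definition xka := Eval vm_compute in
  sumx [:: mu (Qc 2 1) (mu xb xh); mu (Qc 2 1) (mu xg xmu); ne (mu xT xg);
     mu (Qc 1 2) (mu xJ5 xb); ne (dd 2 xg); xD xb].

(** Connection forms on the base. Their components solve the linear system which the
    structure equations impose; the freedom left, adding a multiple of the first
    form to the first connection form, is used to remove its first component. *)
Definition xv : seq (seq dexp) :=
  [:: [:: zero; zero; zero; zero; xFz];
      [:: xmu; xg; zero; ne xh; ne (ad (xD xFp) (mu (Qc 1 2) xFz))];
      [:: xnu; xmu; zero; ne xa; ne (xD xFz)];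
      [:: xka; ne xb; zero; ne xmu; dd 2 xFp]].

Definition wk k := nth [::] xw k.
Definition vk k := nth [::] xv k.
Definition scx e (c : seq dexp) := [seq mu e x | x <- c].
Definition adx (a b : seq dexp) := [seq ad (nthx a i) (nthx b i) | i <- [:: 0%N; 1%N; 2%N; 3%N; 4%N]].

(** Right-hand side of the structure equation of the form [m], evaluated on the
    vectors [i] and [j] of the frame. *)
Definition xrhs (m i j : nat) : dexp :=
  let W a b := xwedge a b i j in
  match m with
  | 0 => ad (ne (W (wk 0) (vk 0))) (W (wk 1) (wk 3))
  | 1 => sumx [:: W (wk 1) (adx (vk 1) (scx (ne (Qc 1 2)) (vk 0)));
                  ne (W (wk 0) (vk 2)); W (wk 2) (wk 3)]
  | 2 => sumx [:: mu (Qc 2 1) (W (wk 2) (vk 1)); ne (W (wk 1) (vk 2));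
                  mu xI1 (W (wk 0) (wk 3)); mu xI3 (W (wk 1) (wk 2));
                  mu xT (W (wk 0) (wk 2))]
  | 3 => sumx [:: ne (W (wk 1) (wk 4));
                  ne (W (wk 3) (adx (scx (Qc 1 2) (vk 0)) (vk 1)));
                  ne (W (wk 0) (vk 3))]
  | _ => sumx [:: ne (mu (Qc 2 1) (W (wk 4) (vk 1))); W (wk 3) (vk 3);
                  mu xI2 (W (wk 0) (wk 1));
                  ne (mu (mu (Qc 1 2) xJ5) (W (wk 3) (wk 4)));
                  mu xT (W (wk 0) (wk 4))]
  end.

(* The expression is first computed to its normal form, so that [field] only sees
   the jets as atoms. *)
Ltac ev_field :=
  lazymatch goal with |- ev _ _ _ _ ?e = _ =>
    let e' := eval vm_compute in e in
    replace e with e' by (vm_compute; reflexivity)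
  end; cbn [ev]; by field.

Section Identities.
Context {R : realFieldType}.
Variables (jF jH : seq nat -> R) (p r : R).
Hypothesis P0 : jF [:: 3%N; 3%N] != 0.
Local Notation E := (ev jF jH p r).

(** The bracket table [xBr] is right: exterior derivatives of the coframe [xS] taken
    in coordinates agree with those given by the brackets. *)
Lemma sigma_structure m i j : (m < 5)%N -> (i < 5)%N -> (j < 5)%N ->
  E (ad (sb (dd i (nthx (nth [::] xS m) j)) (dd j (nthx (nth [::] xS m) i)))
     (sum5 (fun k => sum5 (fun l => mu (nthx (nth [::] xS k) i)
        (mu (xBr k l m) (nthx (nth [::] xS l) j)))))) = 0.
Proof.
case: m => [|[|[|[|[|//]]]]] _; (case: i => [|[|[|[|[|//]]]]] _);
  (case: j => [|[|[|[|[|//]]]]] _).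
all: ev_field.
Qed.

Lemma ev_sum5 f : E (sum5 f) = \sum_(k < 5) E (f k).
Proof. by rewrite /sum5 ev_sumx !big_ord_recl big_ord0 !big_cons big_nil. Qed.

Lemma big_nat5 (G : nat -> R) : \sum_(k < 5) G k = G 0%N + (G 1%N + (G 2%N + (G 3%N + G 4%N))).
Proof. by rewrite !big_ord_recl big_ord0 addr0. Qed.

Lemma frame_dual e j : (j < 5)%N ->
  \sum_(k < 5) E (xX k e) * E (nthx (nth [::] xS k) j) = E (dd j e).
Proof.
rewrite (big_nat5 (fun k => E (xX k e) * E (nthx (nth [::] xS k) j))) => j5.
rewrite /xX /xL /xD /Dwith !(ev_ad, ev_mu, ev_sb).
case: j j5 => [|[|[|[|[|//]]]]] _;
  move: (E (dd 0 e)) (E (dd 1 e)) (E (dd 2 e)) (E (dd 3 e)) (E (dd 4 e)) => *;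
  cbn -[xDF xDDF ne]; rewrite ?ev_ne; cbn -[xDF xDDF]; by field.
Qed.

Lemma xBr_anti i j m : E (xBr i j m) = - E (xBr j i m).
Proof.
rewrite /xBr; case: ltngtP => [_|_|->]; rewrite ?ev_ne ?opprK //.
have -> : xbr j j = [::] by case: j => [|[|[|[|[|]]]]].
by rewrite /nthx nth_nil ev_zero oppr0.
Qed.

Lemma xdc_anti c i j : E (xdc c i j) = - E (xdc c j i).
Proof.
rewrite /xdc !ev_sb !ev_sum5.
have -> : \sum_(k < 5) E (mu (nthx c k) (xBr i j k)) =
    - \sum_(k < 5) E (mu (nthx c k) (xBr j i k)).
  by rewrite -sumrN; apply: eq_bigr => k _; rewrite !ev_mu xBr_anti mulrN.
by ring.
Qed.

Lemma xrhs_anti m i j : E (xrhs m i j) = - E (xrhs m j i).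
Proof.
case: m => [|[|[|[|m]]]]; cbv beta zeta iota delta [xrhs sumx foldr];
  rewrite !(ev_ad, ev_ne, ev_mu, ev_zero); ring.
Qed.

(** The heart of the computation: fifty rational identities between jets. *)
Lemma hat_structure_lt m i j : (m < 5)%N -> (j < 5)%N -> (i < j)%N ->
  E (sb (xdc (wk m) i j) (xrhs m i j)) = 0.
Proof.
case: m => [|[|[|[|[|//]]]]] _; (case: j => [|[|[|[|[|//]]]]] _);
  (case: i => [|[|[|[|[|//]]]]] //) => _.
all: ev_field.
Qed.

Lemma hat_structure m i j : (m < 5)%N -> (i < 5)%N -> (j < 5)%N ->
  E (xdc (wk m) i j) = E (xrhs m i j).
Proof.
move=> m5 i5 j5; case: (ltngtP i j) => [ij|ij|->].
- by apply/eqP; rewrite -subr_eq0 -ev_sb; apply/eqP; exact: hat_structure_lt.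
- rewrite xdc_anti xrhs_anti; congr (- _).
  by apply/eqP; rewrite -subr_eq0 -ev_sb; apply/eqP; exact: hat_structure_lt.
- have z (x : R) : x = - x -> x = 0 by lra.
  by rewrite (z _ (xdc_anti _ _ _)) (z _ (xrhs_anti _ _ _)).
Qed.

(** This identifies [xJ5] with [I3_5]: the vector dual to the fifth adapted form is
    [- L / F_pp], and [D F_p + F_z] comes from the connection forms. *)
Lemma J5_structure :
  E (ad (xL xI3) (ad (mu xI3 (ad (xD xFp) xFz)) (mu xP xJ5))) = 0.
Proof. by ev_field. Qed.

End Identities.

Section FrameForms.
Context {R : realType} {M : set 'rV[R]_5} {F : 'rV[R]_4 -> R} {H : 'rV[R]_5 -> R}.
Hypothesis hMFH : integrable_system M F H.
Let oM : open M. Proof. by case: hMFH. Qed.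
Let jFpp0 q : M q -> jet (pullr F) [:: 3%N; 3%N] q != 0.
Proof. by case: hMFH => _ _ _ h _ /h. Qed.
Local Notation E := (@evq R F H).

Lemma evq_sum5 f q : E (sum5 f) q = \sum_(k < 5) E (f k) q.
Proof. exact: ev_sum5. Qed.

Definition coframe (q : 'rV[R]_5) : 'M[R]_5 :=
  \matrix_(k, j) E (nthx (nth [::] xS k) j) q.
Definition comps (c : seq dexp) (q : 'rV[R]_5) : 'rV[R]_5 := \row_k E (nthx c k) q.
Definition frame_form (c : seq dexp) (q : 'rV[R]_5) : 'rV[R]_5 := comps c q *m coframe q.

Lemma smooth_coframe : smooth M coframe.
Proof.
apply/(smooth_mx oM) => k j; apply: (eq_on_smooth oM) (smooth_ev hMFH _) => x _.
by rewrite mxE.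
Qed.

Lemma smooth_form c : smooth M (frame_form c).
Proof.
apply: (smooth_mulmx oM) smooth_coframe; apply/(smooth_mx oM) => k j.
by apply: (eq_on_smooth oM) (smooth_ev hMFH (nthx c j)) => x _; rewrite mxE.
Qed.

Lemma dfun_frame e q : M q -> yfree e ->
  dfun (E e) q = (\row_k E (xX k e) q) *m coframe q.
Proof.
move=> Mq ye; apply/rowP => j; rewrite !mxE -{1}[j]crdE (dd_correct hMFH (ltn_ord j) Mq ye).
apply: etrans (esym (frame_dual (fun s => jet (pullr F) s q) (fun s => jet H s q)
  (q 0 ip) (q 0 ir) e (ltn_ord j))) _.
by apply: eq_bigr => k _; rewrite !mxE.
Qed.

Lemma dform_coframe m q : M q ->
  dform (fun x => row m (coframe x)) q =
  (coframe q)^T *m (\matrix_(k, l) - E (xBr k l m) q) *m coframe q.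
Proof.
move=> Mq; apply/matrixP => i j; rewrite dformE.
have pE a b : partial a (fun x => row m (coframe x) 0 b) q =
    E (dd a (nthx (nth [::] xS m) b)) q.
  rewrite -(dd_correct hMFH (ltn_ord a) Mq); last first.
    case: m => -[|[|[|[|[|//]]]]] ?; case: b => -[|[|[|[|[|//]]]]] ?; by vm_compute.
  rewrite crdE; apply: (congr1 (fun f => partial a f q)); apply/funext => x.
  by rewrite !mxE.
rewrite !pE.
have := sigma_structure (fun s => jet (pullr F) s q) (fun s => jet H s q)
  (q 0 ip) (q 0 ir)
  (ltn_ord m) (ltn_ord i) (ltn_ord j).
rewrite -/(evq _ _) evq_ad evq_sb => /eqP; rewrite addr_eq0 => /eqP ->.
rewrite evq_sum5 -sumrN mxE.
under [RHS]eq_bigr => l _ do rewrite mxE mulr_suml.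
rewrite exchange_big /=; apply: eq_bigr => k _.
rewrite evq_sum5 -sumrN; apply: eq_bigr => l _.
by rewrite !mxE !evq_mu mulrN mulNr mulrA.
Qed.

(** Cartan's formula for the exterior derivative in the frame dual to [coframe]. *)
Lemma dform_form c q : M q -> all yfree c ->
  dform (frame_form c) q =
  (coframe q)^T *m (\matrix_(k, l) E (xdc c k l) q) *m coframe q.
Proof.
move=> Mq yc; pose A (x : 'rV[R]_5) : 'M[R]_(1, 5) := \row_k E (nthx c k) x.
have yk k : yfree (nthx c k).
  have [kc|kc] := ltnP k (size c); first exact: (elimT (all_nthP zero) yc k kc).
  by rewrite /nthx nth_default.
have -> : frame_form c = fun x => row 0 (A x *m coframe x).
  by apply/funext => x; rewrite row_id.
rewrite dform_mulmx; first last.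
- exact: smooth_differentiable smooth_coframe Mq.
- have sA : smooth M A.
    apply/(smooth_mx oM) => k j.
    by apply: (eq_on_smooth oM) (smooth_ev hMFH (nthx c j)) => x _; rewrite mxE.
  exact: smooth_differentiable sA Mq.
have kE k : dfun (fun x => A x 0 k) q \wedge row k (coframe q) +
    A q 0 k *: dform (fun x => row k (coframe x)) q =
    (coframe q)^T *m ((\row_l E (xX l (nthx c k)) q) \wedge delta_mx 0 k
      + E (nthx c k) q *: \matrix_(i, j) - E (xBr i j k) q) *m coframe q.
  have -> : (fun x => A x 0 k) = E (nthx c k) by apply/funext => x; rewrite mxE.
  have -> : A q 0 k = E (nthx c k) q by rewrite mxE.
  rewrite (dfun_frame Mq (yk k)) (dform_coframe k Mq) rowE -mulmx_wedge.
  by rewrite scalemxAl scalemxAr -mulmxDl -mulmxDr.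
rewrite (eq_bigr _ (fun k _ => kE k)) -mulmx_suml -mulmx_sumr.
congr (_ *m _ *m _); apply/matrixP => i j; rewrite summxE [RHS]mxE /xdc !evq_sb.
under eq_bigr => k _ do rewrite mxE wedgeE !mxE !eqxx /= mulrN.
rewrite evq_sum5 !big_split /= sumrN.
under [X in _ = _ - X]eq_bigr => k _ do rewrite evq_mu.
rewrite sumrN.
congr (_ + - _ - _).
  rewrite (bigD1 j) //= eqxx mulr1 big1 ?addr0 // => k /negPf kj.
  by rewrite eq_sym kj mulr0.
rewrite (bigD1 i) //= eqxx mul1r big1 ?addr0 // => k /negPf kj.
by rewrite eq_sym kj mul0r.
Qed.

Lemma base_structure q : M q ->
  structure_eqs (frame_form (wk 0) q) (frame_form (wk 1) q) (frame_form (wk 2) q) (frame_form (wk 3) q)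
    (frame_form (wk 4) q)
    (dform (frame_form (wk 0)) q) (dform (frame_form (wk 1)) q) (dform (frame_form (wk 2)) q)
    (dform (frame_form (wk 3)) q) (dform (frame_form (wk 4)) q)
    (frame_form (vk 0) q) (frame_form (vk 1) q) (frame_form (vk 2) q) (frame_form (vk 3) q)
    (E xI1 q) (E xI2 q) (E xI3 q) (2^-1 * E xJ5 q) (E xT q).
Proof.
move=> Mq.
have key m : (m < 5)%N -> dform (frame_form (wk m)) q =
    (coframe q)^T *m (\matrix_(k, l) E (xrhs m k l) q) *m coframe q.
  move=> m5; rewrite dform_form //; last by case: m m5 => [|[|[|[|[|//]]]]] _; vm_compute.
  congr (_ *m _ *m _); apply/matrixP => i j; rewrite !mxE.
  exact: (@hat_structure _ (fun s => jet (pullr F) s q) (fun s => jet H s q)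
    (q 0 ip) (q 0 ir) (jFpp0 Mq) m i j m5 (ltn_ord i) (ltn_ord j)).
have cw a b i j : (comps a q \wedge comps b q) i j = E (xwedge a b i j) q.
  by rewrite wedgeE !mxE /xwedge evq_sb !evq_mu.
have nadx a b (i : 'I_5) : E (nthx (adx a b) i) q = E (nthx a i) q + E (nthx b i) q.
  rewrite -evq_ad; congr (evq _ _).
  by case: i => -[|[|[|[|[|//]]]]].
have nscx e c (i : 'I_5) : E (nthx (scx e c) i) q = E e q * E (nthx c i) q.
  rewrite /nthx /scx; have [ic|ic] := ltnP i (size c).
    by rewrite (nth_map zero) // evq_mu.
  by rewrite !nth_default ?size_map // evq_zero mulr0.
have halfE : E (Qc 1 2) q = 2^-1 by rewrite /evq /= div1r.
have nhalfE : E (ne (Qc 1 2)) q = - 2^-1 by rewrite evq_ne halfE.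
have twoE : E (Qc 2 1) q = 2 by rewrite /evq /= divr1.
have sS a (W : 'M[R]_5) : a *: ((coframe q)^T *m W *m coframe q) =
    (coframe q)^T *m (a *: W) *m coframe q by rewrite -scalemxAr -scalemxAl.
have nS (W : 'M[R]_5) : - ((coframe q)^T *m W *m coframe q) =
    (coframe q)^T *m (- W) *m coframe q by rewrite mulmxN mulNmx.
have aS (V W : 'M[R]_5) : (coframe q)^T *m V *m coframe q + (coframe q)^T *m W *m coframe q
    = (coframe q)^T *m (V + W) *m coframe q by rewrite mulmxDr mulmxDl.
rewrite /structure_eqs !key // /frame_form !scalemxAl -mulmxBl -mulmxDl -!mulmx_wedge.
rewrite !(sS, nS, aS).
split; congr (_ *m _ *m _); apply/matrixP => i j.
all: rewrite [LHS]mxE; cbv beta zeta iota delta [xrhs sumx foldr].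
all: rewrite !(evq_ad, evq_ne, evq_mu, evq_zero) ?nadx ?nscx ?halfE ?nhalfE ?twoE.
all: rewrite !(mxE, big_ord1); ring.
Qed.

End FrameForms.

Definition xDHr := Eval vm_compute in xD (HJ [:: 4%N]).
Definition xDDHr := Eval vm_compute in xD xDHr.
Definition xDHp := Eval vm_compute in xD (HJ [:: 3%N]).

Section Coefficients.
Context {R : realFieldType}.
Variables (jF jH : seq nat -> R) (p r : R).
Hypothesis P0 : jF [:: 3%N; 3%N] != 0.
Local Notation E := (ev jF jH p r).
Local Notation P := (jF [:: 3%N; 3%N]).
Local Notation P3 := (jF [:: 3%N; 3%N; 3%N]).
Local Notation P4 := (jF [:: 3%N; 3%N; 3%N; 3%N]).
Local Notation P5 := (jF [:: 3%N; 3%N; 3%N; 3%N; 3%N]).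

Lemma ev_I1 : E xI1 = - 54^-1 * (9 * E xDDHr - 27 * E xDHp
  - 18 * jH [:: 4%N] * E xDHr + 18 * jH [:: 3%N] * jH [:: 4%N]
  + 4 * jH [:: 4%N] ^+ 3 + 54 * jH [:: 2%N]).
Proof. by cbn [ev xI1 xDHr xDDHr xDHp]; field. Qed.

Lemma ev_I2 : E xI2 =
  (40 * P3 ^+ 3 - 45 * P * P3 * P4 + 9 * P ^+ 2 * P5) / (54 * P ^+ 3).
Proof. by cbn [ev xI2]; field. Qed.

Lemma ev_I3 : E xI3 = (2 * P3 + P * jH [:: 4%N; 4%N]) / (3 * P).
Proof. by cbn [ev xI3]; field. Qed.

Lemma ev_a : E xa = (2 * jH [:: 4%N] ^+ 2 + 9 * jH [:: 3%N] - 3 * E xDHr) / 18.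
Proof. by cbn [ev xa xDHr]; field. Qed.

Lemma ev_b : E xb = (3 * P * P4 - 5 * P3 ^+ 2) / (18 * P ^+ 2).
Proof. by cbn [ev xb xP]; field. Qed.

Lemma ev_h : E xh = jH [:: 4%N] / 3.
Proof. by cbn [ev xh]; field. Qed.

Lemma ev_g : E xg = P3 / (3 * P).
Proof. by cbn [ev xg]; field. Qed.

Lemma ev_gP (f : R) : - P = (P3 * f - 3 * P ^+ 2) / (3 * P) - P3 / (3 * P) * f.
Proof. by field. Qed.

(** Inverses of the matrices [xS] and [xw]. *)
Definition xframe : seq (seq dexp) :=
  [:: [:: zero; zero; zero; one; ne xFp];
      [:: zero; zero; zero; zero; one];
      [:: one; zero; zero; Xp; sb xF (mu Xp xFp)];
      [:: zero; one; zero; Xr; sb xDF (mu Xr xFp)];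
      [:: zero; zero; one; HJ [::]; sb xDDF (mu (HJ [::]) xFp)]].

Definition xdual : seq (seq dexp) :=
  [:: [:: ne one; zero; zero; zero; zero];
      [:: zero; one; zero; zero; zero];
      [:: ne xa; xh; ne one; zero; zero];
      [:: zero; zero; zero; one; zero];
      [:: ne (mu xb IP); zero; zero; mu xg IP; ne IP]].

Lemma coframe_frame i j : (i < 5)%N -> (j < 5)%N ->
  E (sum5 (fun l => mu (nthx (nth [::] xS i) l) (nthx (nth [::] xframe l) j)))
  = (i == j)%:R.
Proof.
by case: i => [|[|[|[|[|//]]]]] _; case: j => [|[|[|[|[|//]]]]] _; rewrite [RHS]/=; ev_field.
Qed.

Lemma hat_dual i j : (i < 5)%N -> (j < 5)%N ->
  E (sum5 (fun l => mu (nthx (nth [::] xw i) l) (nthx (nth [::] xdual l) j)))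
  = (i == j)%:R.
Proof.
by case: i => [|[|[|[|[|//]]]]] _; case: j => [|[|[|[|[|//]]]]] _; rewrite [RHS]/=; ev_field.
Qed.

End Coefficients.

Section AdaptedCoframe.
Context {R : realType} {M : set 'rV[R]_5} {F : 'rV[R]_4 -> R} {H : 'rV[R]_5 -> R}.
Hypothesis hMFH : integrable_system M F H.
Let oM : open M. Proof. by case: hMFH. Qed.
Let Fpp0 q : M q -> jet (pullr F) [:: 3%N; 3%N] q != 0.
Proof. by case: hMFH => _ _ _ h _ /h. Qed.
Local Notation E := (@evq R F H).
Local Notation form := (@frame_form R F H).
Local Notation coframe := (@coframe R F H).

Let rep_Hr : @rep R M F H (Hr H) (HJ [:: 4%N]). Proof. by split. Qed.
Let rep_Hp : @rep R M F H (Hp H) (HJ [:: 3%N]). Proof. by split. Qed.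

Lemma DHr_eq q : M q -> D H (Hr H) q = E xDHr q.
Proof. exact: (rep_D hMFH rep_Hr).2. Qed.

Lemma DDHr_eq q : M q -> D H (D H (Hr H)) q = E xDDHr q.
Proof. exact: (rep_D hMFH (rep_D hMFH rep_Hr)).2. Qed.

Lemma DHp_eq q : M q -> D H (Hp H) q = E xDHp q.
Proof. exact: (rep_D hMFH rep_Hp).2. Qed.

Lemma I1_eq q : M q -> I1 F H q = E xI1 q.
Proof.
move=> Mq; rewrite /I1 DDHr_eq // DHp_eq // DHr_eq //.
exact/esym/ev_I1.
Qed.

Lemma I2_eq q : M q -> I2 F H q = E xI2 q.
Proof. by move=> Mq; exact/esym/ev_I2/Fpp0. Qed.

Lemma I3_eq q : M q -> I3 F H q = E xI3 q.
Proof. by move=> Mq; exact/esym/ev_I3/Fpp0. Qed.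

Lemma row_mx_of_rows m n (s : seq 'rV[R]_n) (k : 'I_m) :
  row k (mx_of_rows m s) = s`_k.
Proof. by apply/rowP => j; rewrite !mxE. Qed.

Lemma form_sum c q :
  form c q = \sum_(k < 5) E (nthx c k) q *: row k (coframe q).
Proof.
rewrite /frame_form mulmx_sum_row; apply: eq_bigr => k _.
by rewrite mxE.
Qed.

Lemma coframe_rows q : M q ->
  [/\ row ix (omega F H q) = row ix (coframe q),
      row iy (omega F H q) = row iy (coframe q),
      row iz (omega F H q) = row iz (coframe q),
      row ip (omega F H q) = row ip (coframe q) - Fp F q *: row ir (coframe q)
    & row ir (omega F H q) = row ir (coframe q)].
Proof.
move=> Mq; have [_ EDF] := rep_DF hMFH; have [_ EDDF] := rep_DDF hMFH.
split; rewrite row_mx_of_rows /=; apply/rowP => j; rewrite !mxE ?EDF ?EDDF //;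
case: j => -[|[|[|[|[|//]]]]] jlt; rewrite /nthx /=.
all: rewrite ?divr1 ?(mul0r, mulr0, mulr1, subr0, sub0r, subrr, oppr0) //.
Qed.

Lemma hat_entries q : M q ->
  [/\ E xa q = (2 * Hr H q ^+ 2 + 9 * Hp H q - 3 * D H (Hr H) q) / 18,
      E xh q = Hr H q / 3,
      E xg q = Fppp F q / (3 * Fpp F q),
      E xb q = (3 * Fpp F q * Fpppp F q - 5 * Fppp F q ^+ 2) / (18 * Fpp F q ^+ 2)
    & - E xP q = (Fppp F q * Fp F q - 3 * Fpp F q ^+ 2) / (3 * Fpp F q)
        - Fppp F q / (3 * Fpp F q) * Fp F q].
Proof.
move=> Mq; have P0 := Fpp0 Mq; split.
- by rewrite DHr_eq //; exact: ev_a.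
- exact: ev_h.
- exact: ev_g.
- exact: ev_b.
- exact: (@ev_gP _ (fun s => jet (pullr F) s q) P0 (Fp F q)).
Qed.

Lemma omega_hat_form q (k : 'I_5) : M q -> row k (omega_hat F H q) = form (wk k) q.
Proof.
move=> Mq; have [w1 w2 w3 w4 w5] := coframe_rows Mq.
have P0 := Fpp0 Mq.
have form5 c : form c q = E (nthx c 0) q *: row ix (coframe q) +
    (E (nthx c 1) q *: row iy (coframe q) + (E (nthx c 2) q *: row iz (coframe q) +
    (E (nthx c 3) q *: row ip (coframe q) + E (nthx c 4) q *: row ir (coframe q)))).
  rewrite form_sum !big_ord_recl big_ord0 addr0.
  by do ![congr (_ + _)]; congr (_ *: row _ _); apply: val_inj.
have [aE hE gE bE PE] := hat_entries Mq.
have z : E zero q = 0 by exact: evq_zero.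
have o : E one q = 1 by exact: evq_one.
rewrite form5; case: k => -[|[|[|[|[|//]]]]] klt; rewrite row_mx_of_rows /nthx /wk;
  cbn [nth xw nat_of_ord]; rewrite ?evq_ne ?z ?o ?w1 ?w2 ?w3 ?w4 ?w5;
  rewrite ?scale0r ?addr0 ?add0r ?scaleN1r ?scale1r //.
- by rewrite aE hE -addrA.
- by rewrite subrK.
- rewrite bE gE PE scalerBr scalerBl scalerA -!addrA.
  by congr (_ + (_ + _)); rewrite addrC.
Qed.

Lemma smooth_omega_hat : smooth M (omega_hat F H).
Proof.
apply/(smooth_mx oM) => k j.
have /(smooth_mx oM)/(_ 0 j) := smooth_form hMFH (wk k).
by apply: (eq_on_smooth oM) => x Mx; rewrite -omega_hat_form // mxE.
Qed.

Lemma omega_hat_unit q : M q -> omega_hat F H q \in unitmx.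
Proof.
move=> Mq; have P0 := Fpp0 Mq.
pose A : 'M[R]_5 := \matrix_(k, j) E (nthx (nth [::] xw k) j) q.
have -> : omega_hat F H q = A *m coframe q.
  apply/row_matrixP => k; rewrite omega_hat_form // row_mul; congr (_ *m _).
  by apply/rowP => j; rewrite !mxE.
rewrite unitmx_mul; apply/andP; split.
  have /mulmx1_unit[] // : A *m (\matrix_(k, j) E (nthx (nth [::] xdual k) j) q) = 1%:M.
  apply/matrixP => i j; rewrite !mxE.
  transitivity (E (sum5 (fun l => mu (nthx (nth [::] xw i) l) (nthx (nth [::] xdual l) j))) q);
    last by apply: hat_dual => //.
  rewrite evq_sum5; apply: eq_bigr => k _; rewrite !mxE; by rewrite evq_mu.
have /mulmx1_unit[] // : coframe q *m (\matrix_(k, j) E (nthx (nth [::] xframe k) j) q) = 1%:M.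
apply/matrixP => i j; rewrite !mxE.
transitivity (E (sum5 (fun l => mu (nthx (nth [::] xS i) l) (nthx (nth [::] xframe l) j))) q);
  last by apply: coframe_frame => //.
rewrite evq_sum5; apply: eq_bigr => k _; rewrite !mxE; by rewrite evq_mu.
Qed.

Lemma dform_omega_hat q (k : 'I_5) : M q ->
  dform (fun x => row k (omega_hat F H x)) q = dform (form (wk k)) q.
Proof. by move=> Mq; apply: (eq_on_dform oM Mq) => x; exact: omega_hat_form. Qed.

Lemma omega_hat_structure q : M q ->
  let w i := row i (omega_hat F H q) in
  let dw i := dform (fun x => row i (omega_hat F H x)) q in
  structure_eqs (w 0) (w 1) (w 2) (w 3) (w 4) (dw 0) (dw 1) (dw 2) (dw 3) (dw 4)
    (form (vk 0) q) (form (vk 1) q) (form (vk 2) q) (form (vk 3) q)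
    (I1 F H q) (I2 F H q) (I3 F H q) (2^-1 * E xJ5 q) (E xT q).
Proof.
move=> Mq w dw; rewrite /w /dw !dform_omega_hat // !omega_hat_form //.
rewrite I1_eq // I2_eq // I3_eq //.
exact: (base_structure hMFH Mq).
Qed.

End AdaptedCoframe.

(** * The derivatives of the third invariant *)

Section BasisComponents.
Context {R : realType}.
Local Notation e i := (delta_mx 0 i : 'rV[R]_5).

Lemma wedge_delta i (a : 'rV[R]_5) j k :
  (e i \wedge a) j k = (j == i)%:R * a 0 k - a 0 j * (k == i)%:R.
Proof. by rewrite wedgeE !mxE eqxx. Qed.

Lemma row_unit_invmx (W : 'M[R]_5) i : W \in unitmx -> row i W *m invmx W = e i.
Proof. by move=> Wu; rewrite -row_mul mulmxV // row1. Qed.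

(** The difference of two pairs of connection forms, in the basis of the coframe: each
    equation kills the components that the preceding ones leave. *)
Lemma connection_unique_standard (d1 d2 : 'rV[R]_5) :
  e 0 \wedge d1 = 0 ->
  (exists c, e 1 \wedge (d2 - 2^-1 *: d1) = e 0 \wedge c) ->
  (exists c, e 3 \wedge (2^-1 *: d1 + d2) = e 0 \wedge c) ->
  d1 = d1 0 0 *: e 0 /\ d2 = d2 0 0 *: e 0.
Proof.
move=> /matrixP E1 [c /matrixP E2] [c' /matrixP E4].
have d1E j : j != 0 -> d1 0 j = 0.
  move=> /negPf j0; have := E1 0 j; rewrite wedge_delta eqxx j0 mxE.
  by rewrite mul1r mulr0 subr0.
have d2E j : j != 0 -> d2 0 j = 0.
  move=> j0; have [->|j1] := eqVneq j 1.
    have := E4 3 1; rewrite !wedge_delta !mxE /= d1E //.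
    by rewrite !mulr0 !mul0r mul1r !subr0 add0r.
  have := E2 1 j; rewrite !wedge_delta !mxE /= d1E // (negPf j0) (negPf j1).
  by rewrite !mulr0 !mul0r mul1r !subr0.
by split; apply/rowP => j; rewrite !mxE /=; (have [->|j0] := eqVneq j 0);
  rewrite ?mulr1 // mulr0 ?d1E ?d2E.
Qed.

Lemma coefficients_unique (W : 'M[R]_5) (l y2 y3 y4 y5 : R) :
  W \in unitmx ->
  l *: row 0 W + y2 *: row 1 W + y3 *: row 2 W + y4 *: row 3 W + y5 *: row 4 W = 0 ->
  [/\ y2 = 0, y3 = 0, y4 = 0 & y5 = 0].
Proof.
move=> Wu /(congr1 (fun a => a *m invmx W)).
rewrite !mulmxDl -!scalemxAl !row_unit_invmx // mul0mx => /rowP E.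
have := (E 1, E 2, E 3, E 4); rewrite !mxE /=.
by rewrite !(mulr0, mulr1, addr0, add0r) => -[[[]]].
Qed.

End BasisComponents.

Section Derivatives.
Context {R : realType} {M : set 'rV[R]_5} {F : 'rV[R]_4 -> R} {H : 'rV[R]_5 -> R}.
Hypothesis hMFH : integrable_system M F H.
Let oM : open M. Proof. by case: hMFH. Qed.
Let Fpp0 q : M q -> jet (pullr F) [:: 3%N; 3%N] q != 0.
Proof. by case: hMFH => _ _ _ h _ /h. Qed.
Local Notation E := (@evq R F H).
Local Notation form := (@frame_form R F H).
Local Notation coframe := (@coframe R F H).

Lemma varpi_exists : varpi_spec M F H (form (vk 0)) (form (vk 1)).
Proof.
split; [exact: smooth_form|exact: smooth_form|] => q Mq w dw v1 v2.
have [E1 E2 _ E4 _] := omega_hat_structure hMFH Mq.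
split; first exact: E1.
  exists (- form (vk 2) q); rewrite [dw 1]E2.
  by rewrite [X in X - _]addrAC [LHS]addrAC subrr add0r wedgeN.
exists (- form (vk 3) q); rewrite [dw 3]E4.
by rewrite [LHS]addrAC subrr add0r wedgeN.
Qed.

Lemma varpi_unique a1 a2 b1 b2 q :
  varpi_spec M F H a1 a2 -> varpi_spec M F H b1 b2 -> M q ->
  exists l m, b1 q = a1 q + l *: row 0 (omega_hat F H q) /\
              b2 q = a2 q + m *: row 0 (omega_hat F H q).
Proof.
move=> [_ _ /(_ q)] As [_ _ /(_ q)] Bs Mq.
have [A1 [cA2 A2] [cA4 A4]] := As Mq; have [B1 [cB2 B2] [cB4 B4]] := Bs Mq.
have Wu := omega_hat_unit hMFH Mq; move: Wu A1 A2 A4 B1 B2 B4.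
move: (dform _ q) (dform _ q) (dform _ q) => dw1 dw2 dw4.
move: (omega_hat F H q) (a1 q) (a2 q) (b1 q) (b2 q) => W x1 x2 y1 y2 Wu.
move=> A1 A2 A4 B1 B2 B4; pose P := invmx W.
pose d1 := (y1 - x1) *m P; pose d2 := (y2 - x2) *m P.
have conj (X Y : 'M[R]_5) : X = Y -> P^T *m X *m P = P^T *m Y *m P by move->.
have [d1E d2E] : d1 = d1 0 0 *: delta_mx 0 0 /\ d2 = d2 0 0 *: delta_mx 0 0.
  apply: connection_unique_standard.
  - have : row 0 W \wedge (y1 - x1) = 0.
      have := A1; rewrite B1 => /addIr /oppr_inj E.
      by rewrite wedgeDr wedgeN E subrr.
    by move=> /conj; rewrite mulmx_wedge mulmx0 mul0mx row_unit_invmx.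
  - exists ((cA2 - cB2) *m P).
    have : row 1 W \wedge (y2 - x2 - 2^-1 *: (y1 - x1)) = row 0 W \wedge (cA2 - cB2).
      rewrite [RHS]wedgeDr [in RHS]wedgeN -A2 -B2; apply/matrixP => i j; rewrite !(mxE, big_ord1); ring.
    by move=> /conj; rewrite !mulmx_wedge !row_unit_invmx // mulmxBl -scalemxAl.
  - exists ((cB4 - cA4) *m P).
    have : row 3 W \wedge (2^-1 *: (y1 - x1) + (y2 - x2)) = row 0 W \wedge (cB4 - cA4).
      rewrite [RHS]wedgeDr [in RHS]wedgeN -A4 -B4; apply/matrixP => i j; rewrite !(mxE, big_ord1); ring.
    by move=> /conj; rewrite !mulmx_wedge !row_unit_invmx // mulmxDl -scalemxAl.
exists (d1 0 0), (d2 0 0); have back (x y : 'rV[R]_5) (c : R) : (y - x) *m P = c *: delta_mx 0 0 -> y = x + c *: row 0 W.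
  by move=> Ec; rewrite -[LHS](subrK x) -(mulmxKV Wu (y - x)) Ec -scalemxAl -rowE addrC.
by split; apply: back.
Qed.

(** Comparison of components along d/dp, d/dr, [D] and [L], the component along d/dz
    being free modulo the first form. *)
Lemma eqmod1_form q (x : 'rV[R]_5) (c2 c3 c4 c5 s t : R) :
  x 0 1 = c2 + c3 * E xh q + t * E xg q ->
  x 0 2 = - c3 ->
  x 0 3 = c4 + c5 * E xg q - t * E xh q ->
  x 0 4 = - c5 * E xP q + s * E xFz q - t * (E (xD xFp) q + 2^-1 * E xFz q) ->
  eqmod1 (form (wk 0) q) (x *m coframe q)
    (c2 *: form (wk 1) q + c3 *: form (wk 2) q + c4 *: form (wk 3) q
     + c5 *: form (wk 4) q + s *: form (vk 0) q + t *: form (vk 1) q).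
Proof.
move=> x1 x2 x3 x4; rewrite /eqmod1 /frame_form !scalemxAl -!mulmxDl -mulmxBl.
exists (c3 * E xa q + c5 * E xb q + t * E xmu q - x 0 0).
rewrite scalemxAl; congr (_ *m _).
have z : E zero q = 0 by exact: evq_zero.
have o : E one q = 1 by exact: evq_one.
have half : E (Qc 1 2) q = 2^-1 by rewrite /evq /= div1r.
apply/rowP => -[[|[|[|[|[|//]]]]] jlt]; rewrite !mxE; cbn [nthx nth wk vk xw xv nat_of_ord].
- rewrite (_ : Ordinal jlt = 0) ?(evq_ne, z, o); last exact: val_inj.
  by ring.
- rewrite (_ : Ordinal jlt = 1) ?x1 ?(evq_ne, z, o); last exact: val_inj.
  by ring.
- rewrite (_ : Ordinal jlt = 2) ?x2 ?(evq_ne, z, o); last exact: val_inj.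
  by ring.
- rewrite (_ : Ordinal jlt = 3) ?x3 ?(evq_ne, z, o); last exact: val_inj.
  by ring.
- rewrite (_ : Ordinal jlt = 4) ?x4; last exact: val_inj.
  rewrite (_ : E (ne (ad _ _)) q = - (E (xD xFp) q + 2^-1 * E xFz q)); last first.
    by rewrite evq_ne evq_ad evq_mu half.
  by move: (E (xD xFp) q) => ?; rewrite ?(evq_ne, z, o); ring.
Qed.

Let J5E q : M q -> E (xL xI3) q + E xI3 q * (E (xD xFp) q + E xFz q) + E xP q * E xJ5 q = 0.
Proof.
move=> Mq.
have : E (ad (xL xI3) (ad (mu xI3 (ad (xD xFp) xFz)) (mu xP xJ5))) q = 0.
  exact: J5_structure (Fpp0 Mq).
by rewrite evq_ad (evq_ad (mu _ _)) !evq_mu (evq_ad (xD xFp)) addrA.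
Qed.

(** The remaining components of the covariant differentials of [I3] and of [I3_5]. *)
Definition xI3_2 := sb (ad (dd 3 xI3) (mu xh (dd 4 xI3))) (mu xI3 xg).
Definition xI3_3 := ne (dd 4 xI3).
Definition xI3_53 := ne (dd 4 xJ5).
Definition xI3_55 := mu (ne IP) (sb (xL xJ5) (mu xJ5 (xD xFp))).
Definition xI3_54 := sb (sb (xD xJ5) (mu xJ5 xh)) (mu xI3_55 xg).

Let PIP q : M q -> E xP q * E IP q = 1.
Proof. by move=> Mq; rewrite /evq /= mulfV //; exact: Fpp0. Qed.

Lemma dI3_form q : M q ->
  eqmod1 (form (wk 0) q) (dfun (E xI3) q)
    (E xI3_2 q *: form (wk 1) q + E xI3_3 q *: form (wk 2) q
     + E xJ4 q *: form (wk 3) q + E xJ5 q *: form (wk 4) q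
     + (- (2^-1 * E xI3 q)) *: form (vk 0) q + E xI3 q *: form (vk 1) q).
Proof.
move=> Mq; rewrite (dfun_frame hMFH Mq); last by vm_compute.
have u2 : E xI3_2 q = E (dd 3 xI3) q + E xh q * E (dd 4 xI3) q - E xI3 q * E xg q.
  by apply: etrans (evq_sb _ _ _) _; congr (_ - _); try exact: evq_mu;
    apply: etrans (evq_ad _ _ _) _; congr (_ + _); exact: evq_mu.
have u3 : E xI3_3 q = - E (dd 4 xI3) q by exact: evq_ne.
have u4 : E xJ4 q = E (xD xI3) q + E xI3 q * E xh q - E xg q * E xJ5 q.
  have -> : xJ4 = sb (ad (xD xI3) (mu xI3 xh)) (mu xg xJ5) by vm_compute.
  by apply: etrans (evq_sb _ _ _) _; congr (_ - _); try exact: evq_mu;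
    apply: etrans (evq_ad _ _ _) _; congr (_ + _); exact: evq_mu.
apply: eqmod1_form; rewrite mxE.
- apply: (etrans (y := E (dd 3 xI3) q)); [exact: erefl|]; move: u2 u3.
  by move: (E xI3_2 q) (E xI3_3 q) (E (dd 3 xI3) q) (E (dd 4 xI3) q) => ? ? ? ? -> ->; ring.
- by apply: (etrans (y := E (dd 4 xI3) q)); [exact: erefl|]; rewrite u3 opprK.
- apply: (etrans (y := E (xD xI3) q)); [exact: erefl|]; move: u4.
  by move: (E xJ4 q) (E xI3_3 q) (E (xD xI3) q) => ? ? ? ->; ring.
- apply: (etrans (y := E (xL xI3) q)); [exact: erefl|]; move: (J5E Mq).
  move: (E (xL xI3) q) (E (xD xFp) q) (E xFz q) (E xP q) (E xI3 q) (E xJ5 q).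
  by move=> *; lra.
Qed.

Lemma dJ5_form q : M q ->
  eqmod1 (form (wk 0) q) (dfun (E xJ5) q)
    (E xJ52 q *: form (wk 1) q + E xI3_53 q *: form (wk 2) q
     + E xI3_54 q *: form (wk 3) q + E xI3_55 q *: form (wk 4) q
     + (- (2^-1 * E xJ5 q)) *: form (vk 0) q + (- E xJ5 q) *: form (vk 1) q).
Proof.
move=> Mq; rewrite (dfun_frame hMFH Mq); last by vm_compute.
have u2 : E xJ52 q = E (dd 3 xJ5) q + E xh q * E (dd 4 xJ5) q + E xg q * E xJ5 q.
  have -> : xJ52 = ad (ad (dd 3 xJ5) (mu xh (dd 4 xJ5))) (mu xg xJ5) by vm_compute.
  by apply: etrans (evq_ad _ _ _) _; congr (_ + _); try exact: evq_mu;
    apply: etrans (evq_ad _ _ _) _; congr (_ + _); exact: evq_mu.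
have u3 : E xI3_53 q = - E (dd 4 xJ5) q by exact: evq_ne.
have u4 : E xI3_54 q = E (xD xJ5) q - E xJ5 q * E xh q - E xI3_55 q * E xg q.
  by apply: etrans (evq_sb _ _ _) _; congr (_ - _); try exact: evq_mu;
    apply: etrans (evq_sb _ _ _) _; congr (_ - _); exact: evq_mu.
have u5 : E xI3_55 q = - E IP q * (E (xL xJ5) q - E xJ5 q * E (xD xFp) q).
  by apply: etrans (evq_mu _ _ _) _; congr (_ * _); try exact: evq_ne;
    apply: etrans (evq_sb _ _ _) _; congr (_ - _); exact: evq_mu.
apply: eqmod1_form; rewrite mxE.
- apply: (etrans (y := E (dd 3 xJ5) q)); [exact: erefl|]; move: u2 u3.
  by move: (E xJ52 q) (E xI3_53 q) (E (dd 3 xJ5) q) (E (dd 4 xJ5) q) => ? ? ? ? -> ->; ring.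
- by apply: (etrans (y := E (dd 4 xJ5) q)); [exact: erefl|]; rewrite u3 opprK.
- apply: (etrans (y := E (xD xJ5) q)); [exact: erefl|]; move: u4.
  by move: (E xI3_54 q) (E xI3_55 q) (E (xD xJ5) q) => ? ? ? ->; ring.
- apply: (etrans (y := E (xL xJ5) q)); [exact: erefl|]; move: u5 (PIP Mq).
  move: (E xI3_55 q) (E xP q) (E IP q) (E (xL xJ5) q) (E xJ5 q) (E (xD xFp) q) (E xFz q).
  move=> _ P u l J d z -> Pu.
  have -> : - (- u * (l - J * d)) * P = (P * u) * (l - J * d) by ring.
  by rewrite Pu; ring.
Qed.

Lemma I3_derivatives_exist :
  I3_derivatives M F H (E xJ4) (E xJ5) (E xJ52).
Proof.
exists (form (vk 0)), (form (vk 1)), (E xI3_2), (E xI3_3), (E xI3_53),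
  (E xI3_54), (E xI3_55); split; try by split; exact: smooth_ev.
  exact: varpi_exists.
move=> q Mq w v1 v2; rewrite /w !(omega_hat_form hMFH) // (I3_eq hMFH) //.
rewrite (eq_on_dfun oM Mq (I3_eq hMFH)).
rewrite -(scaleNr (2^-1 * E xI3 q)) -(scaleNr (2^-1 * E xJ5 q)) -(scaleNr (E xJ5 q)).
by split; [exact: dI3_form|exact: dJ5_form].
Qed.

(** The derivatives of [I3] do not depend on the choice of the connection
    forms, which are determined modulo the first coframe form. *)
Lemma I3_derivatives_unique K4 K5 K52 : I3_derivatives M F H K4 K5 K52 ->
  forall q, M q -> [/\ K4 q = E xJ4 q, K5 q = E xJ5 q & K52 q = E xJ52 q].
Proof.
move=> [a1 [a2 [K2 [K3 [K53 [K54 [K55]]]]]]] [sa _ _ HK].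
have K45 q : M q -> K4 q = E xJ4 q /\ K5 q = E xJ5 q.
  move=> Mq; have [[c1 E1] _] := HK q Mq; have [c2 E2] := dI3_form Mq.
  have [l [m [V1 V2]]] := varpi_unique varpi_exists sa Mq.
  have := @coefficients_unique _ _
    (c1 - c2 - 2^-1 * I3 F H q * l + I3 F H q * m)
    (K2 q - E xI3_2 q) (K3 q - E xI3_3 q) (K4 q - E xJ4 q) (K5 q - E xJ5 q)
    (omega_hat_unit hMFH Mq).
  case; last by move=> _ _ /eqP; rewrite subr_eq0 => /eqP -> /eqP; rewrite subr_eq0 => /eqP ->.
  move: E1 E2; rewrite V1 V2 (eq_on_dfun oM Mq (I3_eq hMFH)).
  rewrite !(omega_hat_form hMFH) // (I3_eq hMFH) //.
  move: (form (wk 0) q) (form (wk 1) q) (form (wk 2) q) (form (wk 3) q) (form (wk 4) q).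
  move: (form (vk 0) q) (form (vk 1) q) (dfun _ q) => v1 v2 d w0 w1 w2 w3 w4.
  move=> /rowP E1 /rowP E2; apply/rowP => j; move: (E1 j) (E2 j); rewrite !mxE.
  move: (E xI3 q) (E xJ4 q) (E xJ5 q) (E xI3_2 q) (E xI3_3 q) => *; lra.
move=> q Mq; have [-> ->] := K45 q Mq; split=> //.
have [_ [c1 E1]] := HK q Mq; have [c2 E2] := dJ5_form Mq.
have [l [m [V1 V2]]] := varpi_unique varpi_exists sa Mq.
have := @coefficients_unique _ _
  (c1 - c2 - 2^-1 * K5 q * l - K5 q * m)
  (K52 q - E xJ52 q) (K53 q - E xI3_53 q) (K54 q - E xI3_54 q) (K55 q - E xI3_55 q)
  (omega_hat_unit hMFH Mq).
case; last by move=> /eqP; rewrite subr_eq0 => /eqP.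
move: E1 E2; rewrite V1 V2 (eq_on_dfun oM Mq (fun x Mx => (K45 x Mx).2)) (K45 q Mq).2.
rewrite !(omega_hat_form hMFH) //.
move: (form (wk 0) q) (form (wk 1) q) (form (wk 2) q) (form (wk 3) q) (form (wk 4) q).
move: (form (vk 0) q) (form (vk 1) q) (dfun _ q) => v1 v2 d w0 w1 w2 w3 w4.
move=> /rowP E1 /rowP E2; apply/rowP => j; move: (E1 j) (E2 j); rewrite !mxE.
move: (E xJ5 q) (E xJ52 q) (E xI3_53 q) (E xI3_54 q) (E xI3_55 q) => *; lra.
Qed.

End Derivatives.

(** * Change of adapted coframe *)

Section Lift.
Context {R : realType} {n : nat}.
Variables (w1 w2 w3 w4 w5 : 'rV[R]_n) (dw1 dw2 dw3 dw4 dw5 : 'M[R]_n).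
Variables (v1 v2 v3 v4 : 'rV[R]_n) (i1 i2 i3 k t : R).
Variables (b c s u : R) (be ga ds du : 'rV[R]_n).

(** The torsion coefficient and the connection forms after the change of coframe
    [lift_mx]. They are found by solving the structure equations in turn: the first
    gives [lift_v1], the second and fourth give [lift_v2] up to a multiple [lift_mu] of
    [w1], then [lift_v3] and [lift_v4], and the third and fifth fix the multiples of
    [w1] and [lift_t]. The covectors [be], [ga], [ds], [du] are the differentials of
    [ln b], [ln c], [s], [u]. *)
Definition lift_t : R := t / (b * c) + u * k / (2 * c * (b * c)) - s * i3 / (2 * b * (b * c)).
Definition lift_mu : R := s * u / (2 * (b * c)) + i3 * s / (4 * b) + u * k / (4 * c).
Definition lift_nu : R := s * lift_mu - s ^+ 2 * u / (2 * (b * c)) - i3 * s ^+ 2 / (2 * b)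
  - lift_t * (b * c) * s.
Definition lift_ka : R := - u * lift_mu + u ^+ 2 * s / (2 * (b * c)) + k * u ^+ 2 / (2 * c)
  - lift_t * (b * c) * u.

Definition lift_v1 := v1 + be + ga + (s / b) *: w4 - (u / c) *: w2.
Definition lift_v2 := v2 + 2^-1 *: (ga - be) + (u / (2 * c)) *: w2 + (s / (2 * b)) *: w4
  + lift_mu *: w1.
Definition lift_v3 := (b * c)^-1 *: (ds + (s / 2) *: v1 + s *: v2 + b *: v3 - s *: be
  - (b * lift_mu) *: w2 - (b * u / c) *: w3 + (s ^+ 2 / (2 * b)) *: w4 + lift_nu *: w1).
Definition lift_v4 := (b * c)^-1 *: (du + (u / 2) *: v1 - u *: v2 + c *: v4 - u *: ga
  - (u ^+ 2 / (2 * c)) *: w2 - (s * c / b) *: w5 + (c * lift_mu) *: w4 + lift_ka *: w1).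

(** In the exterior derivatives of the new forms the differential of each matrix
    entry is expressed by [be], [ga], [ds], [du]; the equations then hold
    identically in all components. *)
Lemma structure_lift : b != 0 -> c != 0 ->
  structure_eqs w1 w2 w3 w4 w5 dw1 dw2 dw3 dw4 dw5 v1 v2 v3 v4 i1 i2 i3 k t ->
  structure_eqs ((b * c) *: w1) (s *: w1 + b *: w2)
    ((s ^+ 2 / (2 * (b * c))) *: w1 + (s / c) *: w2 + (b / c) *: w3)
    (u *: w1 + c *: w4)
    (- (u ^+ 2 / (2 * (b * c))) *: w1 + - (u / b) *: w4 + (c / b) *: w5)
    (((b * c) *: (be + ga)) \wedge w1 + (b * c) *: dw1)
    (ds \wedge w1 + s *: dw1 + ((b *: be) \wedge w2 + b *: dw2))
    (((s / (b * c)) *: ds - (s ^+ 2 / (2 * (b * c))) *: (be + ga)) \wedge w1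
        + (s ^+ 2 / (2 * (b * c))) *: dw1
      + ((c^-1 *: ds - (s / c) *: ga) \wedge w2 + (s / c) *: dw2)
      + (((b / c) *: (be - ga)) \wedge w3 + (b / c) *: dw3))
    (du \wedge w1 + u *: dw1 + ((c *: ga) \wedge w4 + c *: dw4))
    ((- ((u / (b * c)) *: du - (u ^+ 2 / (2 * (b * c))) *: (be + ga))) \wedge w1
        + - (u ^+ 2 / (2 * (b * c))) *: dw1
      + ((- (b^-1 *: du - (u / b) *: be)) \wedge w4 + - (u / b) *: dw4)
      + (((c / b) *: (ga - be)) \wedge w5 + (c / b) *: dw5))
    lift_v1 lift_v2 lift_v3 lift_v4
    (i1 / c ^+ 3) (i2 / b ^+ 3) (i3 / b) (k / c) lift_t.
Proof.
move=> b0 c0 [-> -> -> -> ->]; rewrite /structure_eqs /lift_v1 /lift_v2 /lift_v3 /lift_v4.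
rewrite /lift_nu /lift_ka /lift_mu /lift_t.
split; apply/matrixP => i j; rewrite !(mxE, big_ord1).
- by field; rewrite ?b0 ?c0.
- by field; rewrite ?b0 ?c0.
- by field; rewrite ?b0 ?c0.
- by field; rewrite ?b0 ?c0.
- by field; rewrite ?b0 ?c0.
Qed.

End Lift.

Lemma sum_ord5 (V : nmodType) (f : 'I_5 -> V) :
  \sum_(k < 5) f k = f 0 + (f 1 + (f 2 + (f 3 + f 4))).
Proof.
rewrite !big_ord_recl big_ord0 addr0.
by do ![congr (_ + _)]; congr (f _); apply: val_inj.
Qed.

Section LiftedCoframe.
Context {R : realType} {n : nat}.
Implicit Types (f g : 'rV[R]_n.+1 -> R) (q : 'rV[R]_n.+1) (d : 'rV[R]_n.+1).

Definition has_dfun f q d := differentiable f q /\ dfun f q = d.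

Lemma has_dfunE f q : differentiable f q -> has_dfun f q (dfun f q).
Proof. by []. Qed.

Lemma has_dfun_eq f q d d' : d = d' -> has_dfun f q d -> has_dfun f q d'.
Proof. by move->. Qed.

Lemma has_dfun_cst (a : R) q : has_dfun (fun=> a) q 0.
Proof. by split=> //; apply/rowP => i; rewrite !mxE partial_cst. Qed.

Lemma has_dfunM f g q d d' : has_dfun f q d -> has_dfun g q d' ->
  has_dfun (fun x => f x * g x) q (g q *: d + f q *: d').
Proof.
move=> [df <-] [dg <-]; split; first exact: differentiableM.
by apply/rowP => i; rewrite !mxE partialM // [g q * _]mulrC.
Qed.

Lemma has_dfunN f q d : has_dfun f q d -> has_dfun (fun x => - f x) q (- d).
Proof.
move=> [df <-]; split; first exact: differentiableN.
by apply/rowP => i; rewrite !mxE partialN.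
Qed.

Lemma has_dfunV f q d : f q != 0 -> has_dfun f q d ->
  has_dfun (fun x => (f x)^-1) q (- (f q ^- 2) *: d).
Proof.
move=> f0 [df <-]; split; first exact: differentiableV.
apply/rowP => i; rewrite !mxE partialV //; field.
by rewrite f0.
Qed.

Lemma has_dfunX2 f q d : has_dfun f q d ->
  has_dfun (fun x => f x ^+ 2) q ((2 * f q) *: d).
Proof.
move=> hf; have := has_dfunM hf hf.
by rewrite -scalerDl -mulr2n -[_ *+ 2]mulr_natl.
Qed.

(** The matrix of the group [G^4], with [b = rho e^phi] and [c = rho e^-phi]. *)
Definition lift_mx (b c s u : R) : 'M[R]_5 :=
  mx_of_seqs 5 5
    [:: [:: b * c; 0; 0; 0; 0];
        [:: s; b; 0; 0; 0];
        [:: s ^+ 2 / (2 * (b * c)); s / c; b / c; 0; 0];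
        [:: u; 0; 0; c; 0];
        [:: - (u ^+ 2 / (2 * (b * c))); 0; 0; - (u / b); c / b]].

Variables (b c s u : 'rV[R]_n.+1 -> R) (q : 'rV[R]_n.+1).
Hypotheses (b0 : b q != 0) (c0 : c q != 0).
Hypotheses (db : differentiable b q) (dc : differentiable c q).
Hypotheses (ds : differentiable s q) (du : differentiable u q).
Let be := (b q)^-1 *: dfun b q.
Let ga := (c q)^-1 *: dfun c q.
Let L x := lift_mx (b x) (c x) (s x) (u x).

(* The differentials of the entries of [L]. *)
Let dL : seq (seq 'rV[R]_n.+1) :=
  [:: [:: (b q * c q) *: (be + ga)];
      [:: dfun s q; b q *: be];
      [:: (s q / (b q * c q)) *: dfun s q - (s q ^+ 2 / (2 * (b q * c q))) *: (be + ga);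
          (c q)^-1 *: dfun s q - (s q / c q) *: ga; (b q / c q) *: (be - ga)];
      [:: dfun u q; 0; 0; c q *: ga];
      [:: - ((u q / (b q * c q)) *: dfun u q - (u q ^+ 2 / (2 * (b q * c q))) *: (be + ga));
          0; 0; - ((b q)^-1 *: dfun u q - (u q / b q) *: be); (c q / b q) *: (ga - be)]].

Let has_dL (i j : 'I_5) : has_dfun (fun x => L x i j) q (nth [::] dL i)`_j.
Proof.
have hb := has_dfunE db; have hc := has_dfunE dc.
have hs := has_dfunE ds; have hu := has_dfunE du.
have h2 := has_dfun_cst 2 q.
have bc0 : 2 * (b q * c q) != 0 by rewrite !mulf_neq0.
have hz : has_dfun (fun=> 0) q 0 := has_dfun_cst 0 q.
under [X in has_dfun X]eq_fun => x do rewrite mxE.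
case: i => -[|[|[|[|[|//]]]]] ?; case: j => -[|[|[|[|[|//]]]]] ? //=.
- apply: has_dfun_eq (has_dfunM hb hc).
  by apply/rowP => l; rewrite !mxE; field; rewrite b0 c0.
- apply: has_dfun_eq hb.
  by apply/rowP => l; rewrite !mxE; field; rewrite b0.
- apply: has_dfun_eq (has_dfunM (has_dfunX2 hs) (has_dfunV bc0 (has_dfunM h2 (has_dfunM hb hc)))).
  by apply/rowP => l; rewrite !mxE; field; rewrite b0 c0.
- apply: has_dfun_eq (has_dfunM hs (has_dfunV c0 hc)).
  by apply/rowP => l; rewrite !mxE; field; rewrite c0.
- apply: has_dfun_eq (has_dfunM hb (has_dfunV c0 hc)).
  by apply/rowP => l; rewrite !mxE; field; rewrite b0 c0.
- apply: has_dfun_eq hc.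
  by apply/rowP => l; rewrite !mxE; field; rewrite c0.
- apply: has_dfun_eq (has_dfunN (has_dfunM (has_dfunX2 hu)
    (has_dfunV bc0 (has_dfunM h2 (has_dfunM hb hc))))).
  by apply/rowP => l; rewrite !mxE; field; rewrite b0 c0.
- apply: has_dfun_eq (has_dfunN (has_dfunM hu (has_dfunV b0 hb))).
  by apply/rowP => l; rewrite !mxE; field; rewrite b0.
- apply: has_dfun_eq (has_dfunM hc (has_dfunV b0 hb)).
  by apply/rowP => l; rewrite !mxE; field; rewrite b0 c0.
Qed.

(** Whether the group parameters are coordinates on a bundle or functions on the base
    does not matter, so this serves both the lift and the proof of invariance. *)
Lemma structure_lift_mx (W : 'rV[R]_n.+1 -> 'M[R]_(5, n.+1)) v1 v2 v3 v4 i1 i2 i3 k t :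
  differentiable W q ->
  let w i := row i (W q) in let dw i := dform (fun x => row i (W x)) q in
  structure_eqs (w 0) (w 1) (w 2) (w 3) (w 4)
    (dw 0) (dw 1) (dw 2) (dw 3) (dw 4) v1 v2 v3 v4 i1 i2 i3 k t ->
  let w' i := row i (L q *m W q) in
  let dw' i := dform (fun x => row i (L x *m W x)) q in
  structure_eqs (w' 0) (w' 1) (w' 2) (w' 3) (w' 4)
    (dw' 0) (dw' 1) (dw' 2) (dw' 3) (dw' 4)
    (lift_v1 (w 1) (w 3) v1 (b q) (c q) (s q) (u q) be ga)
    (lift_v2 (w 0) (w 1) (w 3) v2 i3 k (b q) (c q) (s q) (u q) be ga)
    (lift_v3 (w 0) (w 1) (w 2) (w 3) v1 v2 v3 i3 k t (b q) (c q) (s q) (u q) be (dfun s q))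
    (lift_v4 (w 0) (w 1) (w 3) (w 4) v1 v2 v4 i3 k t (b q) (c q) (s q) (u q) ga (dfun u q))
    (i1 / c q ^+ 3) (i2 / b q ^+ 3) (i3 / b q) (k / c q)
    (lift_t i3 k t (b q) (c q) (s q) (u q)).
Proof.
move=> dW w dw eqs w' dw'.
have dLx : differentiable L q.
  by apply: (@differentiable_mx _ _ _ _ setT) => i j; case: (has_dL i j).
have dwE i : dw' i = \sum_(k < 5) ((nth [::] dL i)`_k \wedge w k + L q i k *: dw k).
  rewrite /dw' (dform_mulmx _ dLx dW); apply: eq_bigr => l _.
  by rewrite (has_dL i l).2.
have wE i : w' i = \sum_(k < 5) L q i k *: w k.
  by rewrite /w' row_mul mulmx_sum_row; apply: eq_bigr => l _; rewrite mxE.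
have LE i l : L q i l = (nth [::]
    [:: [:: b q * c q; 0; 0; 0; 0];
        [:: s q; b q; 0; 0; 0];
        [:: s q ^+ 2 / (2 * (b q * c q)); s q / c q; b q / c q; 0; 0];
        [:: u q; 0; 0; c q; 0];
        [:: - (u q ^+ 2 / (2 * (b q * c q))); 0; 0; - (u q / b q); c q / b q]] i)`_l.
  by rewrite mxE.
have w0 : w' 0 = (b q * c q) *: w 0.
  by rewrite wE sum_ord5 !LE /= !scale0r !addr0.
have w1 : w' 1 = s q *: w 0 + b q *: w 1.
  by rewrite wE sum_ord5 !LE /= !scale0r !addr0.
have w2 : w' 2 = (s q ^+ 2 / (2 * (b q * c q))) *: w 0 + (s q / c q) *: w 1 + (b q / c q) *: w 2.
  by rewrite wE sum_ord5 !LE /= !scale0r !addr0 !addrA.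
have w3 : w' 3 = u q *: w 0 + c q *: w 3.
  by rewrite wE sum_ord5 !LE /= !scale0r !add0r !addr0.
have w4 : w' 4 = - (u q ^+ 2 / (2 * (b q * c q))) *: w 0 + - (u q / b q) *: w 3 + (c q / b q) *: w 4.
  by rewrite wE sum_ord5 !LE /= !scale0r !add0r !addrA.
(* The summands are abstracted so that the zero ones are found syntactically. *)
have [T TE] : exists T : 'I_5 -> 'I_5 -> 'M[R]_n.+1,
    forall i l : 'I_5, T i l = (nth [::] dL i)`_l \wedge w l + L q i l *: dw l.
  by exists (fun i l : 'I_5 => (nth [::] dL i)`_l \wedge w l + L q i l *: dw l).
have dwT i : dw' i = T i 0 + (T i 1 + (T i 2 + (T i 3 + T i 4))).
  by rewrite dwE sum_ord5 -!TE.
have Tz (i l : 'I_5) : (nth [::] dL i)`_l = 0 -> L q i l = 0 -> T i l = 0.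
  by move=> d0 l0; rewrite TE d0 l0 scale0r addr0 /wedge trmx0 mul0mx mulmx0 subr0.
have [nat0 nat1 nat2] : [/\ nat_of_ord (0 : 'I_5) = 0%N, nat_of_ord (1 : 'I_5) = 1%N
    & nat_of_ord (2 : 'I_5) = 2%N] by [].
have [nat3 nat4] : nat_of_ord (3 : 'I_5) = 3%N /\ nat_of_ord (4 : 'I_5) = 4%N by [].
have dw0 : dw' 0 = ((b q * c q) *: (be + ga)) \wedge w 0 + (b q * c q) *: dw 0.
  rewrite dwT (Tz 0 1 erefl (LE 0 1)) (Tz 0 2 erefl (LE 0 2)) (Tz 0 3 erefl (LE 0 3)).
  rewrite (Tz 0 4 erefl (LE 0 4)) !addr0 TE LE nat0 /dL; cbn [nth]; reflexivity.
have dw1 : dw' 1 = dfun s q \wedge w 0 + s q *: dw 0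
    + ((b q *: be) \wedge w 1 + b q *: dw 1).
  rewrite dwT (Tz 1 2 erefl (LE 1 2)) (Tz 1 3 erefl (LE 1 3)) (Tz 1 4 erefl (LE 1 4)).
  rewrite !addr0 !TE (LE 1 0) (LE 1 1) nat0 nat1 /dL; cbn [nth]; reflexivity.
have dw2 : dw' 2 =
    ((s q / (b q * c q)) *: dfun s q - (s q ^+ 2 / (2 * (b q * c q))) *: (be + ga)) \wedge w 0
      + (s q ^+ 2 / (2 * (b q * c q))) *: dw 0
    + (((c q)^-1 *: dfun s q - (s q / c q) *: ga) \wedge w 1 + (s q / c q) *: dw 1)
    + (((b q / c q) *: (be - ga)) \wedge w 2 + (b q / c q) *: dw 2).
  rewrite dwT (Tz 2 3 erefl (LE 2 3)) (Tz 2 4 erefl (LE 2 4)) !addr0 addrA.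
  rewrite !TE (LE 2 0) (LE 2 1) (LE 2 2) nat0 nat1 nat2 /dL; cbn [nth]; reflexivity.
have dw3 : dw' 3 = dfun u q \wedge w 0 + u q *: dw 0
    + ((c q *: ga) \wedge w 3 + c q *: dw 3).
  rewrite dwT (Tz 3 1 erefl (LE 3 1)) (Tz 3 2 erefl (LE 3 2)) (Tz 3 4 erefl (LE 3 4)).
  rewrite !add0r addr0 !TE (LE 3 0) (LE 3 3) nat0 nat3 /dL; cbn [nth]; reflexivity.
have dw4 : dw' 4 =
    (- ((u q / (b q * c q)) *: dfun u q - (u q ^+ 2 / (2 * (b q * c q))) *: (be + ga))) \wedge w 0
      + - (u q ^+ 2 / (2 * (b q * c q))) *: dw 0
    + ((- ((b q)^-1 *: dfun u q - (u q / b q) *: be)) \wedge w 3 + - (u q / b q) *: dw 3)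
    + (((c q / b q) *: (ga - be)) \wedge w 4 + (c q / b q) *: dw 4).
  rewrite dwT (Tz 4 1 erefl (LE 4 1)) (Tz 4 2 erefl (LE 4 2)) !add0r addrA.
  rewrite !TE (LE 4 0) (LE 4 3) (LE 4 4) nat0 nat3 nat4 /dL; cbn [nth]; reflexivity.
rewrite w0 w1 w2 w3 w4 dw0 dw1 dw2 dw3 dw4.
exact: (@structure_lift _ _ _ _ _ _ _ _ _ _ _ _ _ _ _ _ _ _ _ _ _ 
  (b q) (c q) (s q) (u q) be ga (dfun s q) (dfun u q) b0 c0 eqs).
Qed.

End LiftedCoframe.

Section Composition.
Context {R : realType} {m n : nat}.
Variables (U : set 'rV[R]_m.+1) (V : set 'rV[R]_n.+1) (Phi : 'rV[R]_m.+1 -> 'rV[R]_n.+1).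
Hypotheses (oU : open U) (sPhi : smooth U Phi) (UV : forall x, U x -> V (Phi x)).

Lemma Ck_sum k p (f : 'I_p -> 'rV[R]_m.+1 -> R) :
  (forall i, Ck U k (f i)) -> Ck U k (fun x => \sum_i f i x).
Proof.
elim: p f => [|p IH] f Cf.
  by apply: (eq_on_Ck oU) (Ck_cst U k (0 : R)) => x _; rewrite big_ord0.
apply: (eq_on_Ck oU) (CkD oU (Cf ord0) (IH (fun i => f (lift ord0 i)) _)) => // x _.
by rewrite big_ord_recl.
Qed.

Lemma Ck_comp k (f : 'rV[R]_n.+1 -> R) : Ck V k f -> Ck U k (fun x => f (Phi x)).
Proof.
have dPhi x : U x -> differentiable Phi x by exact: smooth_differentiable.
elim: k f => [|k IH] f Cf.
  by split=> // x Ux; apply: differentiable_comp_coord; [exact: dPhi|exact/Cf.1/UV].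
split=> [x Ux|i].
  by apply: differentiable_comp_coord; [exact: dPhi|exact/Cf.1/UV].
apply: (eq_on_Ck oU (f := fun x => \sum_l partial i (fun y => Phi y 0 l) x * partial l f (Phi x))).
  by move=> x Ux; rewrite partial_comp //; [exact: dPhi|exact/Cf.1/UV].
apply: Ck_sum => l; apply: CkM => //; last exact/IH/Cf.2.
have /(smooth_mx oU)/(_ 0 l)/smoothP/(_ k.+1) [_] := sPhi; exact.
Qed.

Lemma smooth_comp (f : 'rV[R]_n.+1 -> R) : smooth V f -> smooth U (fun x => f (Phi x)).
Proof. by move=> /smoothP sf; apply/smoothP => k; exact: Ck_comp. Qed.

Lemma smooth_comp_mx p l (f : 'rV[R]_n.+1 -> 'M[R]_(p, l)) : open V ->
  smooth V f -> smooth U (fun x => f (Phi x)).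
Proof.
move=> oV /(smooth_mx oV) sf; apply/(smooth_mx oU) => i j.
exact: smooth_comp (sf i j).
Qed.

End Composition.

Section SmoothMatrices.
Context {R : realType} {n p l : nat} {U : set 'rV[R]_n.+1} (oU : open U).
Implicit Types (f g : 'rV[R]_n.+1 -> 'M[R]_(p, l)).

Lemma smooth_mxD f g : smooth U f -> smooth U g -> smooth U (fun x => f x + g x).
Proof.
move=> /(smooth_mx oU) sf /(smooth_mx oU) sg; apply/(smooth_mx oU) => i j.
by apply: (eq_on_smooth oU) (smoothD oU (sf i j) (sg i j)) => x _; rewrite mxE.
Qed.

Lemma smooth_mxN f : smooth U f -> smooth U (fun x => - f x).
Proof.
move=> /(smooth_mx oU) sf; apply/(smooth_mx oU) => i j.
by apply: (eq_on_smooth oU) (smoothN oU (sf i j)) => x _; rewrite mxE.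
Qed.

Lemma smooth_mxZ (a : 'rV[R]_n.+1 -> R) f :
  smooth U a -> smooth U f -> smooth U (fun x => a x *: f x).
Proof.
move=> sa /(smooth_mx oU) sf; apply/(smooth_mx oU) => i j.
by apply: (eq_on_smooth oU) (smoothM oU sa (sf i j)) => x _; rewrite mxE.
Qed.

End SmoothMatrices.

Lemma structure_eqs_mulmx {R : realType} n m (P : 'M[R]_(n, m))
    (w1 w2 w3 w4 w5 : 'rV[R]_n) (dw1 dw2 dw3 dw4 dw5 : 'M[R]_n)
    (v1 v2 v3 v4 : 'rV[R]_n) i1 i2 i3 k t :
  structure_eqs w1 w2 w3 w4 w5 dw1 dw2 dw3 dw4 dw5 v1 v2 v3 v4 i1 i2 i3 k t ->
  structure_eqs (w1 *m P) (w2 *m P) (w3 *m P) (w4 *m P) (w5 *m P)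
    (P^T *m dw1 *m P) (P^T *m dw2 *m P) (P^T *m dw3 *m P) (P^T *m dw4 *m P)
    (P^T *m dw5 *m P) (v1 *m P) (v2 *m P) (v3 *m P) (v4 *m P) i1 i2 i3 k t.
Proof.
move=> [-> -> -> -> ->]; split.
all: by rewrite !(mulmxDr, mulmxDl, mulmxN, mulNmx, =^~ scalemxAr, =^~ scalemxAl, mulmx_wedge).
Qed.

(** * The exterior differential system on the bundle *)

Section LiftFiber.
Context {R : realType} {n m : nat}.
Variables (w1 w2 w3 w4 w5 v1 v2 v3 v4 : 'rV[R]_n) (i3 k t b c s u : R).
Variables (be ga ds du : 'rV[R]_n) (Q : 'M[R]_(n, m)).
Hypotheses (w1Q : w1 *m Q = 0) (w2Q : w2 *m Q = 0) (w3Q : w3 *m Q = 0).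
Hypotheses (w4Q : w4 *m Q = 0) (w5Q : w5 *m Q = 0).
Hypotheses (v1Q : v1 *m Q = 0) (v2Q : v2 *m Q = 0) (v3Q : v3 *m Q = 0) (v4Q : v4 *m Q = 0).

(** With [Q] the inclusion of a fibre, on which all forms of the base vanish, only the
    differentials of the group parameters survive in the connection forms. *)
Lemma lift_connection_fiber :
  [/\ lift_v1 w2 w4 v1 b c s u be ga *m Q = be *m Q + ga *m Q,
      lift_v2 w1 w2 w4 v2 i3 k b c s u be ga *m Q = 2^-1 *: (ga *m Q - be *m Q),
      lift_v3 w1 w2 w3 w4 v1 v2 v3 i3 k t b c s u be ds *m Q
        = (b * c)^-1 *: (ds *m Q - s *: (be *m Q))
    & lift_v4 w1 w2 w4 w5 v1 v2 v4 i3 k t b c s u ga du *m Q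
        = (b * c)^-1 *: (du *m Q - u *: (ga *m Q))].
Proof.
rewrite /lift_v1 /lift_v2 /lift_v3 /lift_v4 !(mulmxDl, mulNmx, =^~ scalemxAl).
rewrite w1Q w2Q w3Q w4Q w5Q v1Q v2Q v3Q v4Q.
by rewrite !(scaler0, addr0, subr0, add0r, oppr0).
Qed.

End LiftFiber.

Lemma lift_mx_unit {R : realType} (b c s u : R) :
  b != 0 -> c != 0 -> lift_mx b c s u \in unitmx.
Proof.
move=> b0 c0; rewrite -unitmx_tr -row_free_unit; apply: inj_row_free => x E0.
have E j : \sum_(k < 5) x 0 k * lift_mx b c s u j k = 0.
  have := congr1 (fun y : 'rV[R]_5 => y 0 j) E0; rewrite [RHS]mxE => E1.
  rewrite -[RHS]E1 [RHS]mxE; apply: eq_bigr => k _.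
  by congr (_ * _); rewrite [RHS]mxE.
have bc0 : b * c != 0 by rewrite mulf_neq0.
have := (E 0, E 1, E 2, E 3, E 4); rewrite !sum_ord5 !mxE /=.
rewrite !(mulr0, addr0, add0r) => -[[[[E0' E1] E2] E3] E4]; move: E0' E1 E2 E3 E4 => /eqP.
rewrite mulf_eq0 (negPf bc0) orbF => /eqP x0; rewrite x0 !mul0r !add0r.
move=> /eqP; rewrite mulf_eq0 (negPf b0) orbF => /eqP x1; rewrite x1 mul0r add0r.
move=> /eqP; rewrite mulf_eq0 (negPf (mulf_neq0 b0 (invr_neq0 c0))) orbF => /eqP x2.
move=> /eqP; rewrite mulf_eq0 (negPf c0) orbF => /eqP x3; rewrite x3 mul0r add0r.
move=> /eqP; rewrite mulf_eq0 (negPf (mulf_neq0 c0 (invr_neq0 b0))) orbF => /eqP x4.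
apply/rowP => j; rewrite [RHS]mxE; case: j => -[|[|[|[|[|//]]]]] jlt.
- by rewrite -[RHS]x0; congr (x 0 _); apply: val_inj.
- by rewrite -[RHS]x1; congr (x 0 _); apply: val_inj.
- by rewrite -[RHS]x2; congr (x 0 _); apply: val_inj.
- by rewrite -[RHS]x3; congr (x 0 _); apply: val_inj.
- by rewrite -[RHS]x4; congr (x 0 _); apply: val_inj.
Qed.

Lemma fiber_rows_free {R : realType} (r a s u : R) (x : 'rV[R]_4) : r != 0 -> a != 0 ->
  let e5 := r^-1 *: delta_mx 0 0 : 'rV[R]_4 in let e6 := delta_mx 0 1 in
  x 0 0 *: (e5 + e6 + (e5 - e6)) + x 0 1 *: (2^-1 *: (e5 - e6 - (e5 + e6)))
  + x 0 2 *: (a *: (delta_mx 0 2 - s *: (e5 + e6)))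
  + x 0 3 *: (a *: (delta_mx 0 3 - u *: (e5 - e6))) = 0 -> x = 0.
Proof.
move=> r0 a0 e5 e6 /rowP E0.
have := (E0 3, E0 2); rewrite !mxE /= => -[E3 E2].
have x3 : x 0 3 = 0.
  by apply/eqP; rewrite -(mulIr_eq0 _ (mulIf a0)); apply/eqP; rewrite -[RHS]E3; ring.
have x2 : x 0 2 = 0.
  by apply/eqP; rewrite -(mulIr_eq0 _ (mulIf a0)); apply/eqP; rewrite -[RHS]E2; ring.
have := (E0 0, E0 1); rewrite x2 x3 !mxE /= => -[E00 E1].
have x1 : x 0 1 = 0 by move: E1; lra.
have x0 : x 0 0 = 0.
  have r2 : 2 / r != 0 by rewrite mulf_neq0 ?invr_neq0.
  by apply/eqP; rewrite -(mulIr_eq0 _ (mulIf r2)); apply/eqP; rewrite -[RHS]E00; ring.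
apply/rowP => j; rewrite [RHS]mxE; case: j => -[|[|[|[|//]]]] jlt.
- by rewrite -[RHS]x0; congr (x 0 _); apply: val_inj.
- by rewrite -[RHS]x1; congr (x 0 _); apply: val_inj.
- by rewrite -[RHS]x2; congr (x 0 _); apply: val_inj.
- by rewrite -[RHS]x3; congr (x 0 _); apply: val_inj.
Qed.
Section Bundle.
Context {R : realType} {M : set 'rV[R]_5} {F : 'rV[R]_4 -> R} {H : 'rV[R]_5 -> R}.
Hypothesis hMFH : integrable_system M F H.
Let oM : open M. Proof. by case: hMFH. Qed.
Local Notation E := (@evq R F H).
Local Notation form := (@frame_form R F H).

(** Right multiplication by [proj] pulls covectors of the base back to the bundle. *)
Definition proj : 'M[R]_(5, 9) := (row_mx 1%:M 0 : 'M[R]_(5, 5 + 4)).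

Lemma smooth_base (U : set 'rV[R]_9) : open U -> smooth U base.
Proof.
move=> oU; apply/(smooth_mx oU) => i k.
by apply: (eq_on_smooth oU) (smooth_coord oU (lshift 4 k)) => x _; rewrite mxE ord1.
Qed.

Lemma open_G9 : open (G9 M).
Proof.
have o1 : open [set u : 'rV[R]_9 | M (base u)].
  apply: (@open_comp _ _ base) oM => x _; apply: differentiable_continuous.
  by apply: (smooth_differentiable (smooth_base openT)).
have o2 : open [set u : 'rV[R]_9 | 0 < rho u].
  by apply: (@open_comp _ _ rho) (@open_gt R 0) => x _; exact: coord_continuous.
exact: openI o1 o2.
Qed.
Let oG := open_G9.

Lemma jacobian_base u : ('J base u)^T = proj.
Proof.
apply/matrixP => k j; rewrite mxE jacobian_partial; last first.
  exact: smooth_differentiable (smooth_base openT) I.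
rewrite (_ : (fun x => _) = (fun x : 'rV[R]_9 => x 0 (lshift 4 k))); last first.
  by apply/funext => x; rewrite mxE.
rewrite partial_coord; case: (split_ordP (j : 'I_(5 + 4))) => l ->.
  apply: etrans (esym (row_mxEl (1%:M : 'M[R]_5) (0 : 'M[R]_(5, 4)) k l)).
  by rewrite -val_eqE /= mxE eq_sym -val_eqE.
apply: etrans (esym (row_mxEr (1%:M : 'M[R]_5) (0 : 'M[R]_(5, 4)) k l)).
by rewrite -val_eqE /= mxE gtn_eqF // (leq_trans (ltn_ord k)) // leq_addr.
Qed.

Definition scale_b (u : 'rV[R]_9) := rho u * expR (phi u).
Definition scale_c (u : 'rV[R]_9) := rho u * expR (- phi u).

Lemma G4_matrix_lift u : 0 < rho u ->
  G4_matrix u = lift_mx (scale_b u) (scale_c u) (f2 u) (fbar2 u).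
Proof.
move=> r0; have rN : rho u != 0 by rewrite gt_eqF.
have eN : expR (phi u) != 0 by rewrite gt_eqF ?expR_gt0.
have eV : expR (- phi u) = (expR (phi u))^-1 by rewrite expRN.
have e2 : expR (2 * phi u) = expR (phi u) ^+ 2 by rewrite expRM_natl.
have e2V : expR (- 2 * phi u) = (expR (phi u))^-1 ^+ 2.
  by rewrite mulNr expRN e2 exprVn.
apply/matrixP => i j; rewrite !mxE /scale_b /scale_c eV e2 e2V.
move: (rho u) (expR (phi u)) (f2 u) (fbar2 u) rN eN => r e s t rN eN.
case: i => -[|[|[|[|[|//]]]]] ?; case: j => -[|[|[|[|[|//]]]]] ? //=; field;
  by rewrite ?rN ?eN.
Qed.

Definition dlog_b (u : 'rV[R]_9) : 'rV[R]_9 := (rho u)^-1 *: dcoord 5 + dcoord 6.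
Definition dlog_c (u : 'rV[R]_9) : 'rV[R]_9 := (rho u)^-1 *: dcoord 5 - dcoord 6.

Lemma dfun_coord n (k : 'I_n.+1) (u : 'rV[R]_n.+1) :
  has_dfun (fun x : 'rV[R]_n.+1 => x 0 k) u (dcoord k).
Proof.
split; first exact: differentiable_coord.
by apply/rowP => i; rewrite !mxE partial_coord.
Qed.

Lemma has_dfun_expR n (f : 'rV[R]_n.+1 -> R) q d : has_dfun f q d ->
  has_dfun (fun x => expR (f x)) q (expR (f q) *: d).
Proof.
move=> [df <-]; split; first exact: differentiable_expR_comp.
by apply/rowP => i; rewrite !mxE partial_expR.
Qed.

Lemma dfun_scale_b u : 0 < rho u -> has_dfun scale_b u (scale_b u *: dlog_b u).
Proof.
move=> r0; have rN : rho u != 0 by rewrite gt_eqF.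
apply: has_dfun_eq (has_dfunM (dfun_coord 5 u) (has_dfun_expR (dfun_coord 6 u))).
apply/rowP => i; rewrite !mxE -/(rho u) -/(phi u) /scale_b.
by move: (rho u) (expR (phi u)) rN => r e rN; field.
Qed.

Lemma dfun_scale_c u : 0 < rho u -> has_dfun scale_c u (scale_c u *: dlog_c u).
Proof.
move=> r0; have rN : rho u != 0 by rewrite gt_eqF.
apply: has_dfun_eq (has_dfunM (dfun_coord 5 u) (has_dfun_expR (has_dfunN (dfun_coord 6 u)))).
apply/rowP => i; rewrite !mxE -/(rho u) -/(phi u) /scale_c.
by move: (rho u) (expR (- phi u)) rN => r e rN; field.
Qed.

Definition basew (k : 'I_5) (u : 'rV[R]_9) : 'rV[R]_9 :=
  row k (omega_hat F H (base u) *m proj).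
Definition basev (k : nat) (u : 'rV[R]_9) : 'rV[R]_9 := form (vk k) (base u) *m proj.

Definition bundle_forms (u : 'rV[R]_9) : seq 'rV[R]_9 :=
  let q := base u in let b := scale_b u in let c := scale_c u in
  let k := 2^-1 * E xJ5 q in
  [:: lift_v1 (basew 1 u) (basew 3 u) (basev 0 u) b c (f2 u) (fbar2 u) (dlog_b u) (dlog_c u);
      lift_v2 (basew 0 u) (basew 1 u) (basew 3 u) (basev 1 u) (I3 F H q) k
        b c (f2 u) (fbar2 u) (dlog_b u) (dlog_c u);
      lift_v3 (basew 0 u) (basew 1 u) (basew 2 u) (basew 3 u) (basev 0 u) (basev 1 u)
        (basev 2 u) (I3 F H q) k (E xT q) b c (f2 u) (fbar2 u) (dlog_b u) (dcoord 7);
      lift_v4 (basew 0 u) (basew 1 u) (basew 3 u) (basew 4 u) (basev 0 u) (basev 1 u)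
        (basev 3 u) (I3 F H q) k (E xT q) b c (f2 u) (fbar2 u) (dlog_c u) (dcoord 8)].

Definition bundle_connection (u : 'rV[R]_9) : 'M[R]_(4, 9) := mx_of_rows 4 (bundle_forms u).

Lemma theta_lift u : G9 M u -> theta F H u =
  lift_mx (scale_b u) (scale_c u) (f2 u) (fbar2 u) *m (omega_hat F H (base u) *m proj).
Proof.
move=> [_ r0]; rewrite /theta G4_matrix_lift //; congr (_ *m _).
apply: esym; apply: etrans (mul_mx_row _ (1%:M : 'M[R]_5) (0 : 'M[R]_(5, 4))) _.
by rewrite mulmx1 mulmx0.
Qed.

Lemma bundle_structure u : G9 M u ->
  let q := base u in let b := scale_b u in let c := scale_c u in
  let th i := row i (theta F H u) in
  let dth i := dform (fun x => row i (theta F H x)) u in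
  let k := 2^-1 * E xJ5 q in
  structure_eqs (th 0) (th 1) (th 2) (th 3) (th 4)
    (dth 0) (dth 1) (dth 2) (dth 3) (dth 4)
    (bundle_forms u)`_0 (bundle_forms u)`_1 (bundle_forms u)`_2 (bundle_forms u)`_3
    (I1 F H q / c ^+ 3) (I2 F H q / b ^+ 3) (I3 F H q / b) (k / c)
    (lift_t (I3 F H q) k (E xT q) b c (f2 u) (fbar2 u)).
Proof.
move=> Gu q b c th dth k; have [Mq r0] := Gu.
pose W (x : 'rV[R]_9) := omega_hat F H (base x) *m proj.
have sW : smooth (G9 M) W.
  apply: (smooth_mulmx oG); last exact: smooth_cst.
  apply: (smooth_comp_mx oG (smooth_base oG) _ oM (smooth_omega_hat hMFH)).
  by move=> x [].
have dW := smooth_differentiable sW Gu.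
have dWE i : dform (fun x => row i (W x)) u =
    proj^T *m dform (fun x => row i (omega_hat F H x)) q *m proj.
  rewrite -(jacobian_base u) trmxK.
  rewrite -(dform_pullback oG (smooth_base oG) Gu); last first.
    apply: smooth_differentiable Mq; apply/(smooth_mx oM) => k' j.
    have /(smooth_mx oM)/(_ i j) := smooth_omega_hat hMFH.
    by apply: (eq_on_smooth oM) => x _; rewrite [RHS]mxE.
  congr (dform _ u); apply/funext => x; by rewrite jacobian_base row_mul.
have dthE i : dth i = dform (fun x => row i
    (lift_mx (scale_b x) (scale_c x) (f2 x) (fbar2 x) *m W x)) u.
  by apply: (eq_on_dform oG Gu) => x Gx; rewrite theta_lift.
have [db dbE] := dfun_scale_b r0; have [dc dcE] := dfun_scale_c r0.
have bN : scale_b u != 0 by rewrite mulf_neq0 ?gt_eqF ?expR_gt0.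
have cN : scale_c u != 0 by rewrite mulf_neq0 ?gt_eqF ?expR_gt0.
have eqs : let w i := row i (W u) in let dw i := dform (fun x => row i (W x)) u in
    structure_eqs (w 0) (w 1) (w 2) (w 3) (w 4) (dw 0) (dw 1) (dw 2) (dw 3) (dw 4)
      (basev 0 u) (basev 1 u) (basev 2 u) (basev 3 u)
      (I1 F H q) (I2 F H q) (I3 F H q) k (E xT q).
  move=> w dw; rewrite /w /dw !dWE /W !row_mul.
  exact: structure_eqs_mulmx (omega_hat_structure hMFH Mq).
have := structure_lift_mx bN cN db dc (dfun_coord 7 u).1 (dfun_coord 8 u).1 dW eqs.
have beE : (scale_b u)^-1 *: dfun scale_b u = dlog_b u.
  by rewrite dbE scalerA mulVf // scale1r.
have gaE : (scale_c u)^-1 *: dfun scale_c u = dlog_c u.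
  by rewrite dcE scalerA mulVf // scale1r.
have sE : dfun (fun x : 'rV[R]_9 => x 0 7) u = dcoord 7 := (dfun_coord 7 u).2.
have uE : dfun (fun x : 'rV[R]_9 => x 0 8) u = dcoord 8 := (dfun_coord 8 u).2.
rewrite beE gaE sE uE => eqs'.
have thE i : th i = row i (lift_mx (scale_b u) (scale_c u) (f2 u) (fbar2 u) *m W u).
  by rewrite /th theta_lift.
rewrite !thE !dthE.
exact: eqs'.
Qed.

(** The coefficients of [structure_lift], in the fibre coordinates. *)
Lemma bundle_coefficients (r f fb ph J4 J5 J52 K : R) : 0 < r ->
  let b := r * expR ph in let c := r * expR (- ph) in
  let T := 8^-1 * (J52 + 2 * J4) in
  [/\ (c ^+ 3)^-1 = expR (3 * ph) / r ^+ 3, (b ^+ 3)^-1 = expR (- 3 * ph) / r ^+ 3,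
      b^-1 = expR (- ph) / r, 2^-1 * J5 / c = expR ph / (2 * r) * J5
    & lift_t K (2^-1 * J5) T b c f fb = (8 * r ^+ 3)^-1 *
       (2 * expR ph * fb * J5 + r * (J52 + 2 * J4) - 4 * expR (- ph) * f * K)].
Proof.
move=> r0 b c T; have rN : r != 0 by rewrite gt_eqF.
have eN : expR ph != 0 by rewrite gt_eqF ?expR_gt0.
have eV : expR (- ph) = (expR ph)^-1 by rewrite expRN.
have e3 : expR (3 * ph) = expR ph ^+ 3 by rewrite expRM_natl.
have e3V : expR (- 3 * ph) = (expR ph)^-1 ^+ 3 by rewrite mulNr expRN e3 exprVn.
rewrite /lift_t /T /b /c e3V e3 eV; move: (expR ph) eN => e eN.
by split; field; rewrite ?rN ?eN.
Qed.

Lemma xT_eq q : E xT q = 8^-1 * (E xJ52 q + 2 * E xJ4 q).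
Proof.
have -> : xT = mu (Qc 1 8) (ad xJ52 (mu (Qc 2 1) xJ4)) by vm_compute.
apply: etrans (evq_mu _ _ _) _; congr (_ * _); first by rewrite /evq /= div1r.
apply: etrans (evq_ad _ _ _) _; congr (_ + _).
by apply: etrans (evq_mu _ _ _) _; congr (_ * _); rewrite /evq /= divr1.
Qed.

Lemma bundle_EDS K4 K5 K52 u : I3_derivatives M F H K4 K5 K52 -> G9 M u ->
  paraCR_EDS F H K4 K5 K52 bundle_connection u.
Proof.
move=> HK Gu; have [Mq r0] := Gu.
have [E4 E5 E52] := I3_derivatives_unique hMFH HK Mq.
have := bundle_structure Gu; cbv zeta; rewrite xT_eq -E4 -E5 -E52.
have [c1 c2 c3 c4 c5] := bundle_coefficients (f2 u) (fbar2 u) (phi u)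
  (K4 (base u)) (K5 (base u)) (K52 (base u)) (I3 F H (base u)) r0.
rewrite /scale_b /scale_c c4 c5.
rewrite [I1 _ _ _ / _]mulrC [I2 _ _ _ / _]mulrC [I3 _ _ _ / _]mulrC c1 c2 c3.
have omE i : row i (bundle_connection u) = (bundle_forms u)`_i by rewrite row_mx_of_rows.
rewrite /paraCR_EDS /structure_eqs !omE.
exact.
Qed.

Lemma smooth_bundle_connection : smooth (G9 M) bundle_connection.
Proof.
have bM x : G9 M x -> M (base x) by case.
have cmp e : smooth (G9 M) (fun x => E e (base x)).
  exact: (smooth_comp oG (smooth_base oG) bM (smooth_ev hMFH e)).
have sI3 : smooth (G9 M) (fun x => I3 F H (base x)).
  by apply: (eq_on_smooth oG) (cmp xI3) => x Gx; rewrite (I3_eq hMFH) //; exact: bM.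
have sv k : smooth (G9 M) (basev k).
  apply: (smooth_mulmx oG); last exact: smooth_cst.
  exact: (smooth_comp_mx oG (smooth_base oG) bM oM (smooth_form hMFH (vk k))).
have sw k : smooth (G9 M) (basew k).
  apply/(smooth_mx oG) => i j.
  have sW : smooth (G9 M) (fun x => omega_hat F H (base x) *m proj).
    apply: (smooth_mulmx oG); last exact: smooth_cst.
    exact: (smooth_comp_mx oG (smooth_base oG) bM oM (smooth_omega_hat hMFH)).
  have /(smooth_mx oG)/(_ k j) := sW; apply: (eq_on_smooth oG) => x _.
  by rewrite [RHS]mxE.
have sf : smooth (G9 M) (@f2 R) := smooth_coord oG 7.
have sfb : smooth (G9 M) (@fbar2 R) := smooth_coord oG 8.
have sr : smooth (G9 M) (@rho R) := smooth_coord oG 5.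
have sp : smooth (G9 M) (@phi R) := smooth_coord oG 6.
have sb : smooth (G9 M) scale_b by apply: (smoothM oG) => //; exact: smooth_expR.
have sc : smooth (G9 M) scale_c.
  by apply: (smoothM oG) => //; apply: (smooth_expR oG); exact: smoothN.
have r0 x : G9 M x -> rho x != 0 by case=> _ r0; rewrite gt_eqF.
have b0 x : G9 M x -> scale_b x != 0.
  by move=> Gx; rewrite /scale_b mulf_neq0 ?r0 // gt_eqF ?expR_gt0.
have c0 x : G9 M x -> scale_c x != 0.
  by move=> Gx; rewrite /scale_c mulf_neq0 ?r0 // gt_eqF ?expR_gt0.
have sbV := smoothV oG b0 sb; have scV := smoothV oG c0 sc; have srV := smoothV oG r0 sr.
have bc0 x : G9 M x -> scale_b x * scale_c x != 0 by move=> Gx; rewrite mulf_neq0 ?b0 ?c0.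
have sbcV := smoothV oG bc0 (smoothM oG sb sc).
have kV (a : R) g : a != 0 -> (forall x, G9 M x -> g x != 0) -> smooth (G9 M) g ->
    smooth (G9 M) (fun x => (a * g x)^-1).
  move=> a0 g0 sg; apply: (smoothV oG); last exact: (smoothM oG (smooth_cst a) sg).
  by move=> x Gx; rewrite mulf_neq0 ?g0.
have s2b := kV 2 _ (lt0r_neq0 (ltr0n R 2)) b0 sb.
have s2c := kV 2 _ (lt0r_neq0 (ltr0n R 2)) c0 sc.
have s4b := kV 4 _ (lt0r_neq0 (ltr0n R 4)) b0 sb.
have s4c := kV 4 _ (lt0r_neq0 (ltr0n R 4)) c0 sc.
have s2bc := kV 2 _ (lt0r_neq0 (ltr0n R 2)) bc0 (smoothM oG sb sc).
have s2bbc : smooth (G9 M) (fun x => (2 * scale_b x * (scale_b x * scale_c x))^-1).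
  apply: (smoothV oG) => [x Gx|]; first by rewrite mulf_neq0 ?bc0 // mulf_neq0 ?b0 ?pnatr_eq0.
  by apply: (smoothM oG); apply: (smoothM oG) => //; exact: smooth_cst.
have s2cbc : smooth (G9 M) (fun x => (2 * scale_c x * (scale_b x * scale_c x))^-1).
  apply: (smoothV oG) => [x Gx|]; first by rewrite mulf_neq0 ?bc0 // mulf_neq0 ?c0 ?pnatr_eq0.
  by apply: (smoothM oG); apply: (smoothM oG) => //; exact: smooth_cst.
have sJ := cmp xJ5; have sT := cmp xT.
have row_smooth k : smooth (G9 M) (fun x => (bundle_forms x)`_k).
  case: k => [|[|[|[|k]]]]; last first.
    by apply: (eq_on_smooth oG) (smooth_cst (0 : 'rV[R]_9)) => x _ /=; rewrite nth_nil.
  all: rewrite /bundle_forms; cbn [nth].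
  all: rewrite /lift_v1 /lift_v2 /lift_v3 /lift_v4 /lift_nu /lift_ka /lift_mu /lift_t /dlog_b /dlog_c.
  all: (repeat first
    [ exact: sv | exact: sw | assumption | exact: smooth_cst
    | apply: (smooth_mxD oG) | apply: (smooth_mxN oG) | apply: (smooth_mxZ oG)
    | apply: (smoothD oG) | apply: (smoothN oG) | apply: (smoothM oG) | apply: (smoothX oG) ]).
apply/(smooth_mx oG) => i j; have /(smooth_mx oG)/(_ 0 j) := row_smooth i.
by apply: (eq_on_smooth oG) => x _; rewrite [RHS]mxE.
Qed.

Definition fiber_cols : 'M[R]_(9, 4) := (col_mx 0 1%:M : 'M[R]_(5 + 4, 4)).

Lemma proj_fiber : proj *m fiber_cols = 0.
Proof.
apply: etrans (mul_row_col (1%:M : 'M[R]_5) (0 : 'M[R]_(5, 4)) 0 1%:M) _.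
by rewrite mulmx0 mul0mx addr0.
Qed.

Lemma proj_base_cols : proj *m (col_mx 1%:M 0 : 'M[R]_(5 + 4, 5)) = 1%:M.
Proof.
apply: etrans (mul_row_col (1%:M : 'M[R]_5) (0 : 'M[R]_(5, 4)) 1%:M 0) _.
by rewrite mulmx1 mulmx0 addr0.
Qed.

Lemma dcoord_fiber (j : 'I_4) (k : 'I_9) : k = (5 + j)%N :> nat ->
  dcoord k *m fiber_cols = delta_mx 0 j :> 'rV[R]_4.
Proof.
move=> kE; have -> : k = rshift 5 j by apply: val_inj.
rewrite /dcoord -rowE.
apply: etrans (rowKd j (0 : 'M[R]_(5, 4)) (1%:M : 'M[R]_4)) _.
by rewrite row1.
Qed.

(** The base forms kill the fibre directions, on which [bundle_forms] restricts to
    the Maurer-Cartan forms of the structure group, and the coframe is independent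
    along the base. *)
Lemma row_free_bundle u : G9 M u -> row_free (col_mx (theta F H u) (bundle_connection u)).
Proof.
move=> Gu; have [Mq r0] := Gu; have rN : rho u != 0 by rewrite gt_eqF.
have bN : scale_b u != 0 by rewrite mulf_neq0 ?gt_eqF ?expR_gt0.
have cN : scale_c u != 0 by rewrite mulf_neq0 ?gt_eqF ?expR_gt0.
apply: inj_row_free => x; rewrite -[x]hsubmxK mul_row_col.
move: (lsubmx x) (rsubmx x) => {x} a b; rewrite theta_lift // mulmxA => E0.
have wz k : basew k u *m fiber_cols = 0 by rewrite /basew row_mul -mulmxA proj_fiber mulmx0.
have vz k : basev k u *m fiber_cols = 0 by rewrite /basev -mulmxA proj_fiber mulmx0.
have d5 := @dcoord_fiber 0 5 erefl; have d6 := @dcoord_fiber 1 6 erefl.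
have d7 := @dcoord_fiber 2 7 erefl; have d8 := @dcoord_fiber 3 8 erefl.
have bE : b *m (bundle_connection u *m fiber_cols) = 0.
  have := congr1 (fun y => y *m fiber_cols) E0.
  by rewrite mulmxDl mul0mx -!mulmxA proj_fiber !mulmx0 add0r.
have bl : dlog_b u *m fiber_cols = (rho u)^-1 *: delta_mx 0 0 + delta_mx 0 1.
  by rewrite mulmxDl -scalemxAl d5 d6.
have cl : dlog_c u *m fiber_cols = (rho u)^-1 *: delta_mx 0 0 - delta_mx 0 1.
  by rewrite mulmxBl -scalemxAl d5 d6.
have bc0 : (scale_b u * scale_c u)^-1 != 0 := invr_neq0 (mulf_neq0 bN cN).
have b0 : b = 0.
  apply: (@fiber_rows_free _ (rho u) _ (f2 u) (fbar2 u)) rN bc0 _.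
  have [r1 r2 r3 r4] := @lift_connection_fiber _ _ _ _ _ _ _ _ _ _ _ _ (I3 F H (base u))
    (2^-1 * E xJ5 (base u)) (E xT (base u)) (scale_b u) (scale_c u) (f2 u) (fbar2 u)
    (dlog_b u) (dlog_c u) (dcoord 7) (dcoord 8) fiber_cols
    (wz 0) (wz 1) (wz 2) (wz 3) (wz 4) (vz 0%N) (vz 1%N) (vz 2%N) (vz 3%N).
  rewrite bl cl d7 d8 in r1 r2 r3 r4; rewrite -r1 -r2 -r3 -r4 -[RHS]bE.
  have rE k : row k (bundle_connection u *m fiber_cols) = (bundle_forms u)`_k *m fiber_cols.
    by rewrite row_mul row_mx_of_rows.
  rewrite [RHS]mulmx_sum_row !big_ord_recl big_ord0 addr0 !rE /bundle_forms.
  rewrite -!addrA; congr (_ + (_ + (_ + _))); congr (_ *: _); congr (b 0 _); exact: val_inj.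
have Lu : lift_mx (scale_b u) (scale_c u) (f2 u) (fbar2 u) *m omega_hat F H (base u)
    \in unitmx by rewrite unitmx_mul lift_mx_unit // (omega_hat_unit hMFH Mq).
have aE : a *m (lift_mx (scale_b u) (scale_c u) (f2 u) (fbar2 u)
    *m omega_hat F H (base u)) = 0.
  rewrite -[LHS]mulmx1 -proj_base_cols mulmxA.
  move: E0; rewrite b0 mul0mx addr0 !mulmxA => ->; exact: mul0mx.
by rewrite b0 -[a](mulmxK Lu) aE mul0mx row_mx0.
Qed.

End Bundle.

(** * Comparison of adapted coframes *)

Section Comparison.
Context {R : realType}.
Implicit Types (v x y : 'rV[R]_5).
Variable W : 'M[R]_5.
Hypothesis Wu : W \in unitmx.
Local Notation w i := (row i W).
Local Notation P := (invmx W).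

(** Two-forms are compared entrywise in the basis of the rows of [W], where the coframe
    has constant components. *)
Definition entry (X : 'M[R]_5) j k := (P^T *m X *m P) j k.

Lemma entryD X Y j k : entry (X + Y) j k = entry X j k + entry Y j k.
Proof. by rewrite /entry mulmxDr mulmxDl mxE. Qed.

Lemma entryN X j k : entry (- X) j k = - entry X j k.
Proof. by rewrite /entry mulmxN mulNmx mxE. Qed.

Lemma entryZ a X j k : entry (a *: X) j k = a * entry X j k.
Proof. by rewrite /entry -scalemxAr -scalemxAl mxE. Qed.

Lemma entry_wedge x y j k :
  entry (x \wedge y) j k = (x *m P) 0 j * (y *m P) 0 k - (y *m P) 0 j * (x *m P) 0 k.
Proof. by rewrite /entry mulmx_wedge wedgeE. Qed.

Lemma comp_row i j : (w i *m P) 0 j = (j == i)%:R.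
Proof. by rewrite row_unit_invmx // mxE eqxx. Qed.

Lemma compD x y j : ((x + y) *m P) 0 j = (x *m P) 0 j + (y *m P) 0 j.
Proof. by rewrite mulmxDl mxE. Qed.

Lemma compN x j : (- x *m P) 0 j = - (x *m P) 0 j.
Proof. by rewrite mulNmx mxE. Qed.

Lemma compZ a x j : (a *: x *m P) 0 j = a * (x *m P) 0 j.
Proof. by rewrite -scalemxAl mxE. Qed.

Let entry_eq j k X Y : X = Y -> entry X j k = entry Y j k. Proof. by move->. Qed.

Lemma comp0 j : ((0 : 'rV[R]_5) *m P) 0 j = 0.
Proof. by rewrite mul0mx mxE. Qed.

Let zeroE := (@mulr0 R, @mul0r R, @mulr1 R, @mul1r R, @addr0 R, @add0r R, @subr0 R, @sub0r R,
  @oppr0 R).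
Let simpE := (comp0, entryD, entryN, entryZ, entry_wedge, comp_row, compD, compN, compZ).

(** Modulo [w1], the derivative of the first form is [f] times the product of [w2] and
    [w4], and it is the product of the new second and fourth forms. *)
Lemma compare_dw1 f b e c e' s u df v1 v1' : f != 0 ->
  let w2 := s *: w 0 + b *: w 1 + e *: w 2 in
  let w4 := u *: w 0 + c *: w 3 + e' *: w 4 in
  - ((f *: w 0) \wedge v1') + w2 \wedge w4
    = df \wedge w 0 + f *: (- (w 0 \wedge v1) + w 1 \wedge w 3) ->
  [/\ f = b * c, b != 0, c != 0, e = 0 & e' = 0].
Proof.
move=> f0 w2 w4 E.
have E13 := congr1 (fun X => entry X 1 3) E.
have E14 := congr1 (fun X => entry X 1 4) E.
have E23 := congr1 (fun X => entry X 2 3) E.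
move: E13 E14 E23; rewrite /w2 /w4 !simpE /=.
rewrite !zeroE.
move=> fE be ec; move: f0; rewrite -fE mulf_eq0 negb_or => /andP[b0 c0].
split=> //; apply/eqP.
  by move/eqP: ec; rewrite mulf_eq0 (negPf c0) orbF.
by move/eqP: be; rewrite mulf_eq0 (negPf b0).
Qed.

Lemma compare_dw2 f s b l k a u c x y y' ds db v v' : 
  (s *: w 0 + b *: w 1) \wedge y' - (f *: w 0) \wedge v'
    + (l *: w 0 + k *: w 1 + a *: w 2) \wedge (u *: w 0 + c *: w 3)
  = ds \wedge w 0 + s *: (- (w 0 \wedge x) + w 1 \wedge w 3)
    + (db \wedge w 1 + b *: (w 1 \wedge y - w 0 \wedge v + w 2 \wedge w 3)) ->
  a * c = b.
Proof.
move=> /(congr1 (fun X => entry X 2 3)); rewrite !simpE /=.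
by rewrite !zeroE.
Qed.

Lemma compare_dw4 f s b n m a u c x y y' du dc v v' : 
  - ((s *: w 0 + b *: w 1) \wedge (n *: w 0 + m *: w 3 + a *: w 4))
    - (u *: w 0 + c *: w 3) \wedge y' - (f *: w 0) \wedge v'
  = du \wedge w 0 + u *: (- (w 0 \wedge x) + w 1 \wedge w 3)
    + (dc \wedge w 3 + c *: (- (w 1 \wedge w 4) - w 3 \wedge y - w 0 \wedge v)) ->
  b * a = c.
Proof.
move=> /(congr1 (fun X => entry X 1 4)); rewrite !simpE /=.
rewrite !zeroE.
by rewrite mulrN1; exact: oppr_inj.
Qed.

(** The remaining change of coframe adds multiples of [w2], [w1] to [w3] and of [w4],
    [w1] to [w5]. Each multiple enters one structure equation directly and another
    through the change it forces on a connection form, with different factors. *)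
Section Unipotent.
Variables (dw1 dw2 dw3 dw4 dw5 : 'M[R]_5) (v1 v2 v3 v4 v1' v2' v3' v4' dk dl dm dn : 'rV[R]_5).
Variables (i1 i2 i3 q t i1' i2' i3' q' t' k l m n : R).
Hypothesis eqs : structure_eqs (w 0) (w 1) (w 2) (w 3) (w 4) dw1 dw2 dw3 dw4 dw5
  v1 v2 v3 v4 i1 i2 i3 q t.
Hypothesis eqs' : structure_eqs (w 0) (w 1) (w 2 + k *: w 1 + l *: w 0) (w 3)
  (w 4 + m *: w 3 + n *: w 0)
  dw1 dw2 (dw3 + (dk \wedge w 1 + k *: dw2) + (dl \wedge w 0 + l *: dw1))
  dw4 (dw5 + (dm \wedge w 3 + m *: dw4) + (dn \wedge w 0 + n *: dw1))
  v1' v2' v3' v4' i1' i2' i3' q' t'.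

(** The second equation changes the component of the second connection form along [w4]
    by [- k], while the third changes its double by [k]; likewise for [m]. *)
Lemma unipotent_order1 : k = 0 /\ m = 0.
Proof.
case: eqs' => + + + + +; case: eqs => -> -> -> -> -> E1 E2 E3 E4 E5.
have := entry_eq 0 1 E1; rewrite !simpE /= ?zeroE => E1_2.
have := entry_eq 0 3 E1; rewrite !simpE /= ?zeroE => E1_4.
have := entry_eq 1 3 E2; rewrite !simpE /= ?zeroE => E2_24.
have := entry_eq 1 3 E4; rewrite !simpE /= ?zeroE => E4_24.
have := entry_eq 2 3 E3; rewrite !simpE /= ?zeroE => E3_34.
have := entry_eq 1 4 E5; rewrite !simpE /= ?zeroE => E5_25.
by split; lra.
Qed.

(** The second equation changes the component of the third connection form along [w4]
    by [l], and the third by [- l]; likewise for [n]. *)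
Lemma unipotent_order2 : k = 0 -> m = 0 -> dk = 0 -> dm = 0 -> l = 0 /\ n = 0.
Proof.
move=> k0 m0 dk0 dm0; case: eqs' => + + + + +; case: eqs => -> -> -> -> ->.
rewrite k0 m0 dk0 dm0 => E1 E2 E3 E4 E5.
have := entry_eq 0 3 E2; rewrite !simpE /= ?zeroE => E2_14.
have := entry_eq 0 1 E4; rewrite !simpE /= ?zeroE => E4_12.
have := entry_eq 1 3 E3; rewrite !simpE /= ?zeroE => E3_24.
have := entry_eq 1 3 E5; rewrite !simpE /= ?zeroE => E5_24.
by split; lra.
Qed.

End Unipotent.

(** The connection forms are not unique, but the first, second and fourth equations
    determine their components that occur next to [i1], [i2], [i3]. *)
Lemma torsion_unique dw1 dw2 dw3 dw4 dw5 v1 v2 v3 v4 v1' v2' v3' v4'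
    i1 i2 i3 q t i1' i2' i3' q' t' :
  structure_eqs (w 0) (w 1) (w 2) (w 3) (w 4) dw1 dw2 dw3 dw4 dw5
    v1 v2 v3 v4 i1 i2 i3 q t ->
  structure_eqs (w 0) (w 1) (w 2) (w 3) (w 4) dw1 dw2 dw3 dw4 dw5
    v1' v2' v3' v4' i1' i2' i3' q' t' ->
  [/\ i1 = i1', i2 = i2' & i3 = i3'].
Proof.
move=> [-> -> -> -> ->] [E1 E2 E3 E4 E5].
have := entry_eq 0 1 E1; rewrite !simpE /= ?zeroE => E1_2.
have := entry_eq 0 2 E2; rewrite !simpE /= ?zeroE => E2_13.
have := entry_eq 1 3 E4; rewrite !simpE /= ?zeroE => E4_24.
have := entry_eq 0 3 E3; rewrite !simpE /= ?zeroE => E3_14.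
have := entry_eq 1 2 E3; rewrite !simpE /= ?zeroE => E3_23.
have := entry_eq 0 1 E5; rewrite !simpE /= ?zeroE => E5_12.
by split; lra.
Qed.

End Comparison.

Lemma smooth_div {R : realType} {n : nat} {U : set 'rV[R]_n.+1} (oU : open U)
    (f g : 'rV[R]_n.+1 -> R) :
  smooth U f -> smooth U g -> (forall x, U x -> g x != 0) -> smooth U (fun x => f x / g x).
Proof. by move=> sf sg g0; apply: (smoothM oU sf); exact: (smoothV oU g0). Qed.

Section AdaptedCoframes.
Context {R : realType}.
Implicit Types (W A : 'rV[R]_5 -> 'M[R]_5).

(** The connection forms and the last two torsion coefficients are left existential,
    since only [i1], [i2], [i3] are to be compared. *)
Definition adapted_coframe (U : set 'rV[R]_5) W (i1 i2 i3 : 'rV[R]_5 -> R) : Prop :=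
  smooth U W /\ forall q, U q -> W q \in unitmx /\
    let w i := row i (W q) in let dw i := dform (fun x => row i (W x)) q in
    exists v1 v2 v3 v4 k t,
      structure_eqs (w 0) (w 1) (w 2) (w 3) (w 4) (dw 0) (dw 1) (dw 2) (dw 3) (dw 4)
        v1 v2 v3 v4 (i1 q) (i2 q) (i3 q) k t.

Lemma row_mulmx5 (A W : 'M[R]_5) i : row i (A *m W) =
  A i 0 *: row 0 W + A i 1 *: row 1 W + A i 2 *: row 2 W + A i 3 *: row 3 W
  + A i 4 *: row 4 W.
Proof.
rewrite row_mul mulmx_sum_row sum_ord5 !addrA.
by do ![congr (_ + _)]; rewrite mxE.
Qed.

Lemma lift_mx_rows b c s u (W : 'M[R]_5) :
  let L := lift_mx b c s u in
  [/\ row 0 (L *m W) = (b * c) *: row 0 W,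
      row 1 (L *m W) = s *: row 0 W + b *: row 1 W,
      row 2 (L *m W) = (s ^+ 2 / (2 * (b * c))) *: row 0 W + (s / c) *: row 1 W
        + (b / c) *: row 2 W,
      row 3 (L *m W) = u *: row 0 W + c *: row 3 W
    & row 4 (L *m W) = - (u ^+ 2 / (2 * (b * c))) *: row 0 W + - (u / b) *: row 3 W
        + (c / b) *: row 4 W].
Proof.
rewrite /= !row_mulmx5; split; rewrite ?[lift_mx _ _ _ _ _ _]mxE /=.
all: by rewrite ?(scale0r, addr0, add0r).
Qed.

Lemma paraCR_rows (A W : 'M[R]_5) : paraCR_matrix A ->
  [/\ A 0 0 != 0, row 0 (A *m W) = A 0 0 *: row 0 W,
      forall i : 'I_5, (i == 1) || (i == 2) ->
        row i (A *m W) = A i 0 *: row 0 W + A i 1 *: row 1 W + A i 2 *: row 2 W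
    & forall i : 'I_5, (i == 3) || (i == 4) ->
        row i (A *m W) = A i 0 *: row 0 W + A i 3 *: row 3 W + A i 4 *: row 4 W].
Proof.
move=> [Au A0].
have z i j : ~~ paraCR_entry (nat_of_ord i) (nat_of_ord j) -> A i j = 0 by exact: A0.
split.
- apply/negP => /eqP a0.
  have r0 : row 0 A = 0.
    apply/rowP => j; rewrite mxE [RHS]mxE; have [->//|j0] := eqVneq j 0.
    by apply: z; move: j0; rewrite -val_eqE; case: j => -[].
  have := congr1 (fun x : 'rV[R]_5 => x 0 0) (row_unit_invmx 0 Au).
  by rewrite r0 mul0mx !mxE /= => /eqP; rewrite eq_sym oner_eq0.
- by rewrite row_mulmx5 (z 0 1) // (z 0 2) // (z 0 3) // (z 0 4) // !scale0r !addr0.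
- move=> i i12; rewrite row_mulmx5 (z i 3) ?(z i 4) ?scale0r ?addr0 //.
    by case/orP: i12 => /eqP ->.
  by case/orP: i12 => /eqP ->.
- move=> i i34; rewrite row_mulmx5 (z i 1) ?(z i 2) ?scale0r ?addr0 //.
    by case/orP: i34 => /eqP ->.
  by case/orP: i34 => /eqP ->.
Qed.

Lemma smooth_row U W i : open U -> smooth U W -> smooth U (fun x => row i (W x)).
Proof.
move=> oU /(smooth_mx oU) sW; apply/(smooth_mx oU) => k j.
by apply: (eq_on_smooth oU) (sW i j) => x _; rewrite mxE.
Qed.

(** Two coframes of the same para-CR structure, both adapted. Equations between the
    entries of [A] hold on all of [U], so they may be differentiated. *)
Section Change.
Variables (U : set 'rV[R]_5) (W A : 'rV[R]_5 -> 'M[R]_5).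
Variables (i1 i2 i3 j1 j2 j3 : 'rV[R]_5 -> R).
Hypotheses (oU : open U) (sA : smooth U A).
Hypothesis crA : forall x, U x -> paraCR_matrix (A x).
Hypothesis adW : adapted_coframe U W i1 i2 i3.
Hypothesis adW' : adapted_coframe U (fun x => A x *m W x) j1 j2 j3.
Local Notation w i := (fun x => row i (W x)).
Local Notation w' i := (fun x => row i (A x *m W x)).
Local Notation dw i := (dform (fun x => row i (W x))).
Local Notation dw' i := (dform (fun x => row i (A x *m W x))).
Local Notation a i j := (fun x => A x i j).

Let sa i j : smooth U (a i j). Proof. exact: (smooth_mx oU A).1 sA i j. Qed.
Let da i j q : U q -> differentiable (a i j) q.
Proof. by move=> Uq; exact: smooth_differentiable (sa i j) Uq. Qed.
Let dfw i q : U q -> differentiable (w i) q.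
Proof. by move=> Uq; exact: smooth_differentiable (smooth_row i oU adW.1) Uq. Qed.

Let dform2 (f g : 'rV[R]_5 -> R) (x y : 'rV[R]_5 -> 'rV[R]_5) q :
  differentiable f q -> differentiable g q -> differentiable x q -> differentiable y q ->
  dform (fun p => f p *: x p + g p *: y p) q =
    dfun f q \wedge x q + f q *: dform x q + (dfun g q \wedge y q + g q *: dform y q).
Proof.
move=> df dg dx dy; rewrite dformD; [|exact: differentiable_scale|exact: differentiable_scale].
by rewrite !dformZ.
Qed.

Lemma change_block_diagonal x : U x ->
  [/\ A x 0 0 = A x 1 1 * A x 3 3, A x 1 1 != 0, A x 3 3 != 0, A x 1 2 = 0 & A x 3 4 = 0].
Proof.
move=> Ux; have [Wu [v1 [v2 [v3 [v4 [k [t [E1 _ _ _ _]]]]]]]] := adW.2 x Ux.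
have [_ [v1' [v2' [v3' [v4' [k' [t' [E1' _ _ _ _]]]]]]]] := adW'.2 x Ux.
have [f0 r0 r12 r34] := paraCR_rows (W x) (crA Ux).
have r1 := r12 1 isT; have r3 := r34 3 isT.
have d0 : dw' 0 x = dfun (a 0 0) x \wedge w 0 x + A x 0 0 *: dw 0 x.
  rewrite -(dformZ (da 0 0 Ux) (dfw 0 Ux)); apply: (eq_on_dform oU Ux) => y Uy.
  by have [] := paraCR_rows (W y) (crA Uy).
apply: (compare_dw1 Wu f0 (v1 := v1) (v1' := v1') (df := dfun (a 0 0) x)
  (s := A x 1 0) (u := A x 3 0)).
by rewrite -r0 -r1 -r3 -E1 -d0 E1'.
Qed.
Lemma change_rows x : U x ->
  [/\ w' 0 x = A x 0 0 *: w 0 x,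
      w' 1 x = A x 1 0 *: w 0 x + A x 1 1 *: w 1 x,
      w' 2 x = A x 2 0 *: w 0 x + A x 2 1 *: w 1 x + A x 2 2 *: w 2 x,
      w' 3 x = A x 3 0 *: w 0 x + A x 3 3 *: w 3 x
    & w' 4 x = A x 4 0 *: w 0 x + A x 4 3 *: w 3 x + A x 4 4 *: w 4 x].
Proof.
move=> Ux; have [_ _ _ e0 e0'] := change_block_diagonal Ux.
have [_ r0 r12 r34] := paraCR_rows (W x) (crA Ux).
split=> //.
- by rewrite (r12 1 isT) e0 scale0r addr0.
- exact: r12 2 isT.
- by rewrite (r34 3 isT) e0' scale0r addr0.
- exact: r34 4 isT.
Qed.

Lemma change_scales x : U x ->
  A x 2 2 = A x 1 1 / A x 3 3 /\ A x 4 4 = A x 3 3 / A x 1 1.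
Proof.
move=> Ux; have [Wu [v1 [v2 [v3 [v4 [k [t [E1 E2 _ E4 _]]]]]]]] := adW.2 x Ux.
have [_ [v1' [v2' [v3' [v4' [k' [t' [_ E2' _ E4' _]]]]]]]] := adW'.2 x Ux.
have [_ b0 c0 _ _] := change_block_diagonal Ux.
have [r0 r1 r2 r3 r4] := change_rows Ux.
have d1 : dw' 1 x = dfun (a 1 0) x \wedge w 0 x + A x 1 0 *: dw 0 x
    + (dfun (a 1 1) x \wedge w 1 x + A x 1 1 *: dw 1 x).
  rewrite -(dform2 (da 1 0 Ux) (da 1 1 Ux) (dfw 0 Ux) (dfw 1 Ux)).
  by apply: (eq_on_dform oU Ux) => y Uy; have [] := change_rows Uy.
have d3 : dw' 3 x = dfun (a 3 0) x \wedge w 0 x + A x 3 0 *: dw 0 x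
    + (dfun (a 3 3) x \wedge w 3 x + A x 3 3 *: dw 3 x).
  rewrite -(dform2 (da 3 0 Ux) (da 3 3 Ux) (dfw 0 Ux) (dfw 3 Ux)).
  by apply: (eq_on_dform oU Ux) => y Uy; have [] := change_rows Uy.
split.
  apply: (mulIf c0); rewrite divfK //.
  move: E2'; rewrite r0 r1 r2 r3 d1 E1 E2 => /esym; exact: (compare_dw2 Wu).
apply: (mulIf b0); rewrite divfK // mulrC.
move: E4'; rewrite r0 r1 r3 r4 d3 E1 E4 => /esym; exact: (compare_dw4 Wu).
Qed.

Local Notation b x := (A x 1 1).
Local Notation c x := (A x 3 3).
Local Notation s x := (A x 1 0).
Local Notation u x := (A x 3 0).
Definition lifted x : 'M[R]_5 := lift_mx (b x) (c x) (s x) (u x) *m W x.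

(** What is left of the third and fifth rows of [A] once [lift_mx] is divided out. *)
Definition remainder_k x : R := (A x 2 1 - s x / c x) / b x.
Definition remainder_l x : R :=
  (A x 2 0 - s x ^+ 2 / (2 * (b x * c x)) - remainder_k x * s x) / (b x * c x).
Definition remainder_m x : R := (A x 4 3 + u x / b x) / c x.
Definition remainder_n x : R :=
  (A x 4 0 + u x ^+ 2 / (2 * (b x * c x)) - remainder_m x * u x) / (b x * c x).

Lemma lifted_rows x : U x ->
  [/\ w' 0 x = row 0 (lifted x), w' 1 x = row 1 (lifted x),
      w' 2 x = row 2 (lifted x) + remainder_k x *: row 1 (lifted x) + remainder_l x *: row 0 (lifted x),
      w' 3 x = row 3 (lifted x)
    & w' 4 x = row 4 (lifted x) + remainder_m x *: row 3 (lifted x) + remainder_n x *: row 0 (lifted x)].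
Proof.
move=> Ux; have [f0 b0 c0 _ _] := change_block_diagonal Ux.
have [-> -> -> -> ->] := change_rows Ux; have [-> ->] := change_scales Ux.
have [-> -> -> -> ->] := lift_mx_rows (b x) (c x) (s x) (u x) (W x).
rewrite f0 /remainder_n /remainder_l /remainder_m /remainder_k.
move: (row 0 (W x)) (row 1 (W x)) (row 2 (W x)) (row 3 (W x)) (row 4 (W x)).
move: (b x) (c x) (s x) (u x) (A x 2 0) (A x 2 1) (A x 4 0) (A x 4 3) b0 c0.
move=> b c s u l k n m b0 c0 w0 w1 w2 w3 w4.
split=> //; apply/rowP => j; rewrite !mxE; field; by rewrite b0 c0.
Qed.
Let b0 x : U x -> b x != 0. Proof. by move=> Ux; have [] := change_block_diagonal Ux. Qed.
Let c0 x : U x -> c x != 0. Proof. by move=> Ux; have [] := change_block_diagonal Ux. Qed.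

Lemma adapted_lifted :
  adapted_coframe U lifted (fun x => i1 x / c x ^+ 3) (fun x => i2 x / b x ^+ 3)
    (fun x => i3 x / b x).
Proof.
have sW := adW.1; have bc0 x : U x -> 2 * (b x * c x) != 0.
  by move=> Ux; rewrite mulf_neq0 ?mulf_neq0 ?b0 ?c0.
have s0 : smooth U (fun=> 0 : R) by exact: smooth_cst.
have s2bc : smooth U (fun x => 2 * (b x * c x)).
  by apply: (smoothM oU); [exact: smooth_cst|exact: (smoothM oU)].
split.
  apply: (smooth_mulmx oU) sW; apply/(smooth_mx oU) => i j.
  apply: (eq_on_smooth oU (f := fun x => (nth [::]
    [:: [:: b x * c x; 0; 0; 0; 0];
        [:: s x; b x; 0; 0; 0];
        [:: s x ^+ 2 / (2 * (b x * c x)); s x / c x; b x / c x; 0; 0];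
        [:: u x; 0; 0; c x; 0];
        [:: - (u x ^+ 2 / (2 * (b x * c x))); 0; 0; - (u x / b x); c x / b x]] i)`_j)).
    by move=> x _; rewrite mxE.
  case: i => -[|[|[|[|[|//]]]]] ?; case: j => -[|[|[|[|[|//]]]]] ? //=.
  all: repeat first [exact: s0 | exact: sa | exact: s2bc | exact: bc0 | exact: b0 | exact: c0
    | apply: (smoothN oU) | apply: (smooth_div oU) | apply: (smoothM oU) | apply: (smoothX oU)].
move=> x Ux; have [Wu [v1 [v2 [v3 [v4 [k [t eqs]]]]]]] := adW.2 x Ux.
split; first by rewrite unitmx_mul lift_mx_unit ?b0 ?c0.
have := structure_lift_mx (b0 Ux) (c0 Ux) (da 1 1 Ux) (da 3 3 Ux) (da 1 0 Ux) (da 3 0 Ux)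
  (smooth_differentiable sW Ux) eqs.
by move=> eqs'; do 6!eexists; exact: eqs'.
Qed.

Let dl i q : U q -> differentiable (fun x => row i (lifted x)) q.
Proof.
by move=> Uq; exact: smooth_differentiable (smooth_row i oU adapted_lifted.1) Uq.
Qed.

Let smooth_rest : [/\ smooth U remainder_k, smooth U remainder_l, smooth U remainder_m & smooth U remainder_n].
Proof.
have bc0 x : U x -> b x * c x != 0 by move=> Ux; rewrite mulf_neq0 ?b0 ?c0.
have bc02 x : U x -> 2 * (b x * c x) != 0 by move=> Ux; rewrite mulf_neq0 ?bc0.
have sk : smooth U remainder_k.
  by apply: (smooth_div oU) b0 => //; apply: (smoothB oU) => //; exact: (smooth_div oU) c0.
have sm : smooth U remainder_m.
  by apply: (smooth_div oU) c0 => //; apply: (smoothD oU) => //; exact: (smooth_div oU) b0.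
have sbc : smooth U (fun x => b x * c x) by exact: (smoothM oU).
have s2bc : smooth U (fun x => 2 * (b x * c x)).
  by apply: (smoothM oU) => //; exact: smooth_cst.
split=> //; apply: (smooth_div oU) bc0 => //; apply: (smoothB oU); try exact: (smoothM oU).
  by apply: (smoothB oU) => //; apply: (smooth_div oU) bc02 => //; exact: (smoothX oU).
by apply: (smoothD oU) => //; apply: (smooth_div oU) bc02 => //; exact: (smoothX oU).
Qed.

Let dform_rest (f g : 'rV[R]_5 -> R) (x0 x1 x2 : 'rV[R]_5 -> 'rV[R]_5) q :
  differentiable f q -> differentiable g q ->
  differentiable x0 q -> differentiable x1 q -> differentiable x2 q ->
  dform (fun p => x0 p + f p *: x1 p + g p *: x2 p) q =
    dform x0 q + (dfun f q \wedge x1 q + f q *: dform x1 q)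
    + (dfun g q \wedge x2 q + g q *: dform x2 q).
Proof.
move=> df dg d0 d1 d2; have d01 : differentiable (fun p => x0 p + f p *: x1 p) q.
  by apply: differentiableD => //; exact: differentiable_scale.
rewrite (dformD d01 (differentiable_scale dg d2)) dformZ //.
by rewrite (dformD d0 (differentiable_scale df d1)) dformZ.
Qed.

Lemma change_structure x : U x -> exists v1 v2 v3 v4 k t,
  let l i := row i (lifted x) in let dl i := dform (fun y => row i (lifted y)) x in
  structure_eqs (l 0) (l 1) (l 2 + remainder_k x *: l 1 + remainder_l x *: l 0) (l 3)
    (l 4 + remainder_m x *: l 3 + remainder_n x *: l 0)
    (dl 0) (dl 1)
    (dl 2 + (dfun remainder_k x \wedge l 1 + remainder_k x *: dl 1)
      + (dfun remainder_l x \wedge l 0 + remainder_l x *: dl 0))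
    (dl 3)
    (dl 4 + (dfun remainder_m x \wedge l 3 + remainder_m x *: dl 3)
      + (dfun remainder_n x \wedge l 0 + remainder_n x *: dl 0))
    v1 v2 v3 v4 (j1 x) (j2 x) (j3 x) k t.
Proof.
move=> Ux; have [_ [v1 [v2 [v3 [v4 [k [t eqs]]]]]]] := adW'.2 x Ux.
exists v1, v2, v3, v4, k, t => l dl'.
have [sk sl sm sn] := smooth_rest.
have dk := smooth_differentiable sk Ux; have dll := smooth_differentiable sl Ux.
have dm := smooth_differentiable sm Ux; have dn := smooth_differentiable sn Ux.
have [r0 r1 r2 r3 r4] := lifted_rows Ux.
have d i : (forall y, U y -> w' i y = row i (lifted y)) -> dw' i x = dl' i.
  by move=> e; exact: (eq_on_dform oU Ux e).
have d0 : dw' 0 x = dl' 0 by apply: d => y Uy; have [] := lifted_rows Uy.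
have d1 : dw' 1 x = dl' 1 by apply: d => y Uy; have [] := lifted_rows Uy.
have d3 : dw' 3 x = dl' 3 by apply: d => y Uy; have [] := lifted_rows Uy.
have d2 : dw' 2 x = dl' 2 + (dfun remainder_k x \wedge l 1 + remainder_k x *: dl' 1)
    + (dfun remainder_l x \wedge l 0 + remainder_l x *: dl' 0).
  rewrite -(dform_rest dk dll (dl 2 Ux) (dl 1 Ux) (dl 0 Ux)).
  by apply: (eq_on_dform oU Ux) => y Uy; have [] := lifted_rows Uy.
have d4 : dw' 4 x = dl' 4 + (dfun remainder_m x \wedge l 3 + remainder_m x *: dl' 3)
    + (dfun remainder_n x \wedge l 0 + remainder_n x *: dl' 0).
  rewrite -(dform_rest dm dn (dl 4 Ux) (dl 3 Ux) (dl 0 Ux)).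
  by apply: (eq_on_dform oU Ux) => y Uy; have [] := lifted_rows Uy.
by move: eqs; cbv zeta; rewrite r0 r1 r2 r3 r4 d0 d1 d2 d3 d4.
Qed.

Lemma change_rest_km x : U x -> remainder_k x = 0 /\ remainder_m x = 0.
Proof.
move=> Ux; have [Lu [v1 [v2 [v3 [v4 [k [t eqs]]]]]]] := adapted_lifted.2 x Ux.
have [v1' [v2' [v3' [v4' [k' [t' eqs']]]]]] := change_structure Ux.
exact: (unipotent_order1 Lu eqs eqs').
Qed.

Let dfun0 (f : 'rV[R]_5 -> R) x : U x -> (forall y, U y -> f y = 0) -> dfun f x = 0.
Proof.
move=> Ux f0; rewrite (eq_on_dfun oU Ux f0).
by apply/rowP => i; rewrite !mxE partial_cst.
Qed.

Lemma change_rest_ln x : U x -> remainder_l x = 0 /\ remainder_n x = 0.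
Proof.
move=> Ux; have [Lu [v1 [v2 [v3 [v4 [k [t eqs]]]]]]] := adapted_lifted.2 x Ux.
have [v1' [v2' [v3' [v4' [k' [t' eqs']]]]]] := change_structure Ux.
have [k0 m0] := change_rest_km Ux.
have dk0 : dfun remainder_k x = 0 by apply: dfun0 => // y Uy; have [] := change_rest_km Uy.
have dm0 : dfun remainder_m x = 0 by apply: dfun0 => // y Uy; have [] := change_rest_km Uy.
exact: (unipotent_order2 Lu eqs eqs' k0 m0 dk0 dm0).
Qed.

Lemma adapted_change x : U x -> [/\ b x != 0, c x != 0 &
  [/\ j1 x = i1 x / c x ^+ 3, j2 x = i2 x / b x ^+ 3 & j3 x = i3 x / b x]].
Proof.
move=> Ux; split; [exact: b0|exact: c0|].
have [Lu [v1 [v2 [v3 [v4 [k [t eqs]]]]]]] := adapted_lifted.2 x Ux.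
have [v1' [v2' [v3' [v4' [k' [t' eqs']]]]]] := change_structure Ux.
have [k0 m0] := change_rest_km Ux; have [l0 n0] := change_rest_ln Ux.
have dz f : (forall y, U y -> f y = 0) -> dfun f x = 0 := dfun0 Ux.
move: eqs'; cbv zeta; rewrite k0 m0 l0 n0 !scale0r !addr0.
rewrite (dz remainder_k) => [|y Uy]; last by have [] := change_rest_km Uy.
rewrite (dz remainder_l) => [|y Uy]; last by have [] := change_rest_ln Uy.
rewrite (dz remainder_m) => [|y Uy]; last by have [] := change_rest_km Uy.
rewrite (dz remainder_n) => [|y Uy]; last by have [] := change_rest_ln Uy.
have w0 y : (0 : 'rV[R]_5) \wedge y = 0 by rewrite /wedge trmx0 mul0mx mulmx0 subr0.
rewrite !w0 !addr0 => eqs'.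
have [e1 e2 e3] := torsion_unique Lu eqs eqs'.
by split.
Qed.

End Change.

End AdaptedCoframes.

(** * Relative invariance *)

Section AdaptedMatrix.
Context {R : realType}.

(** The matrix of the adapted coframe on the initial coframe, and its inverse. *)
Definition hat_mx (a h f b g P : R) : 'M[R]_5 :=
  mx_of_seqs 5 5
    [:: [:: -1; 0; 0; 0; 0]; [:: 0; 1; 0; 0; 0]; [:: a; h; -1; 0; 0];
        [:: 0; 0; 0; 1; f]; [:: b; 0; 0; g; g * f - P]].

Definition hat_inv_mx (a h f b g P : R) : 'M[R]_5 :=
  mx_of_seqs 5 5
    [:: [:: -1; 0; 0; 0; 0]; [:: 0; 1; 0; 0; 0]; [:: - a; h; -1; 0; 0];
        [:: f * b / P; 0; 0; 1 - f * g / P; f / P]; [:: - (b / P); 0; 0; g / P; - P^-1]].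

Lemma hat_mxK a h f b g P : P != 0 -> hat_inv_mx a h f b g P *m hat_mx a h f b g P = 1%:M.
Proof.
move=> P0; apply/matrixP => i j; rewrite [RHS]mxE mxE sum_ord5 !mxE.
case: i => -[|[|[|[|[|//]]]]] ilt; case: j => -[|[|[|[|[|//]]]]] jlt /=.
all: by field; rewrite ?P0.
Qed.

Lemma paraCR_hat_mx a h f b g P : P != 0 -> paraCR_matrix (hat_mx a h f b g P).
Proof.
move=> P0; split; first by have [] := mulmx1_unit (hat_mxK a h f b g P0).
move=> i j; rewrite mxE.
by case: i => -[|[|[|[|[|//]]]]] ?; case: j => -[|[|[|[|[|//]]]]] ?.
Qed.

Lemma paraCR_hat_inv_mx a h f b g P : P != 0 -> paraCR_matrix (hat_inv_mx a h f b g P).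
Proof.
move=> P0; split; first by have [] := mulmx1_unit (hat_mxK a h f b g P0).
move=> i j; rewrite mxE.
by case: i => -[|[|[|[|[|//]]]]] ?; case: j => -[|[|[|[|[|//]]]]] ?.
Qed.

Lemma paraCR_matrixM (A B : 'M[R]_5) :
  paraCR_matrix A -> paraCR_matrix B -> paraCR_matrix (A *m B).
Proof.
move=> [Au A0] [Bu B0]; split; first by rewrite unitmx_mul Au.
move=> i j ij; rewrite mxE big1 // => k _.
have [ik|/A0 ->] := boolP (paraCR_entry i k); last by rewrite mul0r.
have [kj|/B0 ->] := boolP (paraCR_entry k j); last by rewrite mulr0.
case/negP: ij; move: ik kj.
by case: i => -[|[|[|[|[|//]]]]] ?; case: k => -[|[|[|[|[|//]]]]] ?;
  case: j => -[|[|[|[|[|//]]]]] ?.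
Qed.

Lemma hat_mx_rows a h f b g P (W : 'M[R]_5) : hat_mx a h f b g P *m W =
  mx_of_rows 5 [:: - row 0 W; row 1 W; a *: row 0 W + h *: row 1 W - row 2 W;
    row 3 W + f *: row 4 W; b *: row 0 W + g *: row 3 W + (g * f - P) *: row 4 W].
Proof.
apply/row_matrixP => i; rewrite row_mulmx5 row_mx_of_rows /hat_mx.
rewrite /mx_of_seqs !mxE; case: i => -[|[|[|[|[|//]]]]] ilt /=.
all: by rewrite ?(scale0r, addr0, add0r, scaleN1r, scale1r).
Qed.

End AdaptedMatrix.

Section HatCoframe.
Context {R : realType} {M : set 'rV[R]_5} {F : 'rV[R]_4 -> R} {H : 'rV[R]_5 -> R}.
Hypothesis hMFH : integrable_system M F H.
Let oM : open M. Proof. by case: hMFH. Qed.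
Local Notation E := (@evq R F H).

Let hat q := hat_mx (E xa q) (E xh q) (E xFp q) (E xb q) (E xg q) (E xP q).
Let hatV q := hat_inv_mx (E xa q) (E xh q) (E xFp q) (E xb q) (E xg q) (E xP q).

Let P0 q : M q -> E xP q != 0.
Proof. by case: hMFH => _ _ _ h _ /h. Qed.

Lemma omega_hat_mx q : M q -> omega_hat F H q = hat q *m omega F H q.
Proof.
move=> Mq; have [aE hE gE bE PE] := hat_entries hMFH Mq.
have fE : E xFp q = Fp F q by [].
have gPE : E xg q * E xFp q - E xP q
    = (Fppp F q * Fp F q - 3 * Fpp F q ^+ 2) / (3 * Fpp F q) by rewrite fE PE gE subrKC.
by rewrite /hat hat_mx_rows gPE aE hE fE bE gE.
Qed.

Lemma paraCR_class_omega_hat U : open U -> U `<=` M -> paraCR_class F H U (omega_hat F H).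
Proof.
move=> oU UM; exists hat; split; last first.
  move=> q /UM Mq; split; first exact: paraCR_hat_mx (P0 Mq).
  exact: omega_hat_mx.
have se e : smooth U (E e) by move=> s q /UM; exact: smooth_ev.
apply/(smooth_mx oU) => i j.
apply: (eq_on_smooth oU (f := fun q => (nth [::]
  [:: [:: -1; 0; 0; 0; 0]; [:: 0; 1; 0; 0; 0]; [:: E xa q; E xh q; -1; 0; 0];
      [:: 0; 0; 0; 1; E xFp q]; [:: E xb q; 0; 0; E xg q; E xg q * E xFp q - E xP q]] i)`_j)).
  by move=> q _; rewrite mxE.
have sc (a : R) : smooth U (fun=> a) by exact: smooth_cst.
have sP : smooth U (fun q => E xg q * E xFp q - E xP q).
  by apply: (smoothB oU) => //; exact: (smoothM oU).
case: i => -[|[|[|[|[|//]]]]] ?; case: j => -[|[|[|[|[|//]]]]] ?;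
  cbn [nth nat_of_ord]; first [exact: sc | exact: se | exact: sP].
Qed.

(** Para-CR matrices form a group, so the adapted coframe may replace the initial one
    as reference. *)
Lemma paraCR_class_via_omega_hat U W : open U -> U `<=` M -> paraCR_class F H U W ->
  exists A, smooth U A /\ forall q, U q -> paraCR_matrix (A q) /\ W q = A q *m omega_hat F H q.
Proof.
move=> oU UM [C [sC CE]]; exists (fun q => C q *m hatV q); split; last first.
  move=> q Uq; have [pC ->] := CE q Uq; have Mq := UM q Uq; split.
    exact: paraCR_matrixM pC (paraCR_hat_inv_mx _ _ _ _ _ (P0 Mq)).
  by rewrite omega_hat_mx // -!mulmxA (mulmxA (hatV q)) hat_mxK ?P0 // mul1mx.
have se e : smooth U (E e) by move=> s q /UM; exact: smooth_ev.
have PU q : U q -> E xP q != 0 by move=> /UM; exact: P0.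
have sc (a : R) : smooth U (fun=> a) by exact: smooth_cst.
have sPV : smooth U (fun q => (E xP q)^-1) by exact: (smoothV oU PU).
apply: (smooth_mulmx oU sC); apply/(smooth_mx oU) => i j.
apply: (eq_on_smooth oU (f := fun q => (nth [::]
  [:: [:: -1; 0; 0; 0; 0]; [:: 0; 1; 0; 0; 0]; [:: - E xa q; E xh q; -1; 0; 0];
      [:: E xFp q * E xb q / E xP q; 0; 0; 1 - E xFp q * E xg q / E xP q; E xFp q / E xP q];
      [:: - (E xb q / E xP q); 0; 0; E xg q / E xP q; - (E xP q)^-1]] i)`_j)).
  by move=> q _; rewrite mxE.
case: i => -[|[|[|[|[|//]]]]] ?; case: j => -[|[|[|[|[|//]]]]] ?;
  cbn [nth nat_of_ord]; repeat first [exact: sc | exact: se | exact: sPV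
    | apply: (smoothB oU) | apply: (smoothN oU) | apply: (smoothM oU)].
Qed.

Lemma omega_hat_adapted U : U `<=` M ->
  adapted_coframe U (omega_hat F H) (I1 F H) (I2 F H) (I3 F H).
Proof.
move=> UM; split; first by move=> s q /UM; exact: smooth_omega_hat.
move=> q /UM Mq; split; first exact: (omega_hat_unit hMFH).
by do 6!eexists; exact: (omega_hat_structure hMFH Mq).
Qed.

End HatCoframe.

Section Invariance.
Context {R : realType} {M M' : set 'rV[R]_5} {F F' : 'rV[R]_4 -> R} {H H' : 'rV[R]_5 -> R}.
Hypotheses (hMFH : integrable_system M F H) (hMFH' : integrable_system M' F' H').
Variables (U U' : set 'rV[R]_5) (Phi : 'rV[R]_5 -> 'rV[R]_5).
Hypotheses (UM : U `<=` M) (UM' : U' `<=` M').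
Hypothesis PhiE : paraCR_equivalence F F' H H' U U' Phi.
Let oU : open U. Proof. by case: PhiE => -[]. Qed.
Let oU' : open U'. Proof. by case: PhiE => -[]. Qed.
Let sPhi : smooth U Phi. Proof. by case: PhiE => -[]. Qed.
Let PhiU q : U q -> U' (Phi q).
Proof. by case: PhiE => -[_ _ _ [fPhi _ _] _] _; exact: fPhi. Qed.

(** Structure equations are preserved by pull-back, the torsion being composed with
    [Phi]. *)
Lemma pullback_adapted A : smooth U A ->
  (forall q, U q -> paraCR_matrix (A q) /\
    pullback Phi (omega_hat F' H') q = A q *m omega_hat F H q) ->
  adapted_coframe U (fun q => A q *m omega_hat F H q)
    (fun q => I1 F' H' (Phi q)) (fun q => I2 F' H' (Phi q)) (fun q => I3 F' H' (Phi q)).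
Proof.
move=> sA AE; have [sW adW] := omega_hat_adapted hMFH UM.
split; first exact: (smooth_mulmx oU).
move=> q Uq; have [Wu _] := adW q Uq; have [[Au _] Aq] := AE q Uq.
split; first by rewrite unitmx_mul Au.
have [sW' /(_ _ (PhiU Uq)) [_ [v1 [v2 [v3 [v4 [k [t eqs]]]]]]]] := omega_hat_adapted hMFH' UM'.
have dE i : dform (fun x => row i (A x *m omega_hat F H x)) q =
    ('J Phi q)^T^T *m dform (fun x => row i (omega_hat F' H' x)) (Phi q) *m ('J Phi q)^T.
  rewrite trmxK -(dform_pullback oU sPhi Uq).
    apply: (eq_on_dform oU Uq) => x Ux; have [_ <-] := AE x Ux.
    by rewrite /pullback row_mul.
  exact: smooth_differentiable (smooth_row i oU' sW') (PhiU Uq).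
have rE i : row i (A q *m omega_hat F H q) = row i (omega_hat F' H' (Phi q)) *m ('J Phi q)^T.
  by rewrite -Aq /pullback row_mul.
rewrite /= !dE !rE; do 6!eexists; exact: (structure_eqs_mulmx _ eqs).
Qed.

Lemma invariants_transform q : U q -> exists b c, [/\ b != 0, c != 0 &
  [/\ I1 F' H' (Phi q) = I1 F H q / c ^+ 3, I2 F' H' (Phi q) = I2 F H q / b ^+ 3
    & I3 F' H' (Phi q) = I3 F H q / b]].
Proof.
move=> Uq; have cls := (PhiE.2 _).1 (paraCR_class_omega_hat hMFH' oU' UM').
have [A [sA AE]] := paraCR_class_via_omega_hat hMFH oU UM cls.
have := adapted_change oU sA (fun x Ux => (AE x Ux).1) (omega_hat_adapted hMFH UM)
  (pullback_adapted sA AE) Uq.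
by exists (A q 1 1), (A q 3 3).
Qed.

End Invariance.

Theorem theorem1p1 (R : realType) (M : set 'rV[R]_5) (F : 'rV[R]_4 -> R)
    (H : 'rV[R]_5 -> R) (hMFH : integrable_system M F H) :
  [/\ exists I3_4 I3_5 I3_52 : 'rV[R]_5 -> R,
        I3_derivatives M F H I3_4 I3_5 I3_52,
      forall I3_4 I3_5 I3_52 : 'rV[R]_5 -> R,
        I3_derivatives M F H I3_4 I3_5 I3_52 ->
        exists Omega : 'rV[R]_9 -> 'M[R]_(4, 9),
          smooth (G9 M) Omega /\
          forall u, G9 M u ->
            row_free (col_mx (theta F H u) (Omega u)) /\
            paraCR_EDS F H I3_4 I3_5 I3_52 Omega u
    & [/\ relative_invariant (@I1 R), relative_invariant (@I2 R)
        & relative_invariant (@I3 R)]].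
Proof.
split.
- by do 3!eexists; exact: (I3_derivatives_exist hMFH).
- move=> K4 K5 K52 HK; exists (@bundle_connection _ F H).
  split; first exact: (smooth_bundle_connection hMFH).
  by move=> u Gu; split; [exact: (row_free_bundle hMFH)|exact: (bundle_EDS hMFH HK)].
have div0 (x y : R) : y != 0 -> x = 0 <-> x / y = 0.
  move=> y0; split=> [->|/eqP]; first by rewrite mul0r.
  by rewrite mulf_eq0 invr_eq0 (negPf y0) orbF => /eqP.
split=> N N' f f' h h' U U' Phi hN hN' UN UN' PhiE q Uq;
  have [b [c [b0 c0 [e1 e2 e3]]]] := invariants_transform hN hN' UN UN' PhiE Uq.
- by rewrite e1; apply: div0; rewrite expf_neq0.
- by rewrite e2; apply: div0; rewrite expf_neq0.
- by rewrite e3; exact: div0.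
Qed.
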